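(* Let $k\geq1$ and let $L(k)$ be either $L_k$ or $\mathcal{L}_k$. The homology classes of the stable cycles $\widehat e_I$, where $I$ runs over main $k$-partitions, form a basis of $H_*(L(k))$.
   Context: Algebras and complex. Everything is over $\mathbb{Q}$. $L_k$ (resp. $\mathcal{L}_k$) is the Lie algebra with basis $e_i$, $i\geq k$, and bracket $[e_a,e_b]=\mu(b-a)e_{a+b}$, where $\mu(z)=z$ for $L_k$ and $\mu(z)=\varepsilon_z$ for $\mathcal{L}_k$, with $\varepsilon_z\in\{-1,0,1\}$, $\varepsilon_z\equiv z\bmod 3$. $C_q(L(k))=\bigwedge^qL(k)$ has the basis $e_I=e_{i_1}\wedge\dots\wedge e_{i_q}$, $I=(i_1,\dots,i_q)$, $k\leq i_1<\dots<i_q$; the inner product $\langle\,,\rangle$ makes this basis orthonormal. The boundary operator is $d(e_{i_1}\wedge\dots\wedge e_{i_q})=\sum_{r<s}(-1)^{r+s-1}\mu(i_s-i_r)e_{i_r+i_s}\wedge e_{i_1}\wedge\dots\widehat{e}_{i_r}\dots\widehat{e}_{i_s}\dots\wedge e_{i_q}$, $H_*(L(k))$ is the homology of $(C_*(L(k)),d)$, and $\delta_k$ is the adjoint of $d$, the antiderivation with $\delta_k(e_i)=\sum_{a+b=i,\,k\leq a<b}\mu(b-a)e_a\wedge e_b$. A chain $x$ is a stable cycle if $d(\sigma^rx)=0$ for all $r\geq0$, where $\sigma(e_{i_1}\wedge\dots\wedge e_{i_q})=e_{i_1+1}\wedge\dots\wedge e_{i_q+1}$. Partitions. A $k$-partition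 is $I=(i_1,\dots,i_q)$ with integers $k\leq i_1\leq\dots\leq i_q$; nonsingular if $i_{r+1}-i_r\geq3$ for all $r$. A nonsingular $k$-partition is main if $i_q\leq 2k+3(q-1)$ when $i_1>k$ and $i_q<2k+3(q-1)$ when $i_1=k$; the empty partition is main. A $k$-partition is dense if $i_1>2k$ and $i_{r+1}-i_r=3$ for all $r$. The normal form of a nonsingular $k$-partition is the unique representation $I=I_0\cup I_1\cup\dots\cup I_m$ where $I_0$ is main, $I_1,\dots,I_m$ dense, each of maximal possible dimension (i.e. $I_0$ is the longest main initial segment, the others are the maximal blocks of consecutive remaining parts with successive differences exactly $3$). The leading parts are the minimal parts $I_a(1)$ of $I_a$, $a\geq1$. A nonsingular distinguished $k$-partition is a pair $(I;J)$, $I$ nonsingular, $J$ a subset of its leading parts. The $\xi(k)$-monomial is $\xi_{(I;J)}=\xi_{I_0}\wedge\xi_{I_1}\wedge\dots\wedge\xi_{I_m}$, where $\xi_{I_0}=e_{I_0}$ and, for $a\geq1$, $\xi_{I_a}=e_{I_a}$ if $I_a(1)\notin J$, $\xi_{I_a}=\delta_k(e_{I_a})$ if $I_a(1)\in J$. The $\xi(k)$-monomials form a basis of $C_*(L(k))$. $\{\widehat\xi_{(I;J)}\}$ is the dual basis: $\langle\widehat\xi_{(I;J)},\xi_{(I';J')}\rangle=1$ if $(I;J)=(I';J')$ and $0$ otherwise; $\widehat e_I=\widehat\xi_{(I;\emptyset)}$, which is a stable cycle for every nonsingular $I$. *)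

(* Defs.v *)
From HB Require Import structures.
From mathcomp Require Import all_boot all_order all_algebra.
From mathcomp Require Import finmap.
From mathcomp.multinomials Require Import monalg.
From mathcomp Require boolp classical_sets.

Set Implicit Arguments.
Unset Strict Implicit.
Unset Printing Implicit Defensive.

Import GRing.Theory.

Local Open Scope fset_scope.
Local Open Scope ring_scope.
Local Open Scope quotient_scope.

(* Bases of a possibly infinite-dimensional vector space, indexed by T. *)

Definition lin_indep (K : fieldType) (V : lmodType K) (T : choiceType)
    (b : T -> V) : Prop :=
  forall (s : seq T) (a : T -> K), uniq s ->
    \sum_(t <- s) a t *: b t = 0 -> forall t, t \in s -> a t = 0.

Definition spanning (K : fieldType) (V : lmodType K) (T : choiceType)
    (b : T -> V) : Prop :=
  forall v : V, exists (s : seq T) (a : T -> K), v = \sum_(t <- s) a t *: b t.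

Definition is_basis (K : fieldType) (V : lmodType K) (T : choiceType)
    (b : T -> V) : Prop :=
  lin_indep b /\ spanning b.

(* L_k is the family L_int, and \mathcal{L}_k is the family L_mod3; in both
   cases [e_a, e_b] = mu (b - a) e_(a + b) for a, b >= k. *)

Variant lie_family := L_int | L_mod3.

Definition eps3 (z : int) : int :=
  if (z %% 3 == 0)%Z then 0 else if (z %% 3 == 1)%Z then 1 else -1.

Definition mu (g : lie_family) (z : int) : rat :=
  match g with L_int => z%:~R | L_mod3 => (eps3 z)%:~R end.

(* The exterior algebra C_* = \bigoplus_q C_q on the e_i, i >= k, as the space
   of finitely supported rational functions on its basis. *)

Definition is_index (k : nat) (I : seq nat) : bool :=
  sorted ltn I && all (leq k) I.

Definition chain_index (k : nat) := {I : seq nat | is_index k I}.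

Notation chain k := {malg rat[chain_index k]}.

Fixpoint inversions (s : seq nat) : nat :=
  if s is x :: s' then (count (fun y => (y < x)%N) s' + inversions s')%N
  else 0%N.

(* e_(s_1) /\ ... /\ e_(s_q) for an arbitrary sequence s of integers >= k: it
   is 0 when s has a repetition, since then sort leq s is not an index. *)
Definition ewedge (k : nat) (s : seq nat) : chain k :=
  if (insub (sort leq s) : option (chain_index k)) is Some t
  then << (-1) ^+ inversions s *g t >> else 0.

Definition wedge (k : nat) (x y : chain k) : chain k :=
  \sum_(I <- msupp x) \sum_(J <- msupp y)
     (x@_I * y@_J) *: ewedge k (val I ++ val J).

Definition inner (k : nat) (x y : chain k) : rat :=
  \sum_(I <- msupp x) x@_I * y@_I.

Definition lin_ext (k : nat) (f : seq nat -> chain k) (x : chain k) : chain k :=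
  \sum_(I <- msupp x) x@_I *: f (val I).

Lemma lin_extEw (k : nat) (f : seq nat -> chain k) (x : chain k)
    (D : {fset chain_index k}) : msupp x `<=` D ->
  lin_ext f x = \sum_(I <- D) x@_I *: f (val I).
Proof.
move=> sxD; rewrite /lin_ext (big_fset_incl _ sxD) // => I _ /mcoeff_outdom ->.
by rewrite scale0r.
Qed.

Lemma lin_ext_is_linear (k : nat) (f : seq nat -> chain k) :
  linear (lin_ext f).
Proof.
move=> a x y; pose D := msupp (a *: x + y) `|` (msupp x `|` msupp y).
have s1 : msupp (a *: x + y) `<=` D by apply: fsubsetUl.
have s2 : msupp x `<=` D.
  by apply: fsubset_trans (fsubsetUl _ (msupp y)) (fsubsetUr _ _).
have s3 : msupp y `<=` D.
  by apply: fsubset_trans (fsubsetUr (msupp x) _) (fsubsetUr _ _).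
rewrite (lin_extEw f s1) (lin_extEw f s2) (lin_extEw f s3).
rewrite scaler_sumr -big_split /=; apply: eq_bigr => I _.
by rewrite mcoeffD mcoeffZ scalerDl scalerA.
Qed.

HB.instance Definition _ (k : nat) (f : seq nat -> chain k) :=
  GRing.isLinear.Build rat (chain k) (chain k) _ (lin_ext f)
    (@lin_ext_is_linear k f).

(* The operators d, delta and sigma are given on e_I for an index I; positions
   r, s are counted from 0, which accounts for the signs. *)

Definition del2 (r s : nat) (I : seq nat) : seq nat :=
  [seq nth 0%N I t | t <- iota 0 (size I) & (t != r) && (t != s)].

Definition bd_basis (g : lie_family) (k : nat) (I : seq nat) : chain k :=
  \sum_(r < size I) \sum_(s < size I | (r < s)%N)
    ((-1) ^+ (r + s + 1) * mu g ((nth 0%N I s)%:Z - (nth 0%N I r)%:Z)) *: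
      ewedge k ((nth 0%N I r + nth 0%N I s)%N :: del2 r s I).

Definition bd (g : lie_family) (k : nat) : chain k -> chain k :=
  lin_ext (bd_basis g k).

HB.instance Definition _ (g : lie_family) (k : nat) :=
  GRing.Linear.copy (@bd g k) (lin_ext (bd_basis g k)).

Definition cobd_basis (g : lie_family) (k : nat) (I : seq nat) : chain k :=
  \sum_(r < size I)
    \sum_(a < (nth 0%N I r).+1)
      \sum_(b < (nth 0%N I r).+1 | (k <= a < b)%N && (a + b == nth 0 I r)%N)
        ((-1) ^+ r * mu g (b%:Z - a%:Z)) *:
          ewedge k (take r I ++ [:: val a; val b] ++ drop r.+1 I).

Definition cobd (g : lie_family) (k : nat) : chain k -> chain k :=
  lin_ext (cobd_basis g k).

Definition shift (k : nat) : chain k -> chain k :=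
  lin_ext (fun I => ewedge k (map succn I)).

Definition stable_cycle (g : lie_family) (k : nat) (x : chain k) : Prop :=
  forall r : nat, bd g (iter r (@shift k) x) = 0.

(* H_* = ker d / im d as a vector space over rat. *)

Section Homology.
Context (g : lie_family) (k : nat).

Definition is_cycle : pred (chain k) := fun x => bd g x == 0.

Lemma is_cycle_submod : submod_closed is_cycle.
Proof.
split=> [|a x y]; first by rewrite unfold_in /is_cycle raddf0.
rewrite !unfold_in /is_cycle => /eqP hx /eqP hy.
by rewrite linearP /= hx hy scaler0 addr0.
Qed.

HB.instance Definition _ :=
  GRing.isSubmodClosed.Build rat (chain k) is_cycle is_cycle_submod.

Record cycles := Cycle { cycle_val : chain k; _ : cycle_val \in is_cycle }.

HB.instance Definition _ := [isSub for cycle_val].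
HB.instance Definition _ := [Choice of cycles by <:].
HB.instance Definition _ := [SubChoice_isSubLmodule of cycles by <:].

Definition is_boundary : pred cycles :=
  fun z => boolp.asbool (exists y : chain k, val z = bd g y).

Lemma is_boundary_submod : submod_closed is_boundary.
Proof.
split=> [|a x y].
  by apply/boolp.asboolP; exists 0; rewrite !linear0.
move=> /boolp.asboolP[u hu] /boolp.asboolP[v hv].
by apply/boolp.asboolP; exists (a *: u + v); rewrite !linearP /= -hu -hv.
Qed.

HB.instance Definition _ :=
  GRing.isSubmodClosed.Build rat cycles is_boundary is_boundary_submod.

Definition homology :=
  Quotient.quot (GRing.ZmodClosed.clone cycles is_boundary _).

HB.instance Definition _ := ZmodQuotient.on homology.

Definition homology_scale (a : rat) (h : homology) : homology :=
  \pi_homology (a *: repr h).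

Lemma pi_homology_scale (a : rat) (z : cycles) :
  homology_scale a (\pi_homology z) = \pi_homology (a *: z).
Proof.
apply/eqP; rewrite -Quotient.idealrBE -scalerBr rpredZ //.
by rewrite Quotient.idealrBE reprK.
Qed.

Lemma homology_scaleA (a b : rat) (h : homology) :
  homology_scale a (homology_scale b h) = homology_scale (a * b) h.
Proof. rewrite -[h]reprK; move: (repr h) => z.
by rewrite (pi_homology_scale b z) !pi_homology_scale scalerA. Qed.

Lemma homology_scale1 : left_id 1 homology_scale.
Proof. by move=> h; rewrite -[h]reprK pi_homology_scale scale1r. Qed.

Lemma homology_scaleDr : right_distributive homology_scale +%R.
Proof.
move=> a h1 h2; rewrite -[h1]reprK -[h2]reprK -raddfD !pi_homology_scale.
by rewrite scalerDr raddfD.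
Qed.

Lemma homology_scaleDl (h : homology) :
  {morph homology_scale^~ h : a b / a + b}.
Proof.
by move=> a b; rewrite -[h]reprK !pi_homology_scale scalerDl raddfD.
Qed.

HB.instance Definition _ := GRing.Zmodule_isLmodule.Build rat homology
  homology_scaleA homology_scale1 homology_scaleDr homology_scaleDl.

Definition hclass (x : chain k) (hx : bd g x = 0) : homology :=
  \pi_homology (Cycle (introT eqP hx : x \in is_cycle)).

End Homology.

Definition kpartition (k : nat) (I : seq nat) : bool := path leq k I.

Definition nonsingular (I : seq nat) : bool :=
  sorted (fun a b => (a + 3 <= b)%N) I.

Definition is_main (k : nat) (I : seq nat) : bool :=
  [&& kpartition k I, nonsingular I &
    if I is i1 :: _ then
      let bound := (2 * k + 3 * (size I).-1)%N in
      if i1 == k then (last 0 I < bound)%N else (last 0 I <= bound)%N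
    else true].

Definition main_partition (k : nat) := {I : seq nat | is_main k I}.

Definition main_length (k : nat) (I : seq nat) : nat :=
  \max_(p < (size I).+1 | is_main k (take p I)) p.

(* The maximal blocks of consecutive parts with successive differences 3. *)
Fixpoint runs (I : seq nat) : seq (seq nat) :=
  if I is x :: I' then
    match runs I' with
    | (y :: b) :: bs =>
        if y == (x + 3)%N then (x :: y :: b) :: bs
        else [:: x] :: (y :: b) :: bs
    | bs => [:: x] :: bs
    end
  else [::].

(* The normal form of I is main_part k I followed by dense_parts k I. *)
Definition main_part (k : nat) (I : seq nat) : seq nat :=
  take (main_length k I) I.

Definition dense_parts (k : nat) (I : seq nat) : seq (seq nat) :=
  runs (drop (main_length k I) I).

Lemma main_part_normal_form (k : nat) (I : seq nat) :
  main_part k I ++ flatten (dense_parts k I) = I.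
Proof.
rewrite -[RHS](cat_take_drop (main_length k I)) /dense_parts; congr (_ ++ _).
elim: (drop _ _) => //= x s.
by case: (runs s) => [|[|y b] bs] /= <- //; case: ifP.
Qed.

Definition is_dense (k : nat) (I : seq nat) : bool :=
  (2 * k < head 0 I)%N && sorted (fun a b => b == a + 3)%N I.

Lemma runs_dense (k : nat) (s : seq nat) :
  all (fun x => 2 * k < x)%N s -> all (is_dense k) (runs s).
Proof.
elim: s => //= x s IHs /andP[hx /IHs].
case: (runs s) => [|[|y b] bs] /=; first by rewrite /is_dense /= hx.
  by rewrite /is_dense /= hx.
have [->|_] := eqVneq y (x + 3)%N; last by rewrite /= /is_dense /= hx.
by rewrite /is_dense /= hx eqxx /= => /andP[/andP[_ ->]].
Qed.

Lemma dense_parts_dense (k : nat) (I : seq nat) :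
  (1 <= k)%N -> kpartition k I -> nonsingular I ->
  all (is_dense k) (dense_parts k I).
Proof.
move=> k_gt0 kI nI; apply: runs_dense; set p := main_length k I.
have sI : sorted leq I by apply: path_sorted kI.
have [lt_pI|le_Ip] := ltnP p (size I); last by rewrite drop_oversize.
have hp : (2 * k < nth 0 I p)%N.
  have : ~~ is_main k (take p.+1 I).
    apply/negP => h; suff: (p.+1 <= p)%N by rewrite ltnn.
    exact: (bigmax_sup (Ordinal (lt_pI : p.+1 < (size I).+1)%N)).
  rewrite /is_main /kpartition take_path // /nonsingular take_sorted //=.
  have -> : last 0%N (take p.+1 I) = nth 0%N I p.
    by rewrite (take_nth 0%N lt_pI) last_rcons.
  rewrite size_takel //=; case: (I) lt_pI kI => //= i1 s _ /andP[le_ki1 _].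
  case: eqP => [->|_]; rewrite -?leqNgt -?ltnNge; last first.
    by apply: leq_ltn_trans; rewrite leq_addr.
  case: (p) => [|q] /= h; last first.
    by apply: leq_trans h; rewrite mulnS -[ltnLHS]addn0 ltn_add2l.
  by move: h; rewrite muln0 addn0 mul2n -addnn -{3}[k]addn0 leq_add2l leqNgt k_gt0.
apply/allP => x /(nthP 0%N)[j]; rewrite size_drop => lt_j <-.
rewrite nth_drop; apply: (leq_trans hp).
apply: (sorted_leq_nth leq_trans leqnn) => //; rewrite ?inE ?leq_addr //.
by rewrite -ltn_subRL.
Qed.

Definition leading (k : nat) (I : seq nat) : {fset nat} :=
  [fset head 0%N b | b in dense_parts k I].

Definition distinguished (k : nat) (I : seq nat) (J : {fset nat}) : bool :=
  [&& kpartition k I, nonsingular I & J `<=` leading k I].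

Definition xi (g : lie_family) (k : nat) (I : seq nat) (J : {fset nat}) :
    chain k :=
  foldr (@wedge k) (ewedge k [::])
    (ewedge k (main_part k I) ::
     [seq if head 0%N b \in J then cobd g (ewedge k b) else ewedge k b
        | b <- dense_parts k I]).

Definition is_dual (g : lie_family) (k : nat) (I : seq nat) (J : {fset nat})
    (x : chain k) : Prop :=
  forall (I' : seq nat) (J' : {fset nat}), distinguished k I' J' ->
    inner x (xi g k I' J') = ((I == I') && (J == J'))%:R.

(* The element of the dual basis attached to (I; J). The fallback value 0 is
   only there to make the definition total: the xi (I; J) form a basis of C_*
   with finitely many elements in each weight, so is_dual g I J has exactly
   one solution for every distinguished (I; J). *)
Definition xihat (g : lie_family) (k : nat) (I : seq nat) (J : {fset nat}) :
    chain k :=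
  classical_sets.xget 0 (@is_dual g k I J).

Definition ehat (g : lie_family) (k : nat) (I : seq nat) : chain k :=
  xihat g k I fset0.

(* Main.v *)
(* Let u_n denote multiplication by delta(e_n).  Jacobi-type identities yield
   relations sum_p r(p) e_p u_(s-p) = 0 in which r can be prescribed on three
   consecutive p.  With them every monomial in the e_i and u_j becomes a
   combination of xi(k)-monomials, all with J nonempty if some u_j occurs; the
   induction is on a rank that drops when two parts merge or move apart.  In each
   weight there are at most as many distinguished pairs as vectors e_I, so the
   xi(k)-monomials form a basis and the dual basis exists.  The span of the
   monomials containing some u_j is preserved by the adjoint of sigma, contains
   the image of delta and is orthogonal to the hat e_I; hence these are stable
   cycles.
   Removing from J the head of the first dense block is, up to sign and terms of
   lower rank, a contracting homotopy for delta on the monomials that are not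
   main.  So each main e_I is completed by such monomials to a cocycle c_I, the
   c_I are dual to the main hat e_I, and they span the cocycles modulo im delta.
   The theorem follows since, weight by weight, im d is the orthogonal
   complement of ker delta. *)
Require Import Defs.
From mathcomp Require Import all_boot all_order all_algebra.
From HB Require Import structures.
From mathcomp Require Import finmap zify ring lra.
From mathcomp.multinomials Require Import monalg.
From mathcomp Require boolp classical_sets.

Set Implicit Arguments.
Unset Strict Implicit.
Unset Printing Implicit Defensive.

Import GRing.Theory Num.Theory.

Local Open Scope fset_scope.
Local Open Scope ring_scope.
(** * Words in anticommuting operators *)

(** A relation r of weight s can be prescribed at p, p+1, p+2 unless s = 3p+3, when the triple (p,
    p+1, p+2) itself ties these values together. This fixes the shape of the definitions. A window
    of length 3 lets any two factors at distance at most 2 be rewritten; at distance exactly 3, e_p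
    u_(p+3) can only be exchanged for u_p e_(p+3), which is why dense blocks appear. The bound for
    main partitions comes from pushing u_b leftwards through the main part: each e_a passed either
    lowers the rank or lowers the index of u by at least 3, until this index is at most 2k and u is
    0. The strict inequality for i_1 = k keeps out e_k u_(2k+3), which has the excluded weight. The
    one place where leading terms could cancel is the expansion of delta on a dense block; there the
    sign of r(p+3) for s = 2p+3 makes all contributions positive. The computations are made for
    anticommuting operators on an abstract vector space; chains are recovered as words of operators
    applied to the vacuum. *)

Lemma inversions_sorted s : sorted leq s -> inversions s = 0%N.
Proof.
elim: s => //= a s IHs; rewrite path_sortedE; last exact: leq_trans.
case/andP=> /allP le_as /IHs ->; rewrite addn0; apply/eqP.
rewrite -leqn0 leqNgt -has_count; apply/hasPn => b /le_as.
by rewrite -leqNgt.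
Qed.

Section Words.
Variables (V : lmodType rat) (e : nat -> {linear V -> V}).
Hypothesis eC : forall i j x, e i (e j x) = - e j (e i x).
Implicit Types (s t : seq nat) (x y : V).

Definition emuls s x := foldr (fun i => e i) x s.

Lemma emulsP s : linear (emuls s).
Proof. by move=> a x y; elim: s => //= i s ->; rewrite linearP. Qed.

HB.instance Definition _ s :=
  GRing.isLinear.Build rat V V _ (emuls s) (@emulsP s).

Lemma emuls_cat s t x : emuls (s ++ t) x = emuls s (emuls t x).
Proof. exact: foldr_cat. Qed.

Lemma ee0 i x : e i (e i x) = 0.
Proof.
have /eqP := eC i i x; rewrite -addr_eq0 -mulr2n -scaler_nat scaler_eq0.
by rewrite pnatr_eq0 => /eqP.
Qed.

Lemma e_emuls i s x : e i (emuls s x) = (-1) ^+ size s *: emuls s (e i x).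
Proof.
elim: s => [|j s IHs] /=; first by rewrite scale1r.
by rewrite eC IHs linearZ /= exprS mulN1r scaleNr.
Qed.

Lemma emuls_rem s i x : i \in s ->
  emuls s x = (-1) ^+ index i s *: e i (emuls (rem i s) x).
Proof.
elim: s => //= j s IHs; rewrite in_cons eq_sym; have [->|ne_ij] //= := eqVneq.
  by rewrite scale1r.
by move=> /IHs ->; rewrite linearZ /= eC exprS mulN1r scaleNr scalerN.
Qed.

(** The sign is left existential because only spans matter later; one sign serves all [x]. *)
Lemma emuls_perm s t : perm_eq s t ->
  exists b : bool, forall x, emuls s x = (-1) ^+ b *: emuls t x.
Proof.
elim: s t => [|i s IHs] t.
  by rewrite perm_sym => /perm_nilP ->; exists false => x; rewrite scale1r.
move=> pst; have it : i \in t by rewrite -(perm_mem pst) mem_head.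
have /IHs[b sE] : perm_eq s (rem i t).
  by rewrite -(perm_cons i); apply: perm_trans pst (perm_to_rem it).
exists (b (+) odd (index i t)) => x.
rewrite /= sE (emuls_rem _ it) linearZ /= scalerA.
by rewrite signr_addb -mulrA signr_odd -expr2 sqrr_sign mulr1.
Qed.

Lemma emuls_dup s x : ~~ uniq s -> emuls s x = 0.
Proof.
elim: s => //= i s IHs; rewrite negb_and negbK => /orP[is_|/IHs ->]; last first.
  by rewrite linear0.
by rewrite (emuls_rem _ is_) linearZ /= ee0 scaler0.
Qed.

Lemma emuls_mem0 s x i : (forall y, e i y = 0) -> i \in s -> emuls s x = 0.
Proof. by move=> e0 is_; rewrite (emuls_rem _ is_) e0 scaler0. Qed.

End Words.
(** * The exterior algebra *)

Section Exterior.
Variable k : nat.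
Implicit Types (s t : seq nat) (x y : chain k) (I : chain_index k).

Lemma malgUZ (a : rat) I : << a *g I >> = a *: << I >> :> chain k.
Proof.
apply/malgP => J; rewrite mcoeffZ.
by rewrite [LHS]mcoeffU [X in _ = _ * X]mcoeffU mulr_natr.
Qed.

Lemma is_indexP s :
  reflect [/\ sorted leq s, uniq s & all (leq k) s] (is_index k s).
Proof.
rewrite /is_index ltn_sorted_uniq_leq.
by apply: (iffP andP) => [[/andP[? ?] ?]|[-> -> ->]].
Qed.

Lemma is_index_sort s :
  is_index k (sort leq s) = uniq s && all (leq k) s.
Proof.
rewrite /is_index ltn_sorted_uniq_leq sort_uniq all_sort.
by rewrite (sort_sorted leq_total) andbT.
Qed.

Lemma ewedge_index I : ewedge k (val I) = << I >>.
Proof.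
have /is_indexP[sI uI kI] := valP I.
rewrite /ewedge sorted_sort //; last exact: leq_trans.
by rewrite valK inversions_sorted.
Qed.

Lemma ewedge_eq0 s : ~~ (uniq s && all (leq k) s) -> ewedge k s = 0.
Proof. by rewrite -is_index_sort /ewedge => ns; rewrite insubN. Qed.

Lemma ewedge_sort s :
  ewedge k s = (-1) ^+ inversions s *: ewedge k (sort leq s).
Proof.
have [us|nus] := boolP (uniq s && all (leq k) s); last first.
  by rewrite !ewedge_eq0 ?scaler0 // sort_uniq all_sort.
rewrite -is_index_sort in us.
rewrite [LHS]/ewedge; case: insubP => [I _ <-|/negP//].
by rewrite ewedge_index malgUZ.
Qed.

Lemma chain_ind (P : chain k -> Prop) :
  (forall a x y, P x -> P y -> P (a *: x + y)) ->
  (forall I, P (ewedge k (val I))) -> forall x, P x.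
Proof.
move=> Plin Pidx x.
have nil_index : is_index k [::] by [].
have P0 : P 0.
  have := Plin (-1) _ _ (Pidx (Sub [::] nil_index)) (Pidx (Sub [::] nil_index)).
  by rewrite scaleN1r addNr.
rewrite [x]monalgE; elim/big_ind: _ => // [y z Py Pz|I _].
  by rewrite -[y]scale1r; apply: Plin.
suff -> : << x@_I *g I >> = x@_I *: ewedge k (val I) + 0 by apply: Plin.
by rewrite addr0 ewedge_index malgUZ.
Qed.

Lemma lin_ext_index (f : seq nat -> chain k) I :
  lin_ext f (ewedge k (val I)) = f (val I).
Proof.
rewrite (@lin_extEw _ _ _ [fset I]).
  by rewrite big_seq_fset1 ewedge_index mcoeffUU scale1r.
by rewrite ewedge_index; apply: msuppU_le.
Qed.

Fact emul_key : unit. Proof. by []. Qed.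

(* Locked, since unification would otherwise unfold sums over supports. *)
Definition emul : nat -> chain k -> chain k :=
  locked_with emul_key (fun i => lin_ext (fun s => ewedge k (i :: s))).

Lemma emulP i a x y : emul i (a *: x + y) = a *: emul i x + emul i y.
Proof. by rewrite /emul unlock linearP. Qed.

HB.instance Definition _ i :=
  GRing.isLinear.Build rat (chain k) (chain k) _ (emul i) (@emulP i).

Lemma emul_index i I : emul i (ewedge k (val I)) = ewedge k (i :: val I).
Proof. by rewrite /emul unlock lin_ext_index. Qed.

(** Sorting [s] preserves the number of entries below [i], so the inversions of [i :: s] are those
    of [s] plus those between [i] and the sorted word. This turns [ewedge] into a word of operators,
    sorted or not. *)
Lemma ewedge_cons i s : ewedge k (i :: s) = emul i (ewedge k s).
Proof.
have [us|nus] := boolP (uniq s && all (leq k) s); last first.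
  rewrite (ewedge_eq0 nus) linear0 ewedge_eq0 //=.
  by move: nus; rewrite !negb_and => /orP[] ->; rewrite ?orbT.
rewrite [ewedge k s]ewedge_sort linearZ /=.
rewrite -is_index_sort in us.
rewrite (emul_index i (Sub (sort leq s) us)) /=.
rewrite [LHS]ewedge_sort [in RHS]ewedge_sort scalerA -exprD.
have -> : sort leq (i :: sort leq s) = sort leq (i :: s).
  apply/perm_sortP; [exact: leq_total|exact: leq_trans|exact: anti_leq|].
  by rewrite perm_cons perm_sort.
suff -> : inversions (i :: s) = (inversions s + inversions (i :: sort leq s))%N.
  by [].
rewrite /= count_sort (inversions_sorted (sort_sorted leq_total s)).
by rewrite addn0 addnC.
Qed.

Fact vac_key : unit. Proof. by []. Qed.

Definition vac : chain k := locked_with vac_key (ewedge k [::]).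

Notation emuls := (emuls (fun i => emul i : {linear chain k -> chain k})).

Lemma ewedgeE s : ewedge k s = emuls s vac.
Proof. by elim: s => [|i s IHs] /=; rewrite ?ewedge_cons ?IHs // /vac unlock. Qed.

Lemma emuls_eq0 s : ~~ (uniq s && all (leq k) s) -> emuls s vac = 0.
Proof. by rewrite -ewedgeE; apply: ewedge_eq0. Qed.

Lemma emuls_vac_sort s :
  emuls s vac = (-1) ^+ inversions s *: emuls (sort leq s) vac.
Proof. by rewrite -!ewedgeE; apply: ewedge_sort. Qed.

Lemma chain_emuls_ind (P : chain k -> Prop) :
  (forall a x y, P x -> P y -> P (a *: x + y)) ->
  (forall I, P (emuls (val I) vac)) -> forall x, P x.
Proof. by move=> ? PI; apply: chain_ind => // I; rewrite ewedgeE; apply: PI. Qed.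

Lemma emul_small i x : (i < k)%N -> emul i x = 0.
Proof.
move=> lt_ik; elim/chain_emuls_ind: x => [a x y hx hy|I].
  by rewrite emulP hx hy scaler0 addr0.
by apply: (@emuls_eq0 (i :: val I)); rewrite /= leqNgt lt_ik andbF.
Qed.

(** Exchanging two distinct leading entries changes the number of inversions by one and leaves the
    sorted word alone; for equal indices both sides are 0. *)
Lemma emulC i j x : emul i (emul j x) = - emul j (emul i x).
Proof.
elim/chain_emuls_ind: x => [a x y hx hy|I].
  by rewrite !emulP hx hy scalerN -opprD.
rewrite -[LHS]/(emuls [:: i, j & val I] vac)
  -[emul j (emul i _)]/(emuls [:: j, i & val I] vac).
have [->|ne_ij] := eqVneq i j.
  by rewrite emuls_eq0 ?oppr0 //= mem_head.
rewrite [LHS]emuls_vac_sort [in RHS]emuls_vac_sort.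
have -> : sort leq [:: j, i & val I] = sort leq [:: i, j & val I].
  apply/perm_sortP; [exact: leq_total|exact: leq_trans|exact: anti_leq|].
  by rewrite (perm_catCA [:: j] [:: i] (val I)).
suff -> : (-1) ^+ inversions [:: i, j & val I] =
          - (-1) ^+ inversions [:: j, i & val I] :> rat by rewrite scaleNr.
rewrite -[RHS]mulN1r -exprS -[LHS]signr_odd -[RHS]signr_odd.
suff -> : odd (inversions [:: i, j & val I]) =
          odd (inversions [:: j, i & val I]).+1 by [].
move: ne_ij; rewrite /= ltnNge; case: ltngtP => //= _ _; rewrite !oddD /=;
  by do 3!case: (odd _).
Qed.

Lemma wedgeE x y : wedge x y = \sum_(I <- msupp x) x@_I *: emuls (val I) y.
Proof.
rewrite /wedge; apply: eq_bigr => I _.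
under eq_bigr do rewrite ewedgeE emuls_cat -scalerA.
rewrite -scaler_sumr; congr (_ *: _).
rewrite [in RHS](monalgE y) raddf_sum /=; apply: eq_bigr => J _.
by rewrite malgUZ linearZ /= -ewedgeE ewedge_index.
Qed.

Lemma wedgeEw (D : {fset chain_index k}) x y : msupp x `<=` D ->
  wedge x y = \sum_(I <- D) x@_I *: emuls (val I) y.
Proof.
move=> sD; rewrite wedgeE (big_fset_incl _ sD) // => I _ /mcoeff_outdom ->.
by rewrite scale0r.
Qed.

Lemma wedgeP a x y z : wedge (a *: x + y) z = a *: wedge x z + wedge y z.
Proof.
pose D := msupp (a *: x + y) `|` (msupp x `|` msupp y).
have s1 : msupp (a *: x + y) `<=` D by rewrite fsubsetUl.
have s2 : msupp x `<=` D by rewrite /D fsetUCA fsubsetUl.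
have s3 : msupp y `<=` D by rewrite /D fsetUA fsubsetUr.
rewrite (wedgeEw z s1) (wedgeEw z s2) (wedgeEw z s3).
rewrite scaler_sumr -big_split /=; apply: eq_bigr => J _.
by rewrite mcoeffD mcoeffZ scalerDl scalerA.
Qed.

Lemma wedge_index I y : wedge (emuls (val I) vac) y = emuls (val I) y.
Proof.
rewrite wedgeE -ewedgeE ewedge_index msuppU oner_eq0 big_seq_fset1 mcoeffUU.
by rewrite scale1r.
Qed.

Lemma wedge0 y : wedge 0 y = 0.
Proof. by rewrite wedgeE msupp0 big_seq_fset0. Qed.

Lemma wedgeZ a x y : wedge (a *: x) y = a *: wedge x y.
Proof. by rewrite -[a *: x]addr0 wedgeP wedge0 addr0. Qed.

(** With this, wedging by a word is applying the word, so [wedge] disappears from the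
    xi(k)-monomials. *)
Lemma wedge_emuls s y : wedge (emuls s vac) y = emuls s y.
Proof.
have [|] := boolP (uniq s && all (leq k) s); last first.
  rewrite negb_and => /orP[nus|].
    by rewrite !(emuls_dup (@emulC) _ nus) wedge0.
  rewrite -has_predC => /hasP[i is_]; rewrite /= -ltnNge => lt_ik.
  have e0 x : emul i x = 0 by apply: emul_small.
  by rewrite !(emuls_mem0 (@emulC) _ e0 is_) wedge0.
rewrite -is_index_sort => us.
have [b sE] : exists b : bool, forall x,
  emuls s x = (-1) ^+ b *: emuls (sort leq s) x.
  by apply: emuls_perm; [exact: emulC | rewrite perm_sym perm_sort].
by rewrite !sE wedgeZ (wedge_index (Sub (sort leq s) us)).
Qed.

Lemma wedge_emul i x y : wedge (emul i x) y = emul i (wedge x y).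
Proof.
elim/chain_emuls_ind: x => [a u v hu hv|I].
  by rewrite emulP !wedgeP hu hv emulP.
by rewrite -[emul i _]/(emuls (i :: val I) vac) !wedge_emuls.
Qed.

End Exterior.
(** * Relations between the structure constants *)

Section StructureConstants.
Implicit Types (g : lie_family) (a b c p s : nat) (r : nat -> rat).

Definition brk g a b : rat := mu g (b%:Z - a%:Z).

(* The condition for \sum_(a + b + c = s) r a * mu (c - b) e_a e_b e_c to
   vanish in the exterior algebra. *)
Definition bracket_rel g s r : Prop := forall a b c, (a + b + c)%N = s ->
  r a * brk g b c + r b * brk g c a + r c * brk g a b = 0.

Lemma brk_int a b : brk L_int a b = b%:R - a%:R.
Proof. by rewrite /brk /= rmorphB. Qed.

Definition mod3_fun (f0 f1 f2 : rat) (a : nat) : rat :=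
  if (a %% 3 == 0)%N then f0 else if (a %% 3 == 1)%N then f1 else f2.

Variant mod3_spec a : nat -> Type :=
  | Mod3_0 of (a %% 3 = 0)%N : mod3_spec a 0
  | Mod3_1 of (a %% 3 = 1)%N : mod3_spec a 1
  | Mod3_2 of (a %% 3 = 2)%N : mod3_spec a 2.

Lemma mod3P a : mod3_spec a (a %% 3)%N.
Proof.
have : (a %% 3 < 3)%N by rewrite ltn_pmod.
by case E: (a %% 3)%N => [|[|[|]]] // _; constructor.
Qed.

Lemma brk_mod3 a b : brk L_mod3 a b = mod3_fun 0 1 (-1) (b + 2 * a).
Proof.
rewrite /brk /mu /eps3 /mod3_fun.
have -> : ((b%:Z - a%:Z) %% 3)%Z = ((b + 2 * a) %% 3)%N%:Z by lia.
by case: mod3P.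
Qed.

Lemma mod3_funE f0 f1 f2 a i : (a %% 3 = i)%N ->
  mod3_fun f0 f1 f2 a = nth f2 [:: f0; f1] i.
Proof.
by move=> <-; rewrite /mod3_fun; case: mod3P.
Qed.

Ltac mod3_eval :=
  repeat match goal with |- context [mod3_fun ?f ?g ?h ?n] => first
    [ rewrite (@mod3_funE f g h n 0); last lia
    | rewrite (@mod3_funE f g h n 1); last lia
    | rewrite (@mod3_funE f g h n 2); last lia ] end; rewrite /=.

Lemma brkN g a b : brk g b a = - brk g a b.
Proof.
case: g; first by rewrite !brk_int opprB.
rewrite !brk_mod3; case: (mod3P a) (mod3P b) => Ha [] Hb; mod3_eval.
all: by rewrite ?oppr0 ?opprK.
Qed.

(** The cyclic sums of 1 and of a against the brackets vanish, and that of a^3 is a + b + c = s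
    times that of a^2. The three free parameters match the three values to be prescribed. *)
Lemma bracket_rel_int s u v w :
  bracket_rel L_int s (fun a => u * (a%:R ^+ 3 - s%:R * a%:R ^+ 2) + v * a%:R + w).
Proof. by move=> a b c <-; rewrite !brk_int !natrD; ring. Qed.

(** As s is not 0 mod 3, exactly two of a, b, c are congruent: their bracket is 0 and the other two
    brackets are opposite. *)
Lemma bracket_rel_mod3 s r : (s %% 3 != 0)%N ->
  (forall a b, (a %% 3 = b %% 3)%N -> r a = r b) -> bracket_rel L_mod3 s r.
Proof.
move=> s3 rE a b c abc; rewrite !brk_mod3.
case: (mod3P a) (mod3P b) (mod3P c) => Ha [] Hb [] Hc; try by [exfalso; lia].
all: mod3_eval.
all: try (have Eab : r a = r b by apply: rE; lia).
all: try (have Ebc : r b = r c by apply: rE; lia).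
all: try (have Eac : r a = r c by apply: rE; lia).
all: lra.
Qed.

(** Here a, b, c are either all congruent, with all brackets 0, or pairwise incongruent, with three
    equal brackets. In the latter case r a + r b + r c must be 0, and 3 a - s contributes 3 s - 3 s
    = 0. *)
Lemma bracket_rel_mod3_0 s f0 f1 f2 v : (s %% 3 = 0)%N -> f0 + f1 + f2 = 0 ->
  bracket_rel L_mod3 s (fun a => mod3_fun f0 f1 f2 a + v * (a%:R *+ 3 - s%:R)).
Proof.
move=> s3 f_sum a b c abc; have -> : f2 = - f0 - f1 by lra.
rewrite !brk_mod3 -abc !natrD.
case: (mod3P a) (mod3P b) (mod3P c) => Ha [] Hb [] Hc; try by [exfalso; lia].
all: mod3_eval.
all: ring.
Qed.

(** The Jacobi identity; through [bracket_rel_eu] it makes [delta] commute with [umul]. *)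
Lemma bracket_rel_jacobi g s : bracket_rel g s (fun a => brk g a (s - a)).
Proof.
case: g => a b c abc.
  have -> : (s - a = b + c)%N by lia.
  have -> : (s - b = a + c)%N by lia.
  have -> : (s - c = a + b)%N by lia.
  by rewrite !brk_int !natrD; ring.
rewrite !brk_mod3.
case: (mod3P a) (mod3P b) (mod3P c) => Ha [] Hb [] Hc; mod3_eval; lra.
Qed.

Lemma brk_neq0 g a b : (a < b <= a + 2)%N -> brk g a b != 0.
Proof.
move=> ab; have [->|->] : b = (a + 1)%N \/ b = (a + 2)%N by lia.
  case: g; first by rewrite brk_int natrD addrAC subrr add0r.
  by rewrite brk_mod3; case: (mod3P a) => Ha; mod3_eval.
case: g; first by rewrite brk_int natrD addrAC subrr add0r.
by rewrite brk_mod3; case: (mod3P a) => Ha; mod3_eval.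
Qed.

Lemma bracket_rel_ext g s r r' :
  r =1 r' -> bracket_rel g s r -> bracket_rel g s r'.
Proof. by move=> rE rel a b c abc; rewrite -!rE rel. Qed.

(** A cubic starting with a^3 - s a^2 is one whose roots add up to s: two roots are free and the
    third is s - u - v. *)
Lemma bracket_rel_roots s (c u v : rat) : bracket_rel L_int s
  (fun a => c * ((a%:R - u) * (a%:R - v) * (a%:R + u + v - s%:R))).
Proof.
apply: (bracket_rel_ext _
  (bracket_rel_int c (c * (s%:R * (u + v) - u ^+ 2 - u * v - v ^+ 2))
                       (c * (u * v * (u + v - s%:R))))) => a.
by ring.
Qed.

(* Three consecutive values of a relation can be prescribed, unless [3 p + 3]
   equals the weight. *)
Lemma bracket_rel_window g s p i : s != (3 * p + 3)%N -> (i < 3)%N ->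
  exists r, [/\ bracket_rel g s r,
    forall j, (j < 3)%N -> r (p + j)%N = (j == i)%:R &
    (0 < p)%N -> i = 0%N -> s = (2 * p + 3)%N -> 0 < r (p + 3)%N].
Proof.
move=> s_ne lt_i3; case: g.
  pose x : rat := p%:R.
  (* The two other points of the window are taken as roots; at p + i the third factor then equals K
     = 3p + 3 - s, whence the excluded weight and the normalizing constants. *)
  have [K [K0 sE K2]] : exists K : rat, [/\ K != 0, s%:R = 3 * x + 3 - K &
      s = (2 * p + 3)%N -> K = x].
    exists (3 * x + 3 - s%:R); split=> [||->]; last by rewrite natrD natrM /x; ring.
      by rewrite /x -natrM -natrD subr_eq0 eqr_nat eq_sym.
    by ring.
  case: i lt_i3 => [|[|[|//]]] _.
  - exists (fun t => (2 * K)^-1 * ((t%:R - (x + 1)) * (t%:R - (x + 2)) *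
                                   (t%:R + (x + 1) + (x + 2) - s%:R))).
    split=> [|j lt_j3|p0 _ /K2 KE]; first exact: bracket_rel_roots.
      case: j lt_j3 => [|[|[|//]]] _; rewrite natrD -/x sE /=; field; exact: K0.
    rewrite natrD -/x sE KE.
    have -> : (2 * x)^-1 * ((x + 3 - (x + 1)) * (x + 3 - (x + 2)) *
      (x + 3 + (x + 1) + (x + 2) - (3 * x + 3 - x))) = (x + 3) / x.
      by have x0 : x != 0 by [rewrite -KE]; field; exact: x0.
    by rewrite divr_gt0 /x ?ltr0n // -natrD ltr0n addn3.
  - exists (fun t => (- K)^-1 * ((t%:R - x) * (t%:R - (x + 2)) *
                                   (t%:R + x + (x + 2) - s%:R))).
    split=> [|j lt_j3|//]; first exact: bracket_rel_roots.
    by case: j lt_j3 => [|[|[|//]]] _; rewrite natrD -/x sE /=; field; exact: K0.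
  exists (fun t => (2 * K)^-1 * ((t%:R - x) * (t%:R - (x + 1)) *
                                   (t%:R + x + (x + 1) - s%:R))).
  split=> [|j lt_j3|//]; first exact: bracket_rel_roots.
  by case: j lt_j3 => [|[|[|//]]] _; rewrite natrD -/x sE /=; field; exact: K0.
have [s3|s3] := eqVneq (s %% 3)%N 0%N; last first.
  exists (fun t => (t %% 3 == (p + i) %% 3)%N%:R); split=> [|j lt_j3|_ -> _].
  - by apply: bracket_rel_mod3 => // a b ->.
  - by congr (nat_of_bool _)%:R; lia.
  - by rewrite addn0 modnDr eqxx.
(* The periodic part must have sum 0 over the window. Since the values of 3 t - s over the window
   sum to 3 y, the multiple [v] of it takes over the excess 1. *)
pose y : rat := 3 * p%:R + 3 - s%:R; pose v := (y *+ 3)^-1.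
have y0 : y *+ 3 != 0.
  by rewrite -mulr_natr mulf_neq0 // /y -natrM -natrD subr_eq0 eqr_nat eq_sym.
pose w j : rat := (j == i)%:R - v * ((p + j)%:R *+ 3 - s%:R).
have w_sum : w 0%N + w 1%N + w 2%N = 0.
  have -> : w 0%N + w 1%N + w 2%N = 1 - v * (y *+ 3).
    rewrite /w /y !natrD.
    by case: i lt_i3 {w} => [|[|[|//]]] _ /=; ring.
  by rewrite mulVf ?subrr.
have wE j : w j + v * ((p + j)%:R *+ 3 - s%:R) = (j == i)%:R by rewrite subrK.
have w_pos : (0 < p)%N -> i = 0%N -> s = (2 * p + 3)%N ->
    0 < w 0%N + v * ((p + 3)%:R *+ 3 - s%:R).
  move=> p0 i0 sE; have yE : y = p%:R by rewrite /y sE natrD natrM; ring.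
  have -> : w 0%N + v * ((p + 3)%:R *+ 3 - s%:R) = 1 + v *+ 9.
    by rewrite /w i0 addn0 natrD /=; ring.
  have vp : 0 <= v by rewrite invr_ge0 yE mulrn_wge0 ?ler0n.
  by rewrite ltr_wpDr // mulrn_wge0.
case: (mod3P p) => p3.
- exists (fun t => mod3_fun (w 0%N) (w 1%N) (w 2%N) t + v * (t%:R *+ 3 - s%:R)).
  split=> [|j lt_j3|p0 i0 sE]; first exact: bracket_rel_mod3_0.
    by rewrite -wE; case: j lt_j3 => [|[|[|//]]] _; mod3_eval.
  by mod3_eval; apply: w_pos.
- exists (fun t => mod3_fun (w 2%N) (w 0%N) (w 1%N) t + v * (t%:R *+ 3 - s%:R)).
  split=> [|j lt_j3|p0 i0 sE].
  + by apply: bracket_rel_mod3_0; rewrite // -w_sum; ring.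
  + by rewrite -wE; case: j lt_j3 => [|[|[|//]]] _; mod3_eval.
  + by exfalso; lia.
- exists (fun t => mod3_fun (w 1%N) (w 2%N) (w 0%N) t + v * (t%:R *+ 3 - s%:R)).
  split=> [|j lt_j3|p0 i0 sE].
  + by apply: bracket_rel_mod3_0; rewrite // -w_sum; ring.
  + by rewrite -wE; case: j lt_j3 => [|[|[|//]]] _; mod3_eval.
  + by exfalso; lia.
Qed.

End StructureConstants.
(** * Multiplication by the coboundary of a generator *)

Section Coboundary.
Variables (V : lmodType rat) (e : nat -> {linear V -> V}).
Hypothesis eC : forall i j x, e i (e j x) = - e j (e i x).
Variable g : lie_family.
Implicit Types (x y : V) (r : nat -> rat).

Fact umul_key : unit. Proof. by []. Qed.

(** The factor 1/2 compensates for summing over ordered pairs, which avoids order conditions in the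
    manipulations; [umul_pairs] recovers the sum over k <= a < b. *)
Definition umul : nat -> V -> V := locked_with umul_key (fun n x =>
  2^-1 *: \sum_(a < n.+1) brk g a (n - a) *: e a (e (n - a)%N x)).

Lemma umulE n x :
  umul n x = 2^-1 *: \sum_(a < n.+1) brk g a (n - a) *: e a (e (n - a)%N x).
Proof. by rewrite /umul unlock. Qed.

Lemma umulP n : linear (umul n).
Proof.
move=> c x y; rewrite !umulE scalerA mulrC -scalerA -scalerDr; congr (_ *: _).
rewrite scaler_sumr -big_split /=; apply: eq_bigr => a _.
by rewrite !(linearP (e _)) scalerDr !scalerA mulrC.
Qed.

HB.instance Definition _ n :=
  GRing.isLinear.Build rat V V _ (umul n) (@umulP n).

Lemma e_rot i a b x : e i (e a (e b x)) = e a (e b (e i x)).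
Proof. by rewrite eC [e i (e b x)]eC (linearN (e a)) opprK. Qed.

Lemma e_umul i n x : e i (umul n x) = umul n (e i x).
Proof.
rewrite !umulE linearZ linear_sum /=; congr (_ *: _); apply: eq_bigr => a _.
by rewrite linearZ /= e_rot.
Qed.

Lemma umulC m n x : umul m (umul n x) = umul n (umul m x).
Proof.
rewrite [umul n x]umulE linearZ linear_sum /= [RHS]umulE; congr (_ *: _).
by apply: eq_bigr => a _; rewrite linearZ /= !e_umul.
Qed.

(** If a + b <= 2k with a, b >= k, then a = b = k, and e_k squares to 0. *)
Lemma umul_small k n x : (forall i y, (i < k)%N -> e i y = 0) ->
  (n <= 2 * k)%N -> umul n x = 0.
Proof.
move=> e_small le_n; rewrite umulE big1 ?scaler0 // => a _; have := ltn_ord a => lt_a.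
have [lt_ak|le_ka] := ltnP a k; first by rewrite e_small ?scaler0.
have [lt_nk|le_kn] := ltnP (n - a) k.
  by rewrite [e (n - a)%N x]e_small // linear0 scaler0.
have -> : (n - a)%N = a by lia.
by rewrite (ee0 eC) scaler0.
Qed.

(** At distance 1 or 2 the coefficient of e_a e_b in u_(a+b) is nonzero in both families, so the
    definition of u can be solved for this product. *)
Lemma ee_umul a b x : (a < b <= a + 2)%N ->
  e a (e b x) = (brk g a b)^-1 *: (umul (a + b) x -
    2^-1 *: \sum_(c < (a + b).+1 | (val c != a) && (val c != b))
               brk g c (a + b - c) *: e c (e (a + b - c)%N x)).
Proof.
move=> ab; have lt_a : (a < (a + b).+1)%N by lia.
have lt_b : (b < (a + b).+1)%N by lia.
rewrite umulE (bigD1 (Ordinal lt_a)) //= (bigD1 (Ordinal lt_b)) /=; last first.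
  by rewrite -val_eqE /=; lia.
have c0 : brk g a b != 0 by apply: brk_neq0.
have -> : brk g b (a + b - b) *: e b (e (a + b - b)%N x) =
          brk g a b *: e a (e b x).
  by rewrite addnK brkN scaleNr eC scalerN opprK.
rewrite addKn.
set c := brk g a b in c0 *; set S := \sum_(_ < _ | _) _; set X := e a (e b x).
rewrite addrA [2^-1 *: (_ + S)]scalerDr addrK -mulr2n -scaler_nat !scalerA.
by rewrite (_ : _ * _ = 1) ?scale1r //; field.
Qed.

Lemma triangle_sum (F : nat -> nat -> nat -> V) s :
  \sum_(p < s.+1) \sum_(a < (s - p).+1) F p a (s - p - a)%N =
  \sum_(p < s.+1) \sum_(a < s.+1) \sum_(b < s.+1)
     (if (p + a + b == s)%N then F p a b else 0).
Proof.
apply: eq_bigr => p _; have := ltn_ord p => lt_p.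
rewrite (big_ord_widen_cond s.+1 xpredT (fun a => F p a (s - p - a)%N)); last by lia.
rewrite big_mkcond /=; apply: eq_bigr => a _; case: ltnP => [lt_a|le_a].
  have lt_b : (s - p - a < s.+1)%N by lia.
  rewrite -big_mkcond /= (big_pred1 (Ordinal lt_b)) // => b.
  by rewrite /= -val_eqE /=; lia.
by rewrite big1 // => b _; case: eqP => //; lia.
Qed.

(* Summing over all (p, a, b) and averaging over cyclic rotations. *)
Lemma bracket_rel_eu s r x : bracket_rel g s r ->
  \sum_(p < s.+1) r p *: e p (umul (s - p) x) = 0.
Proof.
move=> rel; pose F p a b := (r p * brk g a b) *: e p (e a (e b x)).
pose T (G : nat -> nat -> nat -> V) :=
  \sum_(p < s.+1) \sum_(a < s.+1) \sum_(b < s.+1)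
    (if (p + a + b == s)%N then G p a b else 0).
have -> : \sum_(p < s.+1) r p *: e p (umul (s - p) x) = 2^-1 *: T F.
  rewrite /T -(triangle_sum F) scaler_sumr; apply: eq_bigr => p _.
  rewrite umulE linearZ linear_sum /= scalerA mulrC -scalerA; congr (_ *: _).
  by rewrite scaler_sumr; apply: eq_bigr => a _; rewrite linearZ /= scalerA.
have rotT G : T G = T (fun p a b => G a b p).
  rewrite /T; under eq_bigr do rewrite exchange_big; rewrite /= exchange_big /=.
  do 3![apply: eq_bigr => ? _].
  by congr (if _ == _ then _ else _); lia.
have : T F + T F + T F = 0.
  have e1 := rotT F; have e2 := rotT (fun p a b => F a b p).
  rewrite [X in _ + X]e1 [X in _ + X]e2 [X in _ + X + _]e1 /T -!big_split /= big1 // => p _.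
  rewrite -!big_split /= big1 // => a _; rewrite -!big_split big1 //= => b _.
  case: eqP => [abs|_]; last by rewrite !addr0.
  rewrite /F [e b (e p (e a x))]e_rot [e p (e a (e b x))]e_rot.
  by rewrite -!scalerDl rel ?scale0r.
move=> T0; suff -> : T F = 0 by rewrite scaler0.
have /eqP : 3%:R *: T F = 0 by rewrite scaler_nat !mulrSr mulr0n add0r.
by rewrite scaler_eq0 => /eqP.
Qed.

Variable delta : {linear V -> V}.
Hypothesis delta_e : forall i x, delta (e i x) = umul i x - e i (delta x).

(** The derivation rule applied to both factors of u_n leaves twice a sum of e_a u_(n-a) with
    coefficients mu(n - 2a), up to sign, and this sum is 0 by the Jacobi identity. *)
Lemma delta_umul n x : delta (umul n x) = umul n (delta x).
Proof.
have J := bracket_rel_eu x (@bracket_rel_jacobi g n).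
rewrite {1}umulE linearZ linear_sum /=.
have tE (a : 'I_n.+1) : delta (brk g a (n - a) *: e a (e (n - a)%N x)) =
    brk g a (n - a) *: e (n - a)%N (umul a x) -
    brk g a (n - a) *: e a (umul (n - a) x) +
    brk g a (n - a) *: e a (e (n - a)%N (delta x)).
  rewrite linearZ /= !delta_e (linearB (e a)) opprB -scalerBr -scalerDr.
    by rewrite [e (n - a)%N (umul a x)]e_umul addrA addrAC.
rewrite (eq_bigr _ (fun a _ => tE a)) !big_split /= sumrN J oppr0 addr0.
rewrite scalerDr -(umulE n (delta x)).
rewrite (reindex_inj rev_ord_inj) /=.
rewrite (eq_bigr (fun a : 'I_n.+1 => - (brk g a (n - a) *: e a (umul (n - a) x)))).
  by rewrite sumrN J oppr0 scaler0 add0r.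
move=> a _; have := ltn_ord a => lt_a; rewrite subSS.
have -> : (n - (n - a))%N = a by lia.
by rewrite brkN scaleNr.
Qed.

(** This is [delta] applied to [bracket_rel_eu]; the terms in [delta x] vanish by the same
    relation. *)
Lemma bracket_rel_uu s r x : bracket_rel g s r ->
  \sum_(p < s.+1) r p *: umul p (umul (s - p) x) = 0.
Proof.
move=> rel; have := congr1 delta (bracket_rel_eu x rel).
rewrite linear_sum linear0 /=.
have tE (p : 'I_s.+1) : delta (r p *: e p (umul (s - p) x)) =
    r p *: umul p (umul (s - p) x) - r p *: e p (umul (s - p) (delta x)).
  by rewrite linearZ /= delta_e delta_umul scalerBr.
rewrite (eq_bigr _ (fun a _ => tE a)) big_split /= sumrN.
by rewrite (bracket_rel_eu _ rel) oppr0 addr0.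
Qed.

End Coboundary.
(** * Straightening *)

Section Span.
Variables (T : Type) (V : lmodType rat).
Implicit Types (P Q : T -> Prop) (b : T -> V) (x y : V).

(** An inductive predicate, so that membership is proved and used by induction on a combination,
    with no decidability asked of [P]. *)
Inductive span_of P b : V -> Prop :=
  | span_of0 : span_of P b 0
  | span_of_cons a t x : P t -> span_of P b x -> span_of P b (a *: b t + x).

Lemma span_ofD P b x y : span_of P b x -> span_of P b y -> span_of P b (x + y).
Proof.
elim=> [|a t z Pt _ IHz] sy; first by rewrite add0r.
by rewrite -addrA; apply: span_of_cons => //; apply: IHz.
Qed.

Lemma span_ofZ P b a x : span_of P b x -> span_of P b (a *: x).
Proof.
elim=> [|c t z Pt _ IHz]; first by rewrite scaler0; apply: span_of0.
by rewrite scalerDr scalerA; apply: span_of_cons.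
Qed.

Lemma span_ofN P b x : span_of P b x -> span_of P b (- x).
Proof. by rewrite -scaleN1r; apply: span_ofZ. Qed.

Lemma span_ofB P b x y : span_of P b x -> span_of P b y -> span_of P b (x - y).
Proof. by move=> sx sy; apply: span_ofD => //; apply: span_ofN. Qed.

Lemma span_of_sum P b (I : Type) (r : seq I) (R : pred I) (F : I -> V) :
  (forall i, R i -> span_of P b (F i)) ->
  span_of P b (\sum_(i <- r | R i) F i).
Proof.
move=> sF; elim/big_ind: _ => //; first exact: span_of0.
by move=> x y; apply: span_ofD.
Qed.

Lemma span_of_gen P b t : P t -> span_of P b (b t).
Proof.
move=> Pt; rewrite -[b t]addr0 -[b t]scale1r; apply: span_of_cons => //.
exact: span_of0.
Qed.

Lemma span_ofS P Q b x :
  (forall t, P t -> Q t) -> span_of P b x -> span_of Q b x.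
Proof.
move=> sPQ; elim=> [|a t y Pt _ sy]; first exact: span_of0.
by apply: span_of_cons => //; apply: sPQ.
Qed.

End Span.

Lemma span_of_map (T T' : Type) (V V' : lmodType rat) P Q (b : T -> V)
    (b' : T' -> V') (f : {linear V -> V'}) x :
  (forall t, P t -> span_of Q b' (f (b t))) ->
  span_of P b x -> span_of Q b' (f x).
Proof.
move=> sf; elim=> [|a t y Pt _ sy]; first by rewrite linear0; apply: span_of0.
by rewrite linearP; apply: span_ofD => //; apply: span_ofZ; apply: sf.
Qed.

Lemma nonsingular_nth s i j : nonsingular s -> (i <= j < size s)%N ->
  (nth 0 s i + 3 * (j - i) <= nth 0 s j)%N.
Proof.
move=> /(sortedP 0%N) ns; elim: j => [|j IHj] /andP[le_ij lt_j].
  by move: le_ij; rewrite leqn0 => /eqP ->; rewrite addn0.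
have := ns j lt_j; move: le_ij; rewrite leq_eqVlt => /predU1P[->|lt_ij].
  by rewrite subnn addn0.
by have := IHj ltac:(lia); lia.
Qed.

(** * The rank of a multiset of parts *)

Section Rank.
Variable N : nat.

(* Fewer parts means lower rank; among multisets with the same number of parts
   and the same sum, making the smallest parts smaller lowers the rank. *)
Definition rho (i : nat) : nat := 2 ^ (N + 2) - 2 ^ (N - i).
Definition rk (s : seq nat) : nat := sumn [seq rho i | i <- s].

Lemma rhoE i : (rho i + 2 ^ (N - i) = 4 * 2 ^ N)%N.
Proof.
rewrite /rho subnK; first by rewrite expnD mulnC.
by rewrite leq_exp2l //; lia.
Qed.

Lemma pow_gt0 i : (0 < 2 ^ (N - i))%N.
Proof. by rewrite expn_gt0. Qed.

Lemma pow_le i j : (i <= j)%N -> (2 ^ (N - j) <= 2 ^ (N - i))%N.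
Proof. by move=> le_ij; rewrite leq_exp2l //; lia. Qed.

Lemma pow_lt i j : (i < j <= N)%N -> (2 * 2 ^ (N - j) <= 2 ^ (N - i))%N.
Proof. by move=> lt_ij; rewrite -expnS leq_exp2l //; lia. Qed.

(** All values of [rho] lie between 3 2^N and 4 2^N, the upper end excluded, so two parts always
    outrank one. *)
Lemma rho_merge a b : (rho (a + b) < rho a + rho b)%N.
Proof.
have := rhoE a; have := rhoE b; have := rhoE (a + b).
have := pow_gt0 (a + b); have := pow_le (leq0n a); have := pow_le (leq0n b).
rewrite !subn0; lia.
Qed.

(** Lowering the minimum at least doubles its power of 2, which then outweighs the powers of p and q
    together. The bound by [N] keeps the exponents from being truncated at 0. *)
Lemma rho_spread p q p' q' : (p' + q' = p + q)%N -> (p + q <= N)%N ->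
  (minn p' q' < minn p q)%N -> (rho p' + rho q' < rho p + rho q)%N.
Proof.
have H a b a' b' : (a' + b' = a + b)%N -> (a + b <= N)%N -> (a' < a)%N ->
    (a' < b)%N -> (rho a' + rho b' < rho a + rho b)%N.
  move=> ab abN lt_a lt_b.
  have := rhoE a; have := rhoE b; have := rhoE a'; have := rhoE b'.
  have := @pow_lt a' a; have := @pow_lt a' b; have := pow_gt0 b'.
  by move=> h1 h2 h3; have := h2 ltac:(lia); have := h3 ltac:(lia); lia.
move=> pq pqN; rewrite [minn p' q']minnE => lt_min.
have [le_pq|lt_qp] := leqP p' q'; first by apply: H => //; lia.
by rewrite addnC; apply: H => //; lia.
Qed.

Lemma rk_cons i s : rk (i :: s) = (rho i + rk s)%N.
Proof. by []. Qed.

Lemma rk_cat s t : rk (s ++ t) = (rk s + rk t)%N.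
Proof. by rewrite /rk map_cat sumn_cat. Qed.

Lemma rk_perm s t : perm_eq s t -> rk s = rk t.
Proof. by move=> /(perm_map rho)/perm_sumn. Qed.

End Rank.
(** * Normal forms of partitions *)

(* Whether [b] stays in the main part when it follows the initial segment [A]. *)
Definition main_range k (A : seq nat) (b : nat) : bool :=
  if A is a :: _ then
    if a == k then (b < 2 * k + 3 * size A)%N else (b <= 2 * k + 3 * size A)%N
  else (b <= 2 * k)%N.

Section Runs.
Implicit Types (s b : seq nat) (bs : seq (seq nat)).

Lemma runs_flatten s : flatten (runs s) = s.
Proof.
elim: s => //= x s.
by case: (runs s) => [|[|y b] bs] /= <- //; case: ifP.
Qed.

Lemma runs_nonempty s : all (fun b => b != [::]) (runs s).
Proof.
elim: s => //= x s; case: (runs s) => [|[|y b] bs] //= Hbs.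
by case: ifP.
Qed.

Lemma runs_steps s : all (sorted (fun i j => j == i + 3)%N) (runs s).
Proof.
elim: s => //= x s; case: (runs s) => [|[|y b] bs] //= /andP[sb sbs].
by case: ifP => [/eqP Ey|_] /=; rewrite ?sbs ?andbT //= Ey eqxx -Ey.
Qed.

Lemma runs_heads_subseq s : subseq [seq head 0%N b | b <- runs s] s.
Proof.
elim: s => //= x s; have := runs_nonempty s.
case: (runs s) => [|[|y b] bs] //= _; first by rewrite eqxx.
case: ifP => _ /=; rewrite eqxx //.
by apply: subseq_trans; apply: subseq_cons.
Qed.

(** The heads of the runs read from left to right, each part compared with its predecessor [p];
    [runs] recurses from the right and does not show this local criterion. *)
Fixpoint run_starts p s : seq nat :=
  if s is x :: s' then
    if x == (p + 3)%N then run_starts x s' else x :: run_starts x s'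
  else [::].

Lemma runs_heads a s :
  [seq head 0%N b | b <- runs (a :: s)] = a :: run_starts a s.
Proof.
elim: s a => //= y s IHs a; have := IHs y; rewrite /=.
case: (runs s) => [|[|z b] bs] /=; try by case: eqP => _ [<-].
by case: ifP => _ /= [<-]; case: eqP.
Qed.

Lemma run_startsP p s x : reflect
  (exists j, [/\ (j < size s)%N, x = nth 0%N s j &
     nth 0%N s j <> (nth 0%N (p :: s) j + 3)%N])
  (x \in run_starts p s).
Proof.
elim: s p => [|y s IHs] p /=; first by constructor; case=> j [].
have IH : (x \in run_starts y s) -> exists j, [/\ (j < (size s).+1)%N,
    x = nth 0%N (y :: s) j & nth 0%N (y :: s) j <> (nth 0%N [:: p, y & s] j + 3)%N].
  by move=> /IHs[j [? ? ?]]; exists j.+1.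
have IH' j : (j < size s)%N -> x = nth 0%N s j ->
    nth 0%N s j <> (nth 0%N (y :: s) j + 3)%N -> x \in run_starts y s.
  by move=> ? ? ?; apply/IHs; exists j.
case: eqP => [yp|yp]; rewrite ?in_cons.
  apply: (iffP idP) => [/IH //|[[|j] []] //=].
  by move=> ? ? ?; apply: (IH' j).
apply: (iffP idP) => [/predU1P[->|/IH //]|[[|j] [lt_j xE ne_j]]].
- by exists 0%N.
- by rewrite xE eqxx.
- by rewrite (IH' j) // orbT.
Qed.

Lemma runs_headsP s x : reflect
  (exists j, [/\ (j < size s)%N, x = nth 0%N s j &
     j = 0%N \/ nth 0%N s j <> (nth 0%N s j.-1 + 3)%N])
  (x \in [seq head 0%N b | b <- runs s]).
Proof.
case: s => [|a s]; first by constructor; case=> j [].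
rewrite runs_heads in_cons; apply: (iffP predU1P).
  case=> [->|/run_startsP[j [lt_j xE ne_j]]]; first by exists 0%N; split=> //; left.
  by exists j.+1; split=> //; right.
case=> -[|j] [lt_j xE]; first by left.
by case=> // ne_j; right; apply/run_startsP; exists j.
Qed.

End Runs.

Lemma main_length_le k I : (main_length k I <= size I)%N.
Proof. by apply/bigmax_leqP => p _; rewrite -ltnS. Qed.

Lemma is_main_main_part k I : is_main k (main_part k I).
Proof.
have [|p] := @eq_bigmax_cond _ [pred p : 'I_(size I).+1 | is_main k (take p I)] val.
  by apply/card_gt0P; exists ord0; rewrite inE take0.
by rewrite inE => mp pE; rewrite /main_part /main_length pE.
Qed.

Lemma main_partE k I : is_main k I -> main_part k I = I.
Proof.
move=> mI; rewrite /main_part take_oversize //.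
by apply: (bigmax_sup ord_max); rewrite /= ?take_size.
Qed.

Lemma dense_parts_nil k I : (dense_parts k I == [::]) = is_main k I.
Proof.
apply/eqP/idP => [d0|/main_partE mI].
  by rewrite -(main_part_normal_form k I) d0 cats0 is_main_main_part.
have := congr1 size (main_part_normal_form k I); rewrite mI size_cat => /eqP.
rewrite -[X in _ == X]addn0 eqn_add2l size_eq0.
have := runs_nonempty (drop (main_length k I) I); rewrite -/(dense_parts k I).
by case: (dense_parts k I) => [|[|x b] bs].
Qed.

Section MainPart.
Variable k : nat.
Hypothesis k_gt0 : (0 < k)%N.
Variable I : seq nat.
Hypotheses (kI : kpartition k I) (nI : nonsingular I).

Local Notation main_at j := (main_range k (take j I) (nth 0%N I j)).

Lemma kpartition_all : all (leq k) I.
Proof. exact: (order_path_min leq_trans kI). Qed.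

Lemma kpartition_sorted : sorted leq I.
Proof. exact: path_sorted kI. Qed.

Lemma main_atE j : (j < size I)%N -> main_at j =
  if head 0%N I == k then (nth 0%N I j < 2 * k + 3 * j)%N
  else (nth 0%N I j <= 2 * k + 3 * j)%N.
Proof.
case: j => [|j] lt_j; rewrite ?take0 /=.
  by rewrite muln0 addn0 nth0; case: eqP => [->|//]; apply/idP/idP; lia.
by rewrite /main_range; case: (I) lt_j => //= a s lt_j; rewrite size_takel // ltnW.
Qed.

Lemma is_main_take j : (j < size I)%N -> is_main k (take j.+1 I) = main_at j.
Proof.
move=> lt_j; rewrite main_atE // /is_main /kpartition take_path // /nonsingular.
rewrite take_sorted //= size_takel //.
have -> : last 0%N (take j.+1 I) = nth 0%N I j.
  by rewrite (take_nth 0%N lt_j) last_rcons.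
by case: (I) lt_j.
Qed.

(** Parts grow by at least 3 per position and the bound by exactly 3, so the condition passes to
    earlier positions. Hence the main part can be read off position by position. *)
Lemma main_at_le i j : (i <= j < size I)%N -> main_at j -> main_at i.
Proof.
move=> ij; rewrite !main_atE; try lia.
by have := nonsingular_nth nI ij; case: ifP; lia.
Qed.

Lemma main_lengthP j : (j < main_length k I)%N = (j < size I)%N && main_at j.
Proof.
apply/idP/andP => [lt_j|[lt_j mj]]; last first.
  rewrite -is_main_take // in mj.
  exact: (bigmax_sup (Ordinal (lt_j : j.+1 < (size I).+1)%N)).
move: (is_main_main_part k I) (main_length_le k I); rewrite /main_part.
move: (main_length k I) lt_j => p lt_j mp le_p.
split; first lia.
apply: (@main_at_le j p.-1); first lia.
by rewrite -is_main_take; [rewrite prednK //; lia | lia].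
Qed.

(** A part at distance exactly 3 from the last main part would itself satisfy the bound. The gap
    before the first dense block thus exceeds 3 automatically, and leading parts have a criterion
    that does not mention [main_length]. *)
Lemma leadingP x : reflect
  (exists j, [/\ (j < size I)%N, x = nth 0%N I j, ~~ main_at j &
                 j = 0%N \/ (nth 0%N I j.-1 + 3 < nth 0%N I j)%N])
  (x \in leading k I).
Proof.
set l := main_length k I.
have -> : (x \in leading k I) =
    (x \in [seq head 0%N b | b <- runs (drop l I)]).
  apply/imfsetP/mapP => -[b /= bI ->]; by exists b.
apply: (iffP (runs_headsP _ _)) => [[j []]|[j [lt_j xE mj jE]]].
  rewrite size_drop nth_drop => lt_j xE jE.
  have lt_lj : (l + j < size I)%N by lia.
  exists (l + j)%N; split=> //.
    by have := main_lengthP (l + j); rewrite -/l lt_lj /= => <-; lia.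
  have [->|l_j] := posnP (l + j); [by left|right].
  have := @nonsingular_nth _ (l + j).-1 (l + j) nI ltac:(lia).
  rewrite (_ : _ - _ = 1)%N; last by lia.
  rewrite muln1 leq_eqVlt => /predU1P[eq3|//]; exfalso.
  have [j0|j_gt0] := posnP j; last first.
    case: jE => [|ne3]; first by lia.
    rewrite nth_drop (_ : (l + j.-1 = (l + j).-1)%N) in ne3; last by lia.
    exact: ne3.
  have lt_l : ((l + j).-1 < l)%N by lia.
  have := main_lengthP (l + j).-1; rewrite -/l lt_l => /esym/andP[lt_l' m1].
  have := main_lengthP (l + j); rewrite -/l lt_lj /= j0 addn0 ltnn => /esym m2.
  by move: m1 m2; rewrite j0 addn0 in eq3 lt_l lt_l' l_j lt_lj *;
    rewrite !main_atE //; case: ifP; lia.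
have le_lj : (l <= j)%N.
  by rewrite leqNgt; have := main_lengthP j; rewrite -/l lt_j (negPf mj) => ->.
exists (j - l)%N; rewrite size_drop nth_drop subnKC //; split=> //; first lia.
have [->|jl] := eqVneq j l; [by left; rewrite subnn|right].
rewrite nth_drop (_ : (l + (j - l).-1 = j.-1)%N); last by lia.
by case: jE; lia.
Qed.

End MainPart.

(** * Rewriting monomials modulo lower rank *)

Section Filtration.
Variables (V : lmodType rat) (e : nat -> {linear V -> V}).
Hypothesis eC : forall i j x, e i (e j x) = - e j (e i x).
Variables (g : lie_family) (k : nat).
Hypothesis k_gt0 : (0 < k)%N.
Hypothesis e_small : forall i x, (i < k)%N -> e i x = 0.
Variable delta : {linear V -> V}.
Hypothesis delta_e : forall i x, delta (e i x) = umul e g i x - e i (delta x).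
Variables (v : V) (N : nat).
Implicit Types (x : V) (A B D s : seq nat) (f : bool) (w m : nat).

Local Notation u := (umul e g).
Local Notation E := (emuls e).
Local Notation rk := (rk N).
Local Notation rho := (rho N).

Definition umuls B x : V := foldr (fun i => u i) x B.

Definition mon (AB : seq nat * seq nat) : V := E AB.1 (umuls AB.2 v).

(** The flag [f] demands at least one factor u. It is tracked through all rewritings because the hat
    e_I must be orthogonal to every monomial that has one. *)
Definition fil f w m : V -> Prop := span_of (fun AB =>
  [/\ sumn AB.1 + sumn AB.2 = w, rk AB.1 + rk AB.2 < m & f ==> (AB.2 != [::])]%N)
  mon.

(* As [fil], but the rank ignores one factor [u_b]. *)
Definition gil w m : V -> Prop := span_of (fun AB =>
  exists b D, [/\ AB.2 = b :: D, sumn AB.1 + (b + sumn D) = w &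
                  rk AB.1 + rk D < m]%N) mon.

Lemma umul_emuls i A x : u i (E A x) = E A (u i x).
Proof. by elim: A => //= a A IHA; rewrite -(e_umul eC) IHA. Qed.

Lemma filS f f' w m m' x : (f' ==> f) -> (m <= m')%N -> fil f w m x -> fil f' w m' x.
Proof.
move=> ff' mm'; apply: span_ofS => AB [-> lt_m Bf]; split=> //.
  exact: leq_trans mm'.
by apply/implyP => /(implyP ff') /(implyP Bf).
Qed.

Lemma fil_e f w m i x : fil f w m x -> fil f (i + w) (rho i + m) (e i x).
Proof.
apply: span_of_map => -[A B] /= [<- lt_m Bf].
by apply: (@span_of_gen _ _ _ mon (i :: A, B)); rewrite /= rk_cons; split=> //; lia.
Qed.

Lemma fil_u f w m i x : fil f w m x -> fil true (i + w) (rho i + m) (u i x).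
Proof.
apply: span_of_map => -[A B] /= [<- lt_m Bf]; rewrite /mon /= umul_emuls.
by apply: (@span_of_gen _ _ _ mon (A, i :: B)); rewrite /= rk_cons; split=> //; lia.
Qed.

Lemma fil_emuls f w m s x :
  fil f w m x -> fil f (sumn s + w) (rk s + m) (E s x).
Proof. by move=> fx; elim: s => //= i s /(fil_e i); rewrite !addnA. Qed.

Lemma gil_e w m i x : gil w m x -> gil (i + w) (rho i + m) (e i x).
Proof.
apply: span_of_map => -[A B] /= [b [D [-> <- lt_m]]].
apply: (@span_of_gen _ _ _ mon (i :: A, b :: D)); exists b, D.
by rewrite /= rk_cons; split=> //; lia.
Qed.

Lemma gil_emuls w m s x : gil w m x -> gil (sumn s + w) (rk s + m) (E s x).
Proof. by move=> gx; elim: s => //= i s /(gil_e i); rewrite !addnA. Qed.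

Lemma gil_u f w m i x : fil f w m x -> gil (i + w) m (u i x).
Proof.
apply: span_of_map => -[A B] /= [<- lt_m Bf]; rewrite /mon /= umul_emuls.
apply: (@span_of_gen _ _ _ mon (A, i :: B)); exists i, B.
by rewrite /=; split=> //; lia.
Qed.

Lemma gilS w m m' x : (m <= m')%N -> gil w m x -> gil w m' x.
Proof.
move=> mm'; apply: span_ofS => AB [b [D [-> <- lt_m]]]; exists b, D; split=> //.
exact: leq_trans mm'.
Qed.

Lemma gil_fil w m m' x :
  (m + 4 * 2 ^ N <= m'.+1)%N -> gil w m x -> fil true w m' x.
Proof.
move=> mm'; apply: span_ofS => -[A B] /= [b [D [-> <- lt_m]]]; split=> //=.
by rewrite rk_cons; have := rhoE N b; have := pow_gt0 N b; lia.
Qed.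

(** In [ee_umul], u_(a+b) merges two parts, and every other pair of the same sum is further apart,
    except a pair of equal indices, which gives 0. *)
Lemma ee_lower f w m a b x : (a < b <= a + 2)%N -> (a + b <= N)%N ->
  fil f w m.+1 x -> fil f (a + b + w) (rho a + rho b + m) (e a (e b x)).
Proof.
move=> ab abN fx; rewrite (ee_umul eC g x ab); apply: span_ofZ.
apply: span_ofB.
  by apply: filS (fil_u (a + b) fx); rewrite ?implybT //; have := rho_merge N a b; lia.
apply/span_ofZ/span_of_sum => -[c lt_c] /= /andP[/eqP ca /eqP cb].
apply: span_ofZ; have [c2|c2] := eqVneq c (a + b - c)%N.
  by rewrite -c2 (ee0 eC); apply: span_of0.
have := fil_e c (fil_e (a + b - c)%N fx); rewrite addnA subnKC; last by lia.
apply: filS; rewrite ?implybb // !addnA addnS.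
by rewrite ltn_add2r rho_spread //; lia.
Qed.

Lemma sum_solve (F : nat -> V) (r : nat -> rat) n p : (p <= n)%N ->
  \sum_(q < n.+1) r q *: F q = 0 -> r p = 1 ->
  F p = - \sum_(q < n.+1 | val q != p) r q *: F q.
Proof.
rewrite -ltnS => lt_p /eqP; rewrite (bigD1 (Ordinal lt_p)) //= addr_eq0 => /eqP + rp.
by rewrite rp scale1r.
Qed.

Lemma eu_spread f w m p y q z x : (q + z = p + y)%N -> (p + y <= N)%N ->
  (minn q z < minn p y)%N -> fil f w m.+1 x ->
  fil true (p + y + w) (rho p + rho y + m) (e q (u z x)).
Proof.
move=> qz pyN lt_min fx; rewrite -qz -addnA.
apply: filS (fil_e q (fil_u z fx)); rewrite // addnA addnS.
by rewrite ltn_add2r rho_spread.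
Qed.

(** The window starting at min(p, y) contains both p and y. With value 1 at p and 0 at its other
    points, only terms with more distant indices remain. *)
Lemma eu_lower f w m p y x : (p <= y + 2)%N -> (y <= p + 2)%N -> (p + y <= N)%N ->
  fil f w m.+1 x -> fil true (p + y + w) (rho p + rho y + m) (e p (u y x)).
Proof.
move=> py yp pyN fx; set c := minn p y.
have [||r [rel rE _]] := @bracket_rel_window g (p + y) c (p - c)%N; try lia.
have lt_p : (p <= p + y)%N by lia.
have rp : r p = 1 by have := rE (p - c)%N ltac:(lia); rewrite eqxx subnKC //; lia.
have := sum_solve (F := fun q => e q (u (p + y - q)%N x)) lt_p
  (bracket_rel_eu eC x rel) rp; rewrite addKn => ->.
apply/span_ofN/span_of_sum => -[q lt_q] /= /eqP qp.
have [lt_min|] := ltnP (minn q (p + y - q)) (minn p y).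
  by apply/span_ofZ/eu_spread/fx => //; lia.
move=> le_min; rewrite (_ : r q = 0) ?scale0r; first exact: span_of0.
have := rE (q - c)%N ltac:(lia); rewrite subnKC; last by lia.
by move=> ->; case: eqP => //; lia.
Qed.

Lemma uu_spread f w m p y q z x : (q + z = p + y)%N -> (p + y <= N)%N ->
  (minn q z < minn p y)%N -> fil f w m.+1 x ->
  fil true (p + y + w) (rho p + rho y + m) (u q (u z x)).
Proof.
move=> qz pyN lt_min fx; rewrite -qz -addnA.
apply: filS (fil_u q (fil_u z fx)); rewrite // addnA addnS.
by rewrite ltn_add2r rho_spread.
Qed.

(** Distance 3 is within reach here because the u commute: the term at q = p + 3 is the same product
    again, and its coefficient r(p+3) > 0 cannot cancel the 1 at p. *)
Lemma uu_lower f w m p y x : (p <= y + 3)%N -> (y <= p + 3)%N -> (p + y <= N)%N ->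
  fil f w m.+1 x -> fil true (p + y + w) (rho p + rho y + m) (u p (u y x)).
Proof.
wlog le_py : p y / (p <= y)%N.
  move=> H py yp pyN fx; have [le_py|lt_yp] := leqP p y; first exact: H.
  by rewrite (umulC eC) (addnC p) (addnC (rho p)); apply: H => //; lia.
move=> _ yp pyN fx.
have [p0|p_gt0] := posnP p.
  by rewrite (umul_small eC g _ e_small) ?p0 //; apply: span_of0.
have [||r [rel rE rpos]] := @bracket_rel_window g (p + y) p 0%N; try lia.
have lt_p : (p <= p + y)%N by lia.
have rp : r p = 1 by have := rE 0%N isT; rewrite addn0.
have := sum_solve (F := fun q => u q (u (p + y - q)%N x)) lt_p
  (bracket_rel_uu eC delta_e x rel) rp; rewrite addKn.
set S := fil _ _ _ => Fp.
have sumS (R : pred 'I_(p + y).+1) : (forall q, R q -> (q < p)%N || (q > y)%N ||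
    (r q == 0)) -> S (\sum_(q < (p + y).+1 | R q) r q *: u q (u (p + y - q)%N x)).
  move=> RE; apply: span_of_sum => -[q lt_q] /RE /=.
  case: eqP => [-> _|_]; first by rewrite scale0r; apply: span_of0.
  by rewrite orbF => Hq; apply/span_ofZ/uu_spread/fx => //; lia.
have r0 q : (p < q < p + 3)%N -> r q = 0.
  move=> pq; have := rE (q - p)%N ltac:(lia); rewrite subnKC; last by lia.
  by move=> ->; case: eqP => //; lia.
have [y3|y3] := eqVneq y (p + 3)%N; last first.
  rewrite Fp; apply/span_ofN/sumS => -[q lt_q] /= /eqP qp.
  have [|lt_qp] := ltnP q p => //; have [|le_qy] := ltnP y q => //=.
  by rewrite r0 //; lia.
have lt_y : (y < (p + y).+1)%N by lia.
rewrite (bigD1 (Ordinal lt_y)) /= in Fp; last by lia.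
rewrite addnK (umulC eC g y p) opprD in Fp.
have c_gt0 : 0 < r y by rewrite y3; apply: rpos => //; lia.
have : (1 + r y) *: u p (u y x) = - \sum_(q < (p + y).+1 |
    (val q != p) && (q != Ordinal lt_y)) r q *: u q (u (p + y - q)%N x).
  by rewrite scalerDl scale1r {1}Fp addrAC addNr add0r.
move/(congr1 ( *:%R (1 + r y)^-1)); rewrite scalerA mulVf ?scale1r; last first.
  by rewrite lt0r_neq0 // addr_gt0.
move=> ->; apply/span_ofZ/span_ofN/sumS => -[q lt_q] /= /andP[/eqP qp].
rewrite -val_eqE /= => /eqP qy.
have [|lt_qp] := ltnP q p => //; have [|le_qy] := ltnP y q => //=.
by rewrite r0 //; lia.
Qed.

(* A leading [u] inside a dense run can be moved to the front of the run. *)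
Lemma eu3_swap p : (0 < p)%N -> (2 * p + 3 <= N)%N -> exists2 c : rat, 0 < c &
  forall f w m x, fil f w m.+1 x ->
    fil true (p + (p + 3) + w) (rho p + rho (p + 3) + m)
      (e p (u (p + 3) x) + c *: u p (e (p + 3)%N x)).
Proof.
move=> p_gt0 pN.
have [||r [rel rE rpos]] := @bracket_rel_window g (p + (p + 3)) p 0%N; try lia.
have rp : r p = 1 by have := rE 0%N isT; rewrite addn0.
exists (r (p + 3)%N) => [|f w m x fx]; first by apply: rpos => //; lia.
have lt_p : (p <= p + (p + 3))%N by lia.
have := sum_solve (F := fun q => e q (u (p + (p + 3) - q)%N x)) lt_p
  (bracket_rel_eu eC x rel) rp; rewrite addKn => ->.
have lt_y : (p + 3 < (p + (p + 3)).+1)%N by lia.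
rewrite (bigD1 (Ordinal lt_y)) /=; last by lia.
rewrite addnK -(e_umul eC) opprD addrAC addNr add0r.
apply/span_ofN/span_of_sum => -[q lt_q] /= /andP[/eqP qp].
rewrite -val_eqE /= => /eqP qy.
have [lt_min|] := ltnP (minn q (p + (p + 3) - q)) p.
  by apply/span_ofZ/eu_spread/fx => //; lia.
move=> le_min; rewrite (_ : r q = 0) ?scale0r; first exact: span_of0.
have := rE (q - p)%N ltac:(lia); rewrite subnKC; last by lia.
by move=> ->; case: eqP => //; lia.
Qed.

(** A window at the last letter a of the word rewrites e_a u_b. Terms with q < a lose enough rank at
    once. Terms with q >= a + 3 carry a u of index at most b - 3, in main range after the shorter
    word, so induction applies; it ends with u_j = 0 for j <= 2k. The guaranteed loss 2^(N - last)
    at least doubles with each letter to the left, which pays for replacing e_a by a larger e_q. *)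
Lemma boundary_gil A b f w m m' x : nonsingular A -> all (leq k) A ->
  main_range k A b -> (sumn A + b <= N)%N -> fil f w m.+1 x ->
  (A != [::] -> (rk A + m.+1 <= m' + 2 ^ (N - last 0 A))%N) ->
  gil (sumn A + b + w) m' (E A (u b x)).
Proof.
elim/last_ind: A b m' => [|A a IHA] b m' nsA kA rng leN fx.
  by rewrite (umul_small eC g _ e_small) // => _; rewrite linear0; apply: span_of0.
have ha : (head 0 (rcons A a) + 3 * size A <= a)%N.
  have := @nonsingular_nth _ 0 (size A) nsA.
  by rewrite size_rcons ltnSn nth0 nth_rcons ltnn eqxx subn0 => ->.
have hk : (k <= head 0 (rcons A a))%N by case: (A) kA => [|a1 s] /= /andP[].
rewrite last_rcons sumn_rcons -cats1 rk_cat rk_cons addn0 emuls_cat /=.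
rewrite sumn_rcons in leN; move=> /(_ ltac:(by case: (A))) le_m'.
(* This avoids the excluded weight a + b = 3a + 3. The main range even gives b < 2a + 3: for a first
   part k through the strict bound, otherwise because the first part exceeds k. *)
have b_ne : b != (2 * a + 3)%N.
  case: (A) rng ha hk => [|a1 s] /=; rewrite ?size_rcons; case: eqP; lia.
have [||r [rel rE _]] := @bracket_rel_window g (a + b) a 0%N; try lia.
have ra : r a = 1 by have := rE 0%N isT; rewrite addn0.
have lt_a : (a <= a + b)%N by lia.
have := sum_solve (F := fun q => e q (u (a + b - q)%N x)) lt_a
  (bracket_rel_eu eC x rel) ra; rewrite addKn => ->.
rewrite linearN linear_sum /=; apply/span_ofN/span_of_sum => -[q lt_q] /= /eqP qa.
rewrite linearZ /=.
have [lt_qa|le_aq] := ltnP q a.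
  apply: span_ofZ.
  have := gil_emuls A (gil_e q (gil_u (a + b - q)%N fx)).
  rewrite (_ : (sumn A + _ = sumn A + a + b + w)%N); last by lia.
  apply: gilS; have := @pow_lt N q a ltac:(lia); have := rhoE N q.
  by have := rhoE N a; lia.
have [lt_q3|le_3q] := ltnP q (a + 3).
  rewrite (_ : r q = 0) ?scale0r; first exact: span_of0.
  have := rE (q - a)%N ltac:(lia); rewrite subnKC; last by lia.
  by move=> ->; case: eqP => //; lia.
have eE y : E A (e q y) = (-1) ^+ size A *: e q (E A y).
  by rewrite (e_emuls eC) scalerA -expr2 sqrr_sign scale1r.
rewrite eE; do 2!apply: span_ofZ.
rewrite (_ : (sumn A + a + b + w = q + (sumn A + (a + b - q) + w))%N); last by lia.
have [A0|A0] := eqVneq A [::].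
  rewrite A0 /= (umul_small eC g _ e_small) ?linear0; first exact: span_of0.
  by move: rng; rewrite A0 /=; case: eqP; lia.
pose m1 := (rk A + m.+1 - 2 ^ (N - last 0 A))%N.
have le_last : (2 ^ (N - last 0 A) <= rk A)%N.
  case/lastP: (A) A0 => // s z _; rewrite last_rcons -cats1 rk_cat rk_cons.
  by have := rhoE N z; have := pow_le N (leq0n z); rewrite subn0; lia.
have lt_last : (last 0 A < a)%N.
  have := nsA; rewrite /nonsingular; case: (A) A0 => //= a1 s _.
  by rewrite rcons_path => /andP[_]; lia.
have gA : gil (sumn A + (a + b - q) + w) m1 (E A (u (a + b - q)%N x)).
  apply: IHA fx _ => //.
  - by move: nsA; rewrite /nonsingular -cats1 => /cat_sorted2[].
  - by move: kA; rewrite all_rcons => /andP[].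
  - case: (A) A0 rng => //= a1 s _; rewrite size_rcons; case: ifP; lia.
  - lia.
  - by move=> _; rewrite /m1; lia.
apply: gilS (gil_e q gA).
have := @pow_lt N (last 0%N A) a ltac:(lia); have := rhoE N q.
by have := rhoE N a; rewrite /m1; lia.
Qed.

(** Counting the ignored u again costs less than 4 2^N; as [last 0 A <= b], this is covered by rho b
    together with the loss 2^(N - last) from [boundary_gil]. *)
Lemma boundary_lower A b f w m x : nonsingular A -> all (leq k) A ->
  main_range k A b -> (sumn A + b <= N)%N -> (last 0 A <= b)%N ->
  fil f w m.+1 x ->
  fil true (sumn A + b + w) (rk A + rho b + m) (E A (u b x)).
Proof.
move=> nsA kA rng leN le_b fx.
have [A0|A0] := eqVneq A [::].
  rewrite A0 /= (umul_small eC g _ e_small) ?linear0; first exact: span_of0.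
  by move: rng; rewrite A0.
pose m' := (rk A + m.+1 - 2 ^ (N - last 0 A))%N.
have le_last : (2 ^ (N - last 0 A) <= rk A)%N.
  case/lastP: (A) A0 => // s z _; rewrite last_rcons -cats1 rk_cat rk_cons.
  by have := rhoE N z; have := pow_le N (leq0n z); rewrite subn0; lia.
apply: (gil_fil _ (boundary_gil (m' := m') nsA kA rng leN fx _)); last first.
  by rewrite /m'; lia.
by have := pow_le N le_b; have := rhoE N b; rewrite /m'; lia.
Qed.

(** Multiplication by delta(e_s): the Leibniz expansion of [delta] on the word [s], without the term
    in which [delta] reaches [x]. *)
Fixpoint dmul s x : V :=
  if s is i :: s' then u i (E s' x) - e i (dmul s' x) else 0.

Lemma dmulP s : linear (dmul s).
Proof.
move=> a x y; elim: s => [|i s IHs] /=; first by rewrite scaler0 addr0.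
rewrite IHs (linearP (E s)) (linearP (u i)) (linearP (e i)) scalerBr.
by rewrite opprD addrACA.
Qed.

HB.instance Definition _ s :=
  GRing.isLinear.Build rat V V _ (dmul s) (@dmulP s).

Lemma delta_emuls s x :
  delta (E s x) = dmul s x + (-1) ^+ size s *: E s (delta x).
Proof.
elim: s => [|i s IHs] /=; first by rewrite add0r scale1r.
rewrite delta_e IHs (linearD (e i)) (linearZ_LR (e i)) /= opprD addrA.
by rewrite exprS mulN1r scaleNr.
Qed.

Lemma delta_dmul s x :
  delta (dmul s x) = (-1) ^+ (size s).+1 *: dmul s (delta x).
Proof.
elim: s => [|i s IHs] /=; first by rewrite linear0 scaler0.
rewrite (linearB delta) (delta_umul eC delta_e) delta_emuls delta_e IHs.
rewrite (linearD (u i)) !(linearZ_LR (u i)) !(linearZ_LR (e i)) /=.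
rewrite opprB [LHS]addrC addrA subrK addrC scalerBr.
by rewrite !exprS !mulN1r !scaleNr !opprK.
Qed.

Lemma fil_dmul f w m s x :
  fil f w m x -> fil true (sumn s + w) (rk s + m) (dmul s x).
Proof.
move=> fx; elim: s => [|i s IHs] /=; first exact: span_of0.
have := fil_u i (fil_emuls s fx); have := fil_e i IHs.
by rewrite !addnA => h1 h2; apply: span_ofB.
Qed.

(** For the word a, a+3, ... Leibniz gives u_a e_(a+3) ... minus e_a times the expansion of the
    tail. Modulo lower rank the latter starts with c' e_a u_(a+3), which [eu3_swap] turns into - c'
    c u_a e_(a+3); the total 1 + c' c is positive. *)
Lemma dmul_dense b : b != [::] -> sorted (fun i j => j == i + 3)%N b ->
  (0 < head 0 b)%N -> (sumn b <= N)%N -> exists2 c : rat, 0 < c &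
  forall f w m x, fil f w m.+1 x -> fil true (sumn b + w) (rk b + m)
    (dmul b x - c *: u (head 0%N b) (E (behead b) x)).
Proof.
case: b => // a b _; elim: b a => [|a' b IHb] a.
  move=> _ a_gt0 leN; exists 1 => // f w m x fx /=.
  by rewrite linear0 subr0 scale1r subrr; apply: span_of0.
rewrite [sorted _ _]/= => /andP[/eqP -> den] a_gt0 leN.
rewrite /= in a_gt0 leN.
have [||c' c'_gt0 Hc'] := IHb (a + 3)%N den; try by rewrite /=; lia.
have [|c c_gt0 Hc] := @eu3_swap a a_gt0; first by lia.
exists (1 + c' * c) => [|f w m x fx]; first by rewrite addr_gt0 // mulr_gt0.
have key (z D : V) S : span_of S mon (e a (u (a + 3) z) + c *: u a (e (a + 3)%N z)) ->
    span_of S mon (e a (D - c' *: u (a + 3) z)) ->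
    span_of S mon (u a (e (a + 3)%N z) - e a D - (1 + c' * c) *: u a (e (a + 3)%N z)).
  move=> fz fr.
  have -> : u a (e (a + 3)%N z) - e a D - (1 + c' * c) *: u a (e (a + 3)%N z) =
    - e a (D - c' *: u (a + 3)%N z) -
    c' *: (e a (u (a + 3)%N z) + c *: u a (e (a + 3)%N z)).
    rewrite (linearB (e a)) (linearZ_LR (e a)) /= opprB scalerDr scalerA.
    have H (X Y Z : V) : X - Y - (X + Z) = - Y - Z.
      by rewrite opprD addrA [X - Y]addrC addrK.
    by rewrite scalerDl scale1r !H.
  by apply: span_ofB; [apply: span_ofN | apply: span_ofZ].
have := fil_emuls b fx; rewrite addnS => /Hc fz.
have fr := fil_e a (Hc' _ _ _ _ fx); rewrite /= !addnA in fz fr *.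
by rewrite -!addnA in fz fr *; apply: (key (E b x) (dmul (a + 3 :: b)%N x)).
Qed.

Definition zmul bs (J : {fset nat}) x : V :=
  foldr (fun b y => if head 0%N b \in J then dmul b y else E b y) x bs.

(** The xi(k)-monomial as a word of operators on [v]; [xiE] identifies it with [xi] on chains. *)
Definition xim (IJ : seq nat * {fset nat}) : V :=
  E (main_part k IJ.1) (zmul (dense_parts k IJ.1) IJ.2 v).

Definition xsp f m : V -> Prop := span_of (fun IJ =>
  [/\ distinguished k IJ.1 IJ.2, sumn IJ.1 = N, (rk IJ.1 < m)%N &
      f ==> (IJ.2 != fset0)]) xim.

Lemma umuls_perm B B' x : perm_eq B B' -> umuls B x = umuls B' x.
Proof.
have rem_b b D y : b \in D -> umuls D y = u b (umuls (rem b D) y).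
  elim: D => //= d D IHD; rewrite in_cons eq_sym; have [->|_] //= := eqVneq.
  by move=> /IHD ->; rewrite (umulC eC).
elim: B B' => [|b B IHB] B'; first by rewrite perm_sym => /perm_nilP ->.
move=> pB; have bB' : b \in B' by rewrite -(perm_mem pB) mem_head.
rewrite (rem_b _ _ _ bB') /= (IHB (rem b B')) //.
by rewrite -(perm_cons b); apply: perm_trans pB (perm_to_rem bB').
Qed.

Lemma mon_perm A A' B B' : perm_eq A A' -> perm_eq B B' ->
  exists b : bool, mon (A, B) = (-1) ^+ b *: mon (A', B').
Proof.
move=> /(emuls_perm eC)[b bE] pB; exists b.
by rewrite /mon /= bE (umuls_perm _ pB).
Qed.

Lemma mon_fil A B :
  fil (B != [::]) (sumn A + sumn B) (rk A + rk B).+1 (mon (A, B)).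
Proof. by apply: (@span_of_gen _ _ _ mon (A, B)); split=> //; apply: implybb. Qed.

(** With [lead_parts], this describes the leading monomial of a product of dense blocks: a marked
    block carries u on its head and e on its other parts. *)
Definition rest_parts (J : {fset nat}) bs : seq nat :=
  flatten [seq if head 0%N b \in J then behead b else b | b <- bs].

Definition lead_parts (J : {fset nat}) bs : seq nat :=
  [seq head 0%N b | b <- bs & head 0%N b \in J].

Lemma rest_parts_cons J b bs : rest_parts J (b :: bs) =
  (if head 0%N b \in J then behead b else b) ++ rest_parts J bs.
Proof. by []. Qed.

Lemma lead_parts_cons J b bs : lead_parts J (b :: bs) =
  if head 0%N b \in J then head 0%N b :: lead_parts J bs else lead_parts J bs.
Proof. by rewrite /lead_parts /=; case: ifP. Qed.

Lemma rest_lead_perm J bs : all (fun b => b != [::]) bs ->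
  perm_eq (rest_parts J bs ++ lead_parts J bs) (flatten bs).
Proof.
elim: bs => //= b bs IHbs /andP[b0 /IHbs pbs].
rewrite rest_parts_cons lead_parts_cons; case: ifP => Jb /=; last first.
  by rewrite -catA perm_cat2l.
case: b b0 Jb => //= x b _ _.
by rewrite (perm_catCA (b ++ _) [:: x]) /= perm_cons -catA perm_cat2l.
Qed.

Lemma zmul_fil bs J f w m x : fil f w m x ->
  fil (f || has (fun b => head 0%N b \in J) bs)
      (sumn (flatten bs) + w) (rk (flatten bs) + m) (zmul bs J x).
Proof.
move=> fx; elim: bs => [|b bs IHbs] /=; first by rewrite orbF.
rewrite sumn_cat rk_cat -!addnA; case: ifP => _ /=.
  by rewrite orbT; apply: fil_dmul IHbs.
exact: fil_emuls.
Qed.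

Lemma vac_fil : fil false 0 1 v.
Proof. by apply: (@span_of_gen _ _ _ mon ([::], [::])). Qed.

Lemma zmul_lower bs J :
  all (fun b => b != [::]) bs -> all (sorted (fun i j => j == i + 3)%N) bs ->
  all (fun b => 0 < head 0 b)%N bs -> (sumn (flatten bs) <= N)%N ->
  exists2 c : rat, 0 < c &
    fil (lead_parts J bs != [::]) (sumn (flatten bs)) (rk (flatten bs))
      (zmul bs J v - c *: mon (rest_parts J bs, lead_parts J bs)).
Proof.
elim: bs => [|b bs IHbs] /=.
  by exists 1 => //; rewrite scale1r subrr; apply: span_of0.
move=> /andP[b0 bs0] /andP[sb sbs] /andP[hb hbs]; rewrite sumn_cat rk_cat => leN.
have [|c' c'_gt0 fz] := IHbs bs0 sbs hbs; first exact: leq_trans (leq_addl _ _) leN.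
have fm : fil (lead_parts J bs != [::]) (sumn (flatten bs)) (rk (flatten bs)).+1
    (mon (rest_parts J bs, lead_parts J bs)).
  have := mon_fil (rest_parts J bs) (lead_parts J bs).
  by rewrite -sumn_cat -rk_cat (perm_sumn (rest_lead_perm J bs0))
             (rk_perm _ (rest_lead_perm J bs0)).
have M1 h b' : mon (b' ++ rest_parts J bs, h :: lead_parts J bs) =
    u h (E b' (mon (rest_parts J bs, lead_parts J bs))).
  by rewrite /mon /= emuls_cat !umul_emuls.
have M2 b' : mon (b' ++ rest_parts J bs, lead_parts J bs) =
    E b' (mon (rest_parts J bs, lead_parts J bs)).
  by rewrite /mon /= emuls_cat.
rewrite rest_parts_cons lead_parts_cons.
move: (mon (rest_parts J bs, _)) (zmul bs J v) => M Z in fz fm M1 M2 *.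
have fZ : fil (lead_parts J bs != [::]) (sumn (flatten bs)) (rk (flatten bs)).+1 Z.
  rewrite -[Z](subrK (c' *: M)); apply: span_ofD; last exact: span_ofZ.
  by apply: filS fz; rewrite ?implybb.
case: ifP => Jb.
  have [|c c_gt0 fb] := dmul_dense b0 sb hb.
    exact: leq_trans (leq_addr _ _) leN.
  exists (c * c'); first exact: mulr_gt0.
  have -> : dmul b Z - (c * c') *: mon (behead b ++ rest_parts J bs,
                                        head 0%N b :: lead_parts J bs) =
      (dmul b Z - c *: u (head 0%N b) (E (behead b) Z)) +
      c *: u (head 0%N b) (E (behead b) (Z - c' *: M)).
    rewrite M1 (linearB (E _)) (linearB (u _)) (linearZ_LR (E _)).
    by rewrite (linearZ_LR (u _)) /= scalerBr scalerA addrA subrK.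
  apply: span_ofD; first exact: fb fZ.
  apply: span_ofZ; move: (fil_u (head 0%N b) (fil_emuls (behead b) fz)).
  by case: (b) b0 => //= h b' _; rewrite rk_cons !addnA.
exists c' => //; rewrite M2 -(linearZ_LR (E b)) -(linearB (E b)) /=.
exact: fil_emuls.
Qed.

Lemma fil_xsp_lower f m x :
  (forall A B, (sumn A + sumn B = N)%N -> (rk A + rk B < m)%N ->
     xsp (B != [::]) (rk A + rk B).+1 (mon (A, B))) ->
  fil f N m x -> xsp f m x.
Proof.
move=> IH; apply: (span_of_map (f := idfun)) => -[A B] /= [sN lt_m Bf].
apply: span_ofS (IH A B sN lt_m) => -[I J] [dIJ sI lt_I BJ]; split=> //.
  exact: leq_trans lt_I lt_m.
by apply/implyP => /(implyP Bf) /(implyP BJ).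
Qed.

Lemma sorted_take_index s b : sorted ltn s -> b \in s ->
  take (index b s) s = [seq x <- s | (x < b)%N].
Proof.
move=> ss sb; apply: (irr_sorted_eq ltn_trans ltnn).
- exact: take_sorted.
- exact: sorted_filter ltn_trans _ _ ss.
move=> x; rewrite mem_filter; have [sx|nsx] := boolP (x \in s); last first.
  by rewrite andbF; apply/negP => /mem_take; apply/negP.
rewrite in_take // andbT; apply/idP/idP.
  exact: (sorted_ltn_index ltn_trans ss _ _ sx sb).
move=> lt_xb; rewrite ltnNge; apply/negP; rewrite leq_eqVlt => /predU1P[eq_i|].
  by move: lt_xb; rewrite -(nth_index 0%N sx) -eq_i nth_index // ltnn.
by move/(sorted_ltn_index ltn_trans ss _ _ sb sx); rewrite /= ltnNge ltnW.
Qed.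

(** * Irreducible monomials as leading monomials of xi(k)-monomials *)

Section StandardMonomial.
Variables (A B : seq nat).
Hypotheses (uA : uniq A) (kA : all (leq k) A) (uB : uniq B).
Hypothesis leadB : all (fun b => 2 * k < b)%N B.
Hypothesis sepA : forall a b, a \in A -> b \in A -> (a < b)%N -> (a + 3 <= b)%N.
Hypothesis sepB : forall a b, a \in B -> b \in B -> (a < b)%N -> (a + 3 < b)%N.
Hypothesis sepAB : forall a b, a \in A -> b \in B ->
  (a + 3 < b)%N || (b + 3 <= a)%N.
Hypothesis sN : (sumn A + sumn B = N)%N.

Local Notation I := (sort leq (A ++ B)).

Lemma std_mem (x : nat) : (x \in I) = (x \in A) || (x \in B).
Proof. by rewrite mem_sort mem_cat. Qed.

Lemma std_uniq : uniq I.
Proof.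
rewrite sort_uniq cat_uniq uA uB andbT; apply/hasPn => b Bb; apply/negP => Ab.
by have := sepAB Ab Bb; lia.
Qed.

Lemma std_sorted : sorted ltn I.
Proof. by rewrite ltn_sorted_uniq_leq std_uniq (sort_sorted leq_total). Qed.

Lemma std_nonsingular : nonsingular I.
Proof.
apply/(sortedP 0%N) => j lt_j.
have := sorted_ltn_nth ltn_trans 0%N std_sorted j j.+1 (ltnW lt_j) lt_j (ltnSn j).
have := mem_nth 0%N (ltnW lt_j); have := mem_nth 0%N lt_j; rewrite !std_mem.
move: (nth 0%N I j) (nth 0%N I j.+1) => x y.
move=> /orP[hy|hy] /orP[hx|hx] /= lt_xy.
- exact: sepA.
- by have := sepAB hy hx; lia.
- by have := sepAB hx hy; lia.
- by have := sepB hx hy lt_xy; lia.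
Qed.

Lemma std_kpartition : kpartition k I.
Proof.
rewrite /kpartition path_sortedE; last exact: leq_trans.
rewrite (sort_sorted leq_total) andbT all_sort all_cat kA /=.
by apply: sub_all leadB => b; lia.
Qed.

(** Once the smallest u is outside the main range, all later parts are too by [main_at_le]; the
    separation conditions exclude a part exactly 3 below a u. *)
Lemma std_lead : (forall b, b \in B -> (forall c, c \in B -> b <= c)%N ->
    ~~ main_range k (sort leq [seq a <- A | (a < b)%N]) b) ->
  forall b, b \in B -> b \in leading k I.
Proof.
move=> firstB b Bb.
have [b0 Bb0 b0_min] : exists2 b0, b0 \in B & forall c, c \in B -> (b0 <= c)%N.
  have Bs : (0 < size (sort leq B))%N by rewrite size_sort; case: (B) Bb.
  exists (nth 0%N (sort leq B) 0); first by rewrite -(mem_sort leq) mem_nth.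
  move=> c; rewrite -(mem_sort leq) => Bc; rewrite -(nth_index 0%N Bc).
  apply: (sorted_leq_nth leq_trans leqnn) => //.
  - exact: (sort_sorted leq_total).
  - by rewrite inE index_mem.
have Ib : b \in I by rewrite std_mem Bb orbT.
have Ib0 : b0 \in I by rewrite std_mem Bb0 orbT.
apply/(leadingP k_gt0 std_kpartition std_nonsingular).
exists (index b I); rewrite index_mem nth_index //; split=> //.
  have := firstB b0 Bb0 b0_min; apply: contra => mb.
  have -> : sort leq [seq a <- A | (a < b0)%N] = take (index b0 I) I.
    rewrite (sorted_take_index std_sorted Ib0); apply: (irr_sorted_eq ltn_trans ltnn).
    - by rewrite ltn_sorted_uniq_leq sort_uniq filter_uniq // (sort_sorted leq_total).
    - exact: sorted_filter ltn_trans _ _ std_sorted.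
    move=> x; rewrite mem_sort !mem_filter std_mem.
    case: ltnP => //= lt_x; case Bx: (x \in B); last by rewrite orbF.
    by move: lt_x; rewrite ltnNge b0_min.
  have := @main_at_le _ k_gt0 _ std_kpartition std_nonsingular (index b0 I) (index b I).
  rewrite !nth_index //; apply=> //; rewrite index_mem Ib andbT leqNgt.
  apply/negP => lt_i; have := sorted_ltn_index ltn_trans std_sorted _ _ Ib Ib0 lt_i.
  by rewrite /= ltnNge b0_min.
have [->|i_gt0] := posnP (index b I); [by left|right].
have lt_i : (index b I < size I)%N by rewrite index_mem.
have := @nonsingular_nth _ (index b I).-1 (index b I) std_nonsingular ltac:(lia).
rewrite nth_index // (_ : _ - _ = 1)%N; last by lia.
rewrite muln1 leq_eqVlt => /predU1P[eq3|//]; exfalso.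
have : nth 0%N I (index b I).-1 \in I.
  exact/mem_nth/(leq_ltn_trans (leq_pred _)).
move: eq3; move: (nth _ _ _) => a eq3; rewrite std_mem => /orP[Aa|Ba].
  by move: eq3 (sepAB Aa Bb); clear; lia.
by move: eq3 (sepB Ba Bb); clear; lia.
Qed.

(** With J = B, the xi(k)-monomial of (I; J) is a nonzero multiple of this monomial modulo lower
    rank, and lower rank is covered by the last hypothesis. *)
Lemma std_monomial : {subset B <= leading k I} ->
  (forall f x, fil f N (rk A + rk B) x -> xsp f (rk A + rk B) x) ->
  xsp (B != [::]) (rk A + rk B).+1 (mon (A, B)).
Proof.
move=> leadI IH; pose J := [fset b in B].
pose bs := dense_parts k I; pose Im := main_part k I.
have IE : Im ++ flatten bs = I by apply: main_part_normal_form.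
have pI : perm_eq I (A ++ B) by rewrite perm_sort.
have dIJ : distinguished k I J.
  rewrite /distinguished std_kpartition std_nonsingular /=.
  by apply/fsubsetP => b; rewrite in_fset => /leadI.
have JE (x : nat) : (x \in J) = (x \in B) by rewrite in_fset.
have sI : sumn I = N by rewrite (perm_sumn pI) sumn_cat.
have rI : rk I = (rk A + rk B)%N by rewrite (rk_perm _ pI) rk_cat.
have bs0 : all (fun b => b != [::]) bs by apply: runs_nonempty.
have sbs : all (sorted (fun i j => j == i + 3)%N) bs by apply: runs_steps.
have hI : {subset [seq head 0%N b | b <- bs] <= I}.
  move=> x /(mem_subseq (runs_heads_subseq _)) hx; rewrite -IE mem_cat.
  by rewrite /bs /dense_parts runs_flatten hx orbT.
have hbs : all (fun b => 0 < head 0 b)%N bs.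
  apply/allP => b bsb; have /hI : head 0%N b \in [seq head 0%N b | b <- bs].
    exact: map_f.
  by move/(allP (kpartition_all std_kpartition)); apply: leq_trans.
have sbsN : (sumn (flatten bs) <= N)%N by rewrite -sI -IE sumn_cat leq_addl.
have [c c_gt0 fz] := zmul_lower J bs0 sbs hbs sbsN.
have pB : perm_eq (lead_parts J bs) B.
  have uh : uniq [seq head 0%N b | b <- bs].
    apply: subseq_uniq (runs_heads_subseq _) _; apply: drop_uniq.
    exact: std_uniq.
  have lE : lead_parts J bs = [seq x <- [seq head 0%N b | b <- bs] | x \in J].
    by rewrite filter_map.
  apply: uniq_perm => //; first by rewrite lE filter_uniq.
  move=> x; rewrite lE mem_filter JE; case Bx: (x \in B) => //=.
  by have := leadI x Bx => /imfsetP[b /= bsb ->]; apply: map_f.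
have pA : perm_eq (Im ++ rest_parts J bs) A.
  have := rest_lead_perm J bs0; rewrite -(perm_cat2l Im) catA IE => p1.
  have p2 := perm_trans p1 pI; rewrite -(perm_cat2r B).
  by apply: perm_trans p2; rewrite perm_cat2l perm_sym.
have [b1 monE] := mon_perm pA pB.
have fI := fil_emuls Im fz; rewrite -sumn_cat -rk_cat IE sI rI in fI.
have XE : E Im (zmul bs J v - c *: mon (rest_parts J bs, lead_parts J bs)) =
    xim (I, J) - c *: ((-1) ^+ b1 *: mon (A, B)).
  rewrite (linearB (E Im)) (linearZ_LR (E Im)) /= -monE.
  by rewrite /mon /= emuls_cat.
rewrite XE in fI.
have fB : (lead_parts J bs != [::]) = (B != [::]).
  by have := perm_size pB; case: (lead_parts J bs) (B) => [|? ?] [].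
rewrite fB in fI; have xI := IH _ _ fI.
have cb0 : c * (-1) ^+ b1 != 0 by rewrite mulf_neq0 ?signr_eq0 ?lt0r_neq0.
have -> : mon (A, B) = (c * (-1) ^+ b1)^-1 *: (xim (I, J) -
    (xim (I, J) - c *: ((-1) ^+ b1 *: mon (A, B)))).
  by rewrite opprB addrC subrK [c *: _]scalerA scalerA mulVf ?scale1r.
apply/span_ofZ/span_ofB.
  apply: (@span_of_gen _ _ _ xim (I, J)); split=> //=; first by rewrite rI.
  apply/implyP; case: (B) JE => // b B' JE _; apply/fset0Pn; exists b.
  by rewrite JE mem_head.
by apply: span_ofS xI => -[I' J'] [? ? lt_I ?]; split=> //; apply: leqW.
Qed.

End StandardMonomial.

Lemma fil_cast f w w' m m' x : fil f w m x -> w = w' -> m = m' -> fil f w' m' x.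
Proof. by move=> fx <- <-. Qed.

(** Each violation of the separation conditions, and a smallest u in main range, is removed by one
    of the lowering lemmas or by [eu3_swap]; a monomial without any is standard. *)
Lemma straighten A B : (sumn A + sumn B = N)%N ->
  xsp (B != [::]) (rk A + rk B).+1 (mon (A, B)).
Proof.
(* A lexicographic measure: exchanging e_p u_(p+3) for u_p e_(p+3) keeps the rank but lowers the sum
   of the indices of the u, a sum that never exceeds N. *)
have [n] := ubnP ((rk A + rk B) * N.+1 + sumn B)%N.
elim: n A B => // n IHn A B lt_n sN.
have lowS f x : fil f N (rk A + rk B) x -> xsp f (rk A + rk B) x.
  apply: fil_xsp_lower => A' B' sN' lt_rk; apply: IHn => //.
  apply: (@leq_trans ((rk A + rk B) * N.+1)); last first.
    by rewrite -ltnS; apply: leq_trans lt_n; rewrite ltnS leq_addr.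
  apply: (@leq_trans ((rk A' + rk B').+1 * N.+1)); last by rewrite leq_mul2r lt_rk orbT.
  by rewrite mulSn addnC ltn_add2r ltnS -sN' leq_addl.
have low f x : (B != [::]) ==> f -> fil f N (rk A + rk B) x ->
    xsp (B != [::]) (rk A + rk B).+1 x.
  move=> Bf /lowS; apply: span_ofS => -[I J] [? ? lt_I fJ]; split=> //.
    exact: leqW.
  by apply/implyP => /(implyP Bf) /(implyP fJ).
have lowT x : fil true N (rk A + rk B) x -> xsp (B != [::]) (rk A + rk B).+1 x.
  by apply: low; rewrite implybT.
have low0 : mon (A, B) = 0 -> xsp (B != [::]) (rk A + rk B).+1 (mon (A, B)).
  by move=> ->; apply: span_of0.
have lowM A' B' f : perm_eq A A' -> perm_eq B B' -> (B != [::]) ==> f ->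
    fil f (sumn A' + sumn B') (rk A' + rk B') (mon (A', B')) ->
    xsp (B != [::]) (rk A + rk B).+1 (mon (A, B)).
  move=> pA pB Bf; have [b ->] := mon_perm pA pB.
  rewrite -(perm_sumn pA) -(perm_sumn pB) -(rk_perm _ pA) -(rk_perm _ pB) sN.
  by move=> fM; apply/span_ofZ/low/fM.
have [uA|nuA] := boolP (uniq A); last by apply: low0; apply: emuls_dup.
have [kA|] := boolP (all (leq k) A); last first.
  rewrite -has_predC => /hasP[a Aa]; rewrite /= -ltnNge => lt_ak.
  by apply: low0; apply: (emuls_mem0 eC _ _ Aa) => y; apply: e_small.
have [leadB|] := boolP (all (fun b => 2 * k < b)%N B); last first.
  rewrite -has_predC => /hasP[b Bb]; rewrite /= -leqNgt => le_bk.
  apply: low0; rewrite /mon /= (umuls_perm _ (perm_to_rem Bb)) /=.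
  by rewrite (umul_small eC g _ e_small) // linear0.
have [/hasP[a Aa /hasP[b Ab ab]]|/hasPn nearA] :=
    boolP (has (fun a => has (fun b => a < b <= a + 2)%N A) A).
  have bA1 : b \in rem a A by rewrite mem_rem_uniq // inE Ab andbT; lia.
  pose A' := [:: a, b & rem b (rem a A)].
  have pA : perm_eq A A'.
    by rewrite (perm_trans (perm_to_rem Aa)) // perm_cons perm_to_rem.
  apply: (lowM A' B (B != [::]) pA) => //; first exact: implybb.
  have leN : (a + b <= N)%N by rewrite -sN (perm_sumn pA) /= addnA -addnA leq_addr.
  have := ee_lower ab leN (mon_fil (rem b (rem a A)) B).
  by rewrite /A' /= !rk_cons !addnA.
have [/hasP[a Aa /hasP[b Bb /andP[ab ba]]]|/hasPn nearAB] :=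
    boolP (has (fun a => has (fun b => (a <= b + 2) && (b <= a + 2))%N B) A).
  have pA := perm_to_rem Aa; have pB := perm_to_rem Bb.
  apply: (lowM _ _ true pA pB); rewrite ?implybT //.
  have leN : (a + b <= N)%N.
    by rewrite -sN (perm_sumn pA) (perm_sumn pB) /= addnACA leq_addr.
  have := eu_lower ab ba leN (mon_fil (rem a A) (rem b B)).
  rewrite /mon /= umul_emuls !rk_cons.
  by move/fil_cast; apply; clear; lia.
have [/hasP[a Ba /hasP[b Bb /andP[ab ba]]]|/hasPn nearB] :=
    boolP (has (fun a => has (fun b => (a <= b + 3) && (b <= a + 3))%N (rem a B)) B).
  pose B' := [:: a, b & rem b (rem a B)].
  have pB : perm_eq B B'.
    by rewrite (perm_trans (perm_to_rem Ba)) // perm_cons perm_to_rem.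
  apply: (lowM A B' true (perm_refl A) pB); rewrite ?implybT //.
  have leN : (a + b <= N)%N
    by rewrite -sN (perm_sumn pB) /= addnCA leq_add2l addnCA leq_addr.
  have := uu_lower ab ba leN (mon_fil A (rem b (rem a B))).
  rewrite /mon /B' /= !umul_emuls !rk_cons.
  by move/fil_cast; apply; clear; lia.
have [/hasP[p Ap Bp]|/hasPn no3] := boolP (has (fun a => a + 3 \in B)%N A).
  have pA := perm_to_rem Ap; have pB := perm_to_rem Bp.
  have sM := sN; rewrite (perm_sumn pA) (perm_sumn pB) /= in sM.
  have p_gt0 : (0 < p)%N by apply: leq_trans k_gt0 (allP kA p Ap).
  have [|c _ Hc] := @eu3_swap p p_gt0; first by rewrite -sM; clear; lia.
  have fX := Hc _ _ _ _ (mon_fil (rem p A) (rem (p + 3)%N B)).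
  have [b ->] := mon_perm pA pB; apply: span_ofZ.
  have -> : mon (p :: rem p A, (p + 3)%N :: rem (p + 3)%N B) =
      (e p (u (p + 3) (mon (rem p A, rem (p + 3)%N B))) +
       c *: u p (e (p + 3)%N (mon (rem p A, rem (p + 3)%N B)))) -
      c *: mon ((p + 3)%N :: rem p A, p :: rem (p + 3)%N B).
    by rewrite /mon /= -(e_umul eC) !umul_emuls addrK.
  have rkE : (rk ((p + 3)%N :: rem p A) + rk (p :: rem (p + 3)%N B) =
              rk A + rk B)%N.
    by rewrite (rk_perm _ pA) (rk_perm _ pB) !rk_cons; clear; lia.
  apply: span_ofB.
    apply: lowT; move: fX; rewrite (rk_perm _ pA) (rk_perm _ pB) !rk_cons.
    by move/fil_cast; apply; rewrite -?sM; clear; lia.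
  apply: span_ofZ; rewrite -rkE; apply: span_ofS (IHn _ _ _ _).
  - by move=> -[I J] [? ? ? J0]; split=> //; apply/implyP => _.
  - rewrite rkE; move: (lt_n); rewrite ltnS; apply: leq_trans.
    rewrite ltn_add2l (perm_sumn pB) /=.
    by clear; lia.
  - by rewrite -sM /=; clear; lia.
have uB : uniq B.
  apply: count_mem_uniq => b; have [Bb|nBb] := boolP (b \in B); last first.
    by apply/count_memPn.
  rewrite (permP (perm_to_rem Bb)) /= eqxx (count_memPn _) //.
  by apply/negP => b2; have := nearB _ Bb => /hasPn/(_ _ b2); rewrite leq_addr.
have sepA a b : a \in A -> b \in A -> (a < b)%N -> (a + 3 <= b)%N.
  by move=> Aa Ab lt_ab; have := nearA _ Aa => /hasPn/(_ _ Ab); lia.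
have sepB a b : a \in B -> b \in B -> (a < b)%N -> (a + 3 < b)%N.
  move=> Ba Bb lt_ab; have := nearB _ Ba => /hasPn/(_ b).
  by rewrite mem_rem_uniq // inE Bb andbT; lia.
have sepAB a b : a \in A -> b \in B -> (a + 3 < b)%N || (b + 3 <= a)%N.
  move=> Aa Bb; have := nearAB _ Aa => /hasPn/(_ _ Bb).
  by have : b != (a + 3)%N by [apply: contraNneq (no3 _ Aa) => <-]; lia.
have [/hasP[b Bb /andP[/allP b_min rng]]|/hasPn noMin] := boolP (has (fun b =>
    all (leq b) B && main_range k (sort leq [seq a <- A | (a < b)%N]) b) B).
  set A0 := sort leq _ in rng; pose A1 := [seq a <- A | ~~ (a < b)%N].
  have pA : perm_eq A (A0 ++ A1).
    have h : perm_eq ([seq a <- A | (a < b)%N] ++ A1) A by rewrite perm_filterC.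
    by rewrite perm_sym; apply: perm_trans h; rewrite perm_cat2r perm_sort.
  have pB := perm_to_rem Bb.
  apply: (lowM _ _ true pA pB); rewrite ?implybT //.
  have nsA0 : nonsingular A0.
    apply/(sortedP 0%N) => j lt_j.
    have sA0 : sorted ltn A0.
      by rewrite ltn_sorted_uniq_leq sort_uniq filter_uniq // (sort_sorted leq_total).
    have memA0 i : (i < size A0)%N -> nth 0%N A0 i \in A.
      by move=> /(mem_nth 0%N); rewrite mem_sort mem_filter => /andP[].
    apply: sepA; try by apply: memA0; rewrite // ltnW.
    exact: (sorted_ltn_nth ltn_trans 0%N sA0 j j.+1 (ltnW lt_j) lt_j (ltnSn j)).
  have kA0 : all (leq k) A0.
    by apply/allP => a; rewrite mem_sort mem_filter => /andP[_] /(allP kA).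
  have leN : (sumn A0 + b <= N)%N.
    by rewrite -sN (perm_sumn pA) (perm_sumn pB) sumn_cat /= addnACA leq_addr.
  have le_b : (last 0 A0 <= b)%N.
    have := mem_last 0%N A0; rewrite in_cons => /predU1P[->//|].
    by rewrite mem_sort mem_filter => /andP[/ltnW].
  have := boundary_lower nsA0 kA0 rng leN le_b (mon_fil A1 (rem b B)).
  rewrite /mon /= emuls_cat !umul_emuls sumn_cat rk_cat !rk_cons.
  by move/fil_cast; apply; clear; lia.
apply: std_monomial => //.
apply: std_lead => // b Bb b_min; apply/negP => rng.
have := noMin _ Bb; rewrite rng andbT => /negP[].
by apply/allP.
Qed.

(** * A contracting homotopy on the monomials that are not main *)

(** Each Leibniz term has its u at a position of the main part, preceded only by the earlier main
    e's, which is the situation of [boundary_lower]. *)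
Lemma main_part_lower I J : distinguished k I J -> sumn I = N ->
  fil true N (rk I) (dmul (main_part k I) (zmul (dense_parts k I) J v)).
Proof.
move=> /and3P[kI nI _] sI; set bs := dense_parts k I; set M := main_part k I.
have IE : M ++ flatten bs = I by apply: main_part_normal_form.
have fZ := zmul_fil bs J vac_fil; rewrite addn0 addn1 in fZ.
move: (zmul bs J v) (_ || _) fZ => Z f fZ.
suff H d r : (r + d = size M)%N -> fil true N (rk I) (E (take r M) (dmul (drop r M) Z)).
  by have := H _ 0%N (add0n _); rewrite take0 drop0.
elim: d r => [|d IHd] r rd.
  rewrite drop_oversize; last by rewrite -rd addn0.
  by rewrite /= linear0; apply: span_of0.
have lt_r : (r < size M)%N by rewrite -rd addnS ltnS leq_addr.
have lt_rI : (r < main_length k I)%N.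
  by apply: leq_trans lt_r _; rewrite size_take; case: ltnP.
have /andP[lt_rs rng] : (r < size I)%N && main_range k (take r I) (nth 0%N I r).
  by rewrite -main_lengthP.
have tE : take r M = take r I by rewrite /M /main_part take_takel ?(ltnW lt_rI).
have nE : nth 0%N M r = nth 0%N I r by rewrite /M /main_part nth_take.
have dIE : drop r.+1 M ++ flatten bs = drop r.+1 I.
  by rewrite -[in RHS]IE drop_cat; case: ltnP => // h;
    rewrite drop_oversize // (_ : _ - _ = 0)%N ?drop0 //; lia.
rewrite (drop_nth 0%N lt_r) /= (linearB (E _)) /=; apply: span_ofB; last first.
  have := IHd r.+1; rewrite (take_nth 0%N lt_r) -cats1 emuls_cat /=; apply.
  by rewrite addSn -addnS.
have splitI : take r I ++ nth 0%N I r :: drop r.+1 I = I.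
  by rewrite -(drop_nth 0%N lt_rs) cat_take_drop.
have sI' := sI; rewrite -splitI sumn_cat /= in sI'.
have fx := fil_emuls (drop r.+1 M) fZ; rewrite addnS -sumn_cat -rk_cat dIE in fx.
have := @boundary_lower (take r I) (nth 0%N I r) _ _ _ _ _ _ rng _ _ fx.
rewrite tE nE -!addnA sI' => h; rewrite -[X in rk X]splitI rk_cat rk_cons; apply: h.
- exact: take_sorted.
- by apply/allP => i /mem_take; apply: (allP (kpartition_all kI)).
- by rewrite -sI' addnA leq_addr.
- have := mem_last 0%N (take r I); rewrite in_cons => /predU1P[->//|].
  move=> /(nthP 0%N)[j]; rewrite size_take lt_rs => lt_j <-; rewrite nth_take //.
  apply: (sorted_leq_nth leq_trans leqnn _ (kpartition_sorted kI)) => //.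
    by rewrite inE (ltn_trans lt_j).
  exact: ltnW.
Qed.

Lemma zmul_ext bs J K x :
  {in [seq head 0%N b | b <- bs], forall i, (i \in J) = (i \in K)} ->
  zmul bs J x = zmul bs K x.
Proof.
elim: bs => //= b bs IHbs JK; rewrite JK ?mem_head // IHbs // => i bsi.
by apply: JK; rewrite in_cons bsi orbT.
Qed.

Lemma zmul_cons_mem b bs J x : head 0%N b \in J ->
  zmul (b :: bs) J x = dmul b (zmul bs J x).
Proof. by move=> /= ->. Qed.

Lemma zmul_cons_notin b bs J x : head 0%N b \notin J ->
  zmul (b :: bs) J x = E b (zmul bs J x).
Proof. by move=> /= /negPf ->. Qed.

Lemma zmul_fset1U b bs J x : head 0%N b \notin [seq head 0%N b | b <- bs] ->
  zmul (b :: bs) (head 0%N b |` J) x = dmul b (zmul bs J x).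
Proof.
move=> nb; rewrite zmul_cons_mem ?fset1U1 //; congr (dmul b _); apply: zmul_ext => i bsi.
by rewrite in_fset1U; have [ib|] //= := eqVneq; rewrite -ib bsi in nb.
Qed.

Lemma zmul_fsetD1 b bs J x : head 0%N b \notin [seq head 0%N b | b <- bs] ->
  zmul (b :: bs) (J `\ head 0%N b) x = E b (zmul bs J x).
Proof.
move=> nb; rewrite zmul_cons_notin ?fsetD11 //; congr (E b _); apply: zmul_ext => i bsi.
by rewrite in_fsetD1; have [ib|] //= := eqVneq; rewrite -ib bsi in nb.
Qed.

Definition zsp bs (J : {fset nat}) : V -> Prop := span_of (fun K : {fset nat} =>
  forall i, i \in K -> (i \in J) || (i \in [seq head 0%N b | b <- bs]))
  (fun K => zmul bs K v).

(** On each block [delta] either turns e_b into delta(e_b) or annihilates delta(e_b), so the blocks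
    stay the same and only the set of marked heads varies. *)
Lemma delta_zmul bs J : delta v = 0 -> uniq [seq head 0%N b | b <- bs] ->
  zsp bs J (delta (zmul bs J v)).
Proof.
move=> dv; elim: bs => [_|b bs IHbs /= /andP[nb /IHbs sZ]].
  by rewrite /= dv; apply: span_of0.
have sD : zsp (b :: bs) J (dmul b (delta (zmul bs J v))).
  apply: span_of_map sZ => K JK; rewrite /= -zmul_fset1U //.
  apply: (@span_of_gen _ _ _ (fun K => zmul (b :: bs) K v)) => i.
  rewrite in_fset1U /= in_cons => /predU1P[->|/JK /orP[]->]; rewrite ?eqxx ?orbT //.
have sE : zsp (b :: bs) J (E b (delta (zmul bs J v))).
  apply: span_of_map sZ => K JK; rewrite /= -zmul_fsetD1 //.
  apply: (@span_of_gen _ _ _ (fun K => zmul (b :: bs) K v)) => i.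
  by rewrite in_fsetD1 /= in_cons => /andP[_ /JK /orP[]->]; rewrite ?orbT.
case: ifP => _; first by rewrite delta_dmul; apply: span_ofZ.
rewrite delta_emuls; apply: span_ofD; last exact: span_ofZ.
rewrite -zmul_fset1U //.
apply: (@span_of_gen _ _ _ (fun K => zmul (b :: bs) K v)) => i.
by rewrite in_fset1U /= in_cons => /predU1P[->|->]; rewrite ?eqxx ?orbT.
Qed.

Definition msp m : V -> Prop := span_of (fun IJ =>
  [/\ distinguished k IJ.1 IJ.2, sumn IJ.1 = N, (rk IJ.1 < m)%N &
      dense_parts k IJ.1 != [::]]) xim.

Lemma xsp_msp m x : xsp true m x -> msp m x.
Proof.
apply: span_ofS => -[I J] [dIJ sI lt_I /= J0]; split=> //.
move: dIJ => /and3P[_ _ /fsubsetP JI]; apply/eqP => bs0.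
have /fset0Pn[i /JI /imfsetP[b /=]] := J0.
by rewrite bs0.
Qed.

(** The sign undoes the one that [delta] acquires in passing the main part. *)
Definition homotopy_value (IJ : seq nat * {fset nat}) : V :=
  if dense_parts k IJ.1 is b :: _ then
    if head 0%N b \in IJ.2 then
      (-1) ^+ size (main_part k IJ.1) *: xim (IJ.1, IJ.2 `\ head 0%N b)
    else 0
  else 0.

Variable h : {linear V -> V}.
Hypothesis hE : forall IJ, distinguished k IJ.1 IJ.2 -> sumn IJ.1 = N ->
  h (xim IJ) = homotopy_value IJ.
Hypothesis delta_v : delta v = 0.

Lemma msp_h m x : msp m x -> msp m (h x).
Proof.
apply: span_of_map => -[I J] /= [dIJ sI lt_I bs0]; rewrite hE // /homotopy_value /=.
case bsE: (dense_parts k I) => [|b bs]; first exact: span_of0.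
case: ifP => _; last exact: span_of0.
apply: span_ofZ; apply: (@span_of_gen _ _ _ xim (I, _)); split=> //=.
case/and3P: dIJ => kI nI JI; apply/and3P; split=> //.
exact: fsubset_trans (fsubsetDl _ _) JI.
Qed.

(** The terms of [delta] acting on the main part have lower rank by [main_part_lower]. Those acting
    on later blocks cancel between delta h and h delta, or are killed by h when the first block is
    unmarked. Those acting on the first block give the monomial back. *)
Lemma homotopy_lower I J : distinguished k I J -> sumn I = N ->
  dense_parts k I != [::] ->
  msp (rk I) (delta (h (xim (I, J))) + h (delta (xim (I, J))) - xim (I, J)).
Proof.
move=> dIJ sI; case bsE: (dense_parts k I) => [//|b bs] _.
have lower K : distinguished k I K ->
    msp (rk I) (dmul (main_part k I) (zmul (b :: bs) K v)).
  move=> dIK; apply: xsp_msp; apply: fil_xsp_lower; last first.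
    by rewrite -bsE; apply: main_part_lower.
  by move=> A B sAB _; apply: straighten.
have [kI nI /fsubsetP JI] := and3P dIJ.
have uh : uniq [seq head 0%N b | b <- b :: bs].
  rewrite -bsE; apply: subseq_uniq (runs_heads_subseq _) _; apply: drop_uniq.
  apply: (sorted_uniq ltn_trans ltnn).
  by apply: sub_sorted nI => i j; apply: leq_trans; rewrite addnS ltnS leq_addr.
have [nb ubs] : head 0%N b \notin [seq head 0%N b | b <- bs] /\
    uniq [seq head 0%N b | b <- bs] by apply/andP.
have leadE i : (i \in leading k I) = (i \in [seq head 0%N b | b <- b :: bs]).
  by rewrite -bsE; apply/imfsetP/mapP => -[d]; exists d.
pose M := main_part k I; pose eps : rat := (-1) ^+ size M.
have eps2 (x : V) : eps *: (eps *: x) = x by rewrite scalerA -expr2 sqrr_sign scale1r.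
have ximE K : xim (I, K) = E M (zmul (b :: bs) K v) by rewrite /xim /= bsE.
have distK K : (forall i, i \in K -> i \in [seq head 0%N b | b <- b :: bs]) ->
    distinguished k I K.
  by move=> Kh; apply/and3P; split=> //; apply/fsubsetP => i /Kh; rewrite leadE.
have Jh i : i \in J -> i \in [seq head 0%N b | b <- b :: bs].
  by move=> /JI; rewrite leadE.
pose Z := zmul bs J v.
have sZ : zsp bs J (delta Z) by apply: delta_zmul.
pose S := span_of (fun K : {fset nat} =>
  forall i, i \in K -> i \in [seq head 0%N b | b <- b :: bs]) (fun K => zmul bs K v).
have SZ : S Z by apply: (@span_of_gen _ _ _ (fun K => zmul bs K v)).
have SdZ : S (delta Z).
  apply: span_ofS sZ => K JK i /JK /orP[/Jh//|bsi].
  by rewrite /= in_cons bsi orbT.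
have h1 Y : S Y -> h (E M (dmul b Y)) = eps *: E M (E b Y).
  elim=> [|a K Y' Kh _ IHY]; first by
    rewrite (linear0 (dmul b)) (linear0 (E b)) !(linear0 (E M)) (linear0 h) scaler0.
  rewrite (linearP (dmul b)) (linearP (E M)) (linearP h) IHY.
  rewrite (linearP (E b)) (linearP (E M)) scalerDr; congr (_ + _).
  rewrite scalerA mulrC -scalerA; congr (_ *: _).
  rewrite /= -zmul_fset1U // -ximE hE //=; last first.
    by apply: distK => i; rewrite in_fset1U => /predU1P[->|/Kh //]; apply: mem_head.
  rewrite /homotopy_value /= bsE fset1U1 ximE zmul_cons_notin ?fsetD11 //.
  congr (_ *: E M (E b _)); apply: zmul_ext => i bsi.
  rewrite in_fsetD1 in_fset1U; have [ib|] //= := eqVneq.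
  by rewrite -ib bsi in nb.
have h0 Y : S Y -> h (E M (E b Y)) = 0.
  elim=> [|a K Y' Kh _ IHY]; first by
    rewrite (linear0 (E b)) (linear0 (E M)) (linear0 h).
  rewrite (linearP (E b)) (linearP (E M)) (linearP h) IHY addr0.
  rewrite /= -zmul_fsetD1 // -ximE hE //=; last first.
    by apply: distK => i; rewrite in_fsetD1 => /andP[_ /Kh].
  by rewrite /homotopy_value /= bsE fsetD11 scaler0.
have dE Y : delta (E M Y) = dmul M Y + eps *: E M (delta Y) by apply: delta_emuls.
have hlow K : distinguished k I K ->
    msp (rk I) (h (dmul M (zmul (b :: bs) K v))) by move=> /lower/msp_h.
rewrite hE //= /homotopy_value /= bsE; case: ifP => bJ; last first.
  have ZE : zmul (b :: bs) J v = E b Z by rewrite zmul_cons_notin ?bJ.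
  rewrite linear0 add0r ximE dE (linearD h) (linearZ_LR h) /= bJ -/Z.
  rewrite delta_emuls (linearD (E M)) (linearZ_LR (E M)) (linearD h) (linearZ_LR h) /=.
  rewrite h1 // h0 // scaler0 addr0 eps2 addrK -ZE.
  exact: hlow.
have ZE : zmul (b :: bs) J v = dmul b Z by rewrite zmul_cons_mem.
have dJ' : distinguished k I (J `\ head 0%N b).
  by apply: distK => i; rewrite in_fsetD1 => /andP[_ /Jh].
have ZE' : zmul (b :: bs) (J `\ head 0%N b) v = E b Z by apply: zmul_fsetD1.
rewrite !ximE ZE ZE' -/M -/eps (linearZ_LR delta) /= !dE delta_emuls delta_dmul.
rewrite scalerDr eps2 !(linearD (E M)) !(linearZ_LR (E M)) /= (linearD h).
rewrite (linearZ_LR h) /= (linearZ_LR h) /= h1 // exprS mulN1r scaleNr scalerN.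
set s := (-1) ^+ size b; rewrite [eps *: (s *: _)]scalerA mulrC -scalerA eps2.
have -> (A B C D : V) : A + (B + C) + (D - C) - B = A + D.
  by rewrite (addrA A) -(addrA (A + B) C) (addrC C) subrK (addrAC (A + B)) addrK.
apply: span_ofD; first by apply: span_ofZ; rewrite -ZE'; apply: lower.
by rewrite -ZE; apply: hlow.
Qed.

Hypothesis delta_delta : forall x, delta (delta x) = 0.

(** If z is a cocycle, so is delta (h z) - z, and it has lower rank; induction on the rank replaces
    inverting delta h + h delta. *)
Lemma cocycle_exact m z : msp m z -> delta z = 0 -> exists2 w, msp m w & z = delta w.
Proof.
elim: m z => [|m IHm] z mz dz.
  exists 0; first exact: span_of0.
  by rewrite linear0; case: mz => // a t y [].
have low x : msp m.+1 x -> msp m (delta (h x) + h (delta x) - x).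
  elim=> [|a [I J] y [dIJ sI lt_I bs0] _ IHy].
    by rewrite !linear0 !addr0; apply: span_of0.
  rewrite (linearP delta) !(linearP h) (linearP delta).
  have -> (A B C A' B' C' : V) : a *: A + A' + (a *: B + B') - (a *: C + C') =
      a *: (A + B - C) + (A' + B' - C').
    by rewrite [X in X - _]addrACA opprD scalerBr scalerDr [LHS]addrACA.
  apply: span_ofD => //; apply: span_ofZ.
  apply: span_ofS (homotopy_lower dIJ sI bs0) => IJ' [? ? lt ?]; split=> //.
  exact: leq_trans lt lt_I.
have := low z mz; rewrite dz linear0 addr0 => /IHm[|w mw wE].
  by rewrite (linearB delta) /= delta_delta dz subr0.
exists (h z - w); last by rewrite (linearB delta) /= -wE opprB addrC subrK.
apply: span_ofB; first exact: msp_h.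
by apply: span_ofS mw => IJ [? ? lt ?]; split=> //; apply: leqW.
Qed.
End Filtration.
(** * Counting distinguished partitions *)

(* A distinguished pair (I; J) is encoded by the multisets of the values
   I_j - 3 j over the positions j outside, resp. inside, J.  [values] reads such
   data off a strict partition, starting with its largest part: a part [x] that
   meets a value [x + 1] or [x + 2] merges with it into a value inside J. *)
Fixpoint values (s : seq nat) : seq nat * seq nat :=
  if s is x :: t then
    let MN := values t in
    if x.+1 \in MN.1 then (rem x.+1 MN.1, (2 * x + 1)%N :: MN.2)
    else if x.+2 \in MN.1 then (rem x.+2 MN.1, (2 * x + 2)%N :: MN.2)
    else (x :: [seq (y - 3)%N | y <- MN.1], [seq (y - 3)%N | y <- MN.2])
  else ([::], [::]).

(** The sum of the parts of I when the I_j - 3 j are listed in [M] and [N]; the staircase 3 j adds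
    three times a binomial coefficient. *)
Definition weight (M N : seq nat) : nat :=
  (sumn M + sumn N + 3 * 'C(size M + size N, 2))%N.

(** What being distinguished means for the values I_j - 3 j. Gaps above 3 before leading parts make
    the values inside J distinct; leading parts lie outside the main range, so these values are at
    least 2k, and 2k itself occurs only under the strict bound, that is, when the first part is
    k. *)
Definition admissible k (M N : seq nat) : Prop :=
  [/\ all (leq k) M, uniq N, all (leq (2 * k)) N & (2 * k)%N \in N -> k \in M].

Lemma sumn_map_addn c s : sumn [seq (c + y)%N | y <- s] = (sumn s + c * size s)%N.
Proof. by elim: s => [|y s IHs] /=; rewrite ?muln0 // IHs mulnS; lia. Qed.

Lemma addn3K : cancel (addn 3) (subn^~ 3).
Proof. by move=> y; rewrite addKn. Qed.

Lemma weight_perm M M' N N' : perm_eq M M' -> perm_eq N N' ->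
  weight M N = weight M' N'.
Proof.
move=> pM pN.
by rewrite /weight (perm_sumn pM) (perm_sumn pN) (perm_size pM) (perm_size pN).
Qed.

Lemma weight_consM k M N :
  weight (k :: M) N = (k + weight (map (addn 3) M) (map (addn 3) N))%N.
Proof.
rewrite /weight /= !sumn_map_addn !size_map addSn binS bin1; lia.
Qed.

Lemma weight_move k M N m n : (n = k + m)%N ->
  weight M (n :: N) = (k + weight (m :: M) N)%N.
Proof. by move=> ->; rewrite /weight /= addnS addSn; clear; lia. Qed.

Lemma leq_weight k M N : all (leq k) M -> all (leq (2 * k)) N ->
  (M != [::]) || (N != [::]) -> (k <= weight M N)%N.
Proof.
rewrite /weight; case: M => [|m M] /=; case: N => [|n N] //=; lia.
Qed.

(** Undoes [values] from the smallest part upwards: k is taken from [M], or a value 2k+1 or 2k+2 of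
    [N] is split as k + (k+1) or k + (k+2), or k is not a part. In each case the remaining data are
    admissible for k + 1. The number [f] is fuel for this induction. *)
Lemma values_surj f k M N : admissible k M N -> (weight M N < f + k)%N ->
  exists s, [/\ is_index k s, sumn s = weight M N,
                perm_eq (values s).1 M & perm_eq (values s).2 N].
Proof.
elim: f k M N => [|f IHf] k M N [kM uN kN k0] lt_w.
  have := leq_weight kM kN; case: M {kM k0} lt_w => [|m M] lt_w; last first.
    by move=> /(_ isT); lia.
  case: N {uN kN} lt_w => [|n N] lt_w; last by move=> /(_ isT); lia.
  by exists [::].
have index_cons s : is_index k.+1 s -> is_index k (k :: s).
  rewrite /is_index /= leqnn path_sortedE; last exact: ltn_trans.
  move=> /andP[-> ks]; rewrite ks /=; apply: sub_all ks => y; exact: ltnW.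
have IH M' N' : admissible k.+1 M' N' -> weight M N = (k + weight M' N')%N ->
    exists s, [/\ is_index k (k :: s), sumn (k :: s) = weight M N,
                perm_eq (values s).1 M' & perm_eq (values s).2 N'].
  move=> aM' wE; have [|s [si ss sM sN]] := IHf _ _ _ aM'.
    by move: wE lt_w; clear; lia.
  by exists s; split=> //=; [apply: index_cons | rewrite ss].
have [kM0|nkM] := boolP (k \in M).
  have pM := perm_to_rem kM0.
  have [||s [si ss sM sN]] := IH (map (addn 3) (rem k M)) (map (addn 3) N).
  - split.
    + by rewrite all_map; apply/allP => y /mem_rem /(allP kM) /=; lia.
    + by rewrite map_inj_uniq // => y z; lia.
    + by rewrite all_map; apply: sub_all kN => y /=; lia.
    + by case/mapP => y /(allP kN) /=; lia.
  - by rewrite (weight_perm pM (perm_refl N)) weight_consM.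
  exists (k :: s); rewrite /=.
  have far j : (j < k + 3)%N -> (j \in (values s).1) = false.
    move=> lt_j; apply/negP; rewrite (perm_mem sM) => /mapP[y /mem_rem/(allP kM)].
    by move: lt_j; clear => /= ? ? ?; lia.
  rewrite (far k.+1) ?(far k.+2) ?addn3 //=; split=> //.
    rewrite perm_sym (perm_trans pM) // perm_cons perm_sym.
    by rewrite (perm_trans (perm_map _ sM)) // -map_comp (eq_map addn3K) map_id.
  by rewrite (perm_trans (perm_map _ sN)) // -map_comp (eq_map addn3K) map_id.
have n2k : (2 * k)%N \notin N by apply: contra nkM.
have kM1 : all (leq k.+1) M.
  apply/allP => y My; rewrite ltn_neqAle (allP kM y My) andbT.
  by apply: contraNneq nkM => ->.
have kN1 : all (leq (2 * k + 1)) N.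
  apply/allP => y Ny; rewrite addn1 ltn_neqAle (allP kN y Ny) andbT.
  by apply: contraNneq n2k => ->.
have [N1|nN1] := boolP ((2 * k + 1)%N \in N).
  have pN := perm_to_rem N1.
  have [||s [si ss sM sN]] := IH (k.+1 :: M) (rem (2 * k + 1)%N N).
  - split; rewrite ?rem_uniq //= ?leqnn ?kM1 ?mem_head //.
    apply/allP => y; rewrite mem_rem_uniq // inE => /andP[/eqP ne /(allP kN1)] /=.
    by move: ne; clear; lia.
  - by rewrite (weight_perm (perm_refl M) pN); apply: weight_move; clear; lia.
  have Mk : k.+1 \in (values s).1 by rewrite (perm_mem sM) mem_head.
  exists (k :: s); rewrite /= Mk /=; split=> //.
    by rewrite -(perm_cons k.+1) (perm_trans _ sM) // perm_sym perm_to_rem.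
  by rewrite perm_sym (perm_trans pN) // perm_cons perm_sym.
have kN2 : all (leq (2 * k + 2)) N.
  apply/allP => y Ny; have /= := allP kN1 y Ny.
  rewrite leq_eqVlt => /predU1P[yE|]; last by clear; lia.
  by rewrite yE Ny in nN1.
(* When k + 1 is in [M], the value 2k + 2 stays: it is admissible at k + 1, while splitting it would
   be read by [values] as a merge with k + 1. *)
have [/andP[N2 nM1]|case4] := boolP (((2 * k + 2)%N \in N) && (k.+1 \notin M)).
  have pN := perm_to_rem N2.
  have [||s [si ss sM sN]] := IH (k.+2 :: M) (rem (2 * k + 2)%N N).
  - split; rewrite ?rem_uniq //= ?leqnSn ?kM1 //.
      apply/allP => y; rewrite mem_rem_uniq // inE => /andP[_ /(allP kN2)] /=.
      by clear; lia.
    by rewrite mem_rem_uniq // inE => /andP[/eqP ne _]; case: ne; clear; lia.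
  - by rewrite (weight_perm (perm_refl M) pN); apply: weight_move; clear; lia.
  have Mk : k.+2 \in (values s).1 by rewrite (perm_mem sM) mem_head.
  have nMk : k.+1 \in (values s).1 = false.
    by rewrite (perm_mem sM) in_cons (negPf nM1) orbF; apply/eqP; clear; lia.
  exists (k :: s); rewrite /= Mk nMk /=; split=> //.
    by rewrite -(perm_cons k.+2) (perm_trans _ sM) // perm_sym perm_to_rem.
  by rewrite perm_sym (perm_trans pN) // perm_cons perm_sym.
have [||s [si ss sM sN]] := IHf k.+1 M N.
- split=> //; first by apply: sub_all kN2 => y; clear; lia.
  rewrite (_ : (2 * k.+1 = 2 * k + 2)%N); last by clear; lia.
  by move=> N2; move: case4; rewrite N2 /= negbK.
- by move: lt_w; clear; lia.
exists s; split=> //; move: si; rewrite /is_index => /andP[-> ks] /=.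
by apply: sub_all ks => y; apply: ltnW.
Qed.

(** A leading part is the first one with its value I_j - 3 j, so its position is the number of
    smaller values. *)
Definition decode (MN : seq nat * seq nat) : seq nat * {fset nat} :=
  let l := sort leq (MN.1 ++ MN.2) in
  (mkseq (fun r => nth 0 l r + 3 * r)%N (size l),
   [fset (v + 3 * count (fun x => x < v) l)%N | v in MN.2]).

Lemma decode_perm M M' N N' : perm_eq M M' -> perm_eq N N' ->
  decode (M, N) = decode (M', N').
Proof.
move=> pM pN; rewrite /decode /=.
have -> : sort leq (M ++ N) = sort leq (M' ++ N').
  by apply/(perm_sortP leq_total leq_trans anti_leq)/perm_cat.
congr (_, _); apply/fsetP => x; apply/imfsetP/imfsetP => -[y /= Ny ->]; exists y => //=.
  by rewrite -(perm_mem pN).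
by rewrite (perm_mem pN).
Qed.

Lemma sumn_mkseq_stair (f : nat -> nat) n :
  sumn (mkseq (fun r => f r + 3 * r)%N n) = (sumn (mkseq f n) + 3 * 'C(n, 2))%N.
Proof.
by elim: n => // n IHn; rewrite !mkseqS !sumn_rcons IHn binS bin1; lia.
Qed.

Lemma count_ltn_nth l j : sorted leq l -> (j < size l)%N ->
  j = 0%N \/ (nth 0 l j.-1 < nth 0 l j)%N ->
  count (fun x => x < nth 0 l j)%N l = j.
Proof.
move=> sl lt_j jE; rewrite -{2}(cat_take_drop j l) count_cat.
have -> : count (fun x => x < nth 0 l j)%N (take j l) = j.
  rewrite -[RHS](size_takel (ltnW lt_j)); apply/eqP; rewrite -all_count.
  apply/(all_nthP 0%N) => i; rewrite size_takel ?(ltnW lt_j) // => lt_ij.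
  rewrite nth_take //; case: jE => [j0|]; first by rewrite j0 in lt_ij.
  apply: leq_ltn_trans; apply: (sorted_leq_nth leq_trans leqnn 0%N sl).
  - by rewrite inE (ltn_trans lt_ij).
  - by rewrite inE (leq_ltn_trans (leq_pred j)).
  - by rewrite -ltnS prednK //; case: (j) lt_ij.
apply/eqP; rewrite -[X in _ == X]addn0 eqn_add2l eqn0Ngt -has_count.
apply/hasPn => x /(nthP 0%N)[i]; rewrite size_drop => lt_i <-; rewrite -leqNgt nth_drop.
apply: (sorted_leq_nth leq_trans leqnn 0%N sl); rewrite ?inE ?leq_addr //.
by rewrite -ltn_subRL.
Qed.

(** This is the counting bound: every distinguished pair comes from at least one index of the same
    weight. *)
Lemma decode_values_surj k I J : (0 < k)%N -> distinguished k I J ->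
  exists s, [/\ is_index k s, sumn s = sumn I & decode (values s) = (I, J)].
Proof.
move=> k_gt0 /and3P[kI nI /fsubsetP JI].
pose n := size I; pose v j := (nth 0 I j - 3 * j)%N.
have stair i j : (i <= j < n)%N -> (nth 0 I i + 3 * (j - i) <= nth 0 I j)%N.
  exact: nonsingular_nth nI.
have kI0 j : (j < n)%N -> (k + 3 * j <= nth 0 I j)%N.
  move=> lt_j; have lt_0 : (0 < n)%N by apply: leq_ltn_trans lt_j.
  have := stair 0%N j lt_j; rewrite subn0; apply: leq_trans; rewrite leq_add2r.
  by apply: (allP (kpartition_all kI)); rewrite mem_nth.
have vK j : (j < n)%N -> (v j + 3 * j = nth 0 I j)%N.
  by move=> /kI0 le_I; rewrite subnK //; move: le_I; clear; lia.
pose inJ := fun j => nth 0%N I j \in J.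
pose M := [seq v j | j <- iota 0 n & ~~ inJ j].
pose N := [seq v j | j <- iota 0 n & inJ j].
pose l := [seq v j | j <- iota 0 n].
have sz_l : size l = n by rewrite size_map size_iota.
have nth_l j : (j < n)%N -> nth 0%N l j = v j.
  by move=> lt_j; rewrite (nth_map 0%N) ?size_iota // nth_iota.
have v_mono i j : (i <= j < n)%N -> (v i <= v j)%N.
  move=> ij; have := stair i j ij; have := vK j; have := vK i.
  move: ij; case/andP => le_ij lt_j => /(_ (leq_ltn_trans le_ij lt_j)) hi /(_ lt_j).
  by move: hi le_ij; clear; lia.
have sl : sorted leq l.
  apply/(sortedP 0%N) => j; rewrite sz_l => lt_j; rewrite !nth_l ?(ltnW lt_j) //.
  by apply: v_mono; rewrite leqnSn.
have pl : perm_eq (M ++ N) l.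
  by rewrite -map_cat perm_map // perm_catC perm_filterC.
have lE : sort leq (M ++ N) = l.
  rewrite -[RHS](sorted_sort leq_trans sl).
  by apply/(perm_sortP leq_total leq_trans anti_leq).
have inJP j : (j < n)%N -> inJ j -> ~~ main_range k (take j I) (nth 0%N I j) /\
    (j = 0%N \/ (v j.-1 < v j)%N).
  move=> lt_j /JI /(leadingP k_gt0 kI nI)[i [lt_i ij mi iE]].
  have -> : j = i.
    have := stair i j; have := stair j i; rewrite -/n in lt_i.
    by move: ij lt_i lt_j; clear; case: (ltngtP i j) => //; lia.
  split=> //; case: iE => [->|lt_I]; [by left|right].
  have := vK i lt_i; have := vK i.-1 (leq_ltn_trans (leq_pred i) lt_i).
  by move: lt_I; clear; lia.
have v2k j : (j < n)%N -> inJ j -> (2 * k <= v j)%N.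
  move=> lt_j /(inJP j lt_j)[+ _]; rewrite main_atE //.
  by have := vK j lt_j; clear; case: ifP; lia.
have aMN : admissible k M N.
  split.
  - apply/allP => x /mapP[j]; rewrite mem_filter mem_iota add0n => /andP[_ /andP[_ lt_j]] ->.
    by have := kI0 j lt_j; rewrite -(vK j lt_j) leq_add2r.
  - rewrite map_inj_in_uniq ?filter_uniq ?iota_uniq // => i j.
    rewrite !mem_filter !mem_iota !add0n => /andP[Ji /andP[_ lt_i]] /andP[Jj /andP[_ lt_j]].
    have [_ iE] := inJP i lt_i Ji; have [_ jE] := inJP j lt_j Jj.
    have := v_mono i j.-1; have := v_mono j i.-1.
    by move: lt_i lt_j iE jE; clear; case: (ltngtP i j) => //; lia.
  - apply/allP => x /mapP[j]; rewrite mem_filter mem_iota add0n => /andP[Jj /andP[_ lt_j]] ->.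
    exact: v2k.
  - case/mapP => j; rewrite mem_filter mem_iota add0n => /andP[Jj /andP[_ lt_j]] vE.
    have [mj _] := inJP j lt_j Jj.
    have I0 : nth 0%N I 0 = k.
      move: mj; rewrite main_atE // nth0; case: eqP => // _; rewrite -ltnNge.
      by have := vK j lt_j; rewrite -vE; clear; lia.
    have lt_0 : (0 < n)%N by apply: leq_ltn_trans lt_j.
    apply/mapP; exists 0%N; last by rewrite /v I0 subn0.
    rewrite mem_filter mem_iota add0n leq0n lt_0 !andbT; apply/negP => J0.
    have [+ _] := inJP 0%N lt_0 J0.
    by rewrite main_atE // -nth0 I0 eqxx; move: k_gt0; clear; lia.
have [|s [si ss sM sN]] := @values_surj (weight M N).+1 k M N aMN.
  by rewrite addSn ltnS leq_addr.
exists s; split=> //.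
  rewrite ss /weight -size_cat (perm_size pl) sz_l -sumn_cat (perm_sumn pl).
  rewrite -(sumn_mkseq_stair v); congr sumn; apply: (@eq_from_nth _ 0%N).
    by rewrite size_mkseq.
  by move=> j; rewrite size_mkseq => lt_j; rewrite nth_mkseq // vK.
rewrite [values s]surjective_pairing (decode_perm sM sN) /decode /= lE sz_l.
congr (_, _).
  apply: (@eq_from_nth _ 0%N); first by rewrite size_mkseq.
  by move=> j; rewrite size_mkseq => lt_j; rewrite nth_mkseq // nth_l // vK.
have cE j : (j < n)%N -> inJ j -> (v j + 3 * count (fun x => x < v j) l)%N = nth 0%N I j.
  move=> lt_j Jj; rewrite -{2}(nth_l j) // count_ltn_nth ?vK ?sz_l //.
  have [_ [->|lt_v]] := inJP j lt_j Jj; [by left|right].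
  by rewrite !nth_l // (leq_ltn_trans (leq_pred j)).
apply/fsetP => x; apply/imfsetP/idP => /= [[y /mapP[j]]|Jx].
  rewrite mem_filter mem_iota add0n => /andP[Jj /andP[_ lt_j]] -> ->.
  by rewrite cE.
have [j [lt_j xE _ _]] := elimT (leadingP k_gt0 kI nI x) (JI x Jx).
have Jj : inJ j by rewrite /inJ -xE.
exists (v j); last by rewrite cE.
by apply/mapP; exists j; rewrite // mem_filter Jj mem_iota.
Qed.
(** * The operators d and delta *)

Section CoboundaryWords.
Variables (V : lmodType rat) (e : nat -> {linear V -> V}).
Hypothesis eC : forall i j x, e i (e j x) = - e j (e i x).
Variables (g : lie_family) (k : nat).
Hypothesis e_small : forall i x, (i < k)%N -> e i x = 0.
Implicit Types (x : V) (s t : seq nat).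
Local Notation u := (umul e g).
Local Notation E := (emuls e).
Local Notation D := (dmul e g).

Lemma umul_pairs n x : u n x =
  \sum_(a < n.+1) \sum_(b < n.+1 | (k <= a < b)%N && (a + b == n)%N)
     brk g a b *: e a (e b x).
Proof.
pose F a := brk g a (n - a) *: e a (e (n - a)%N x).
have Fsym (a : nat) : (a <= n)%N -> F (n - a)%N = F a.
  by move=> le_a; rewrite /F subKn // eC brkN scaleNr scalerN opprK.
have Fmid (a : nat) : (n - a)%N = a -> F a = 0.
  by move=> aE; rewrite /F aE (ee0 eC) scaler0.
rewrite umulE; apply: (@scalerI _ V 2%:R); first by rewrite pnatr_eq0.
rewrite scalerA mulfV // scale1r scaler_nat mulr2n.
have -> : \sum_(a < n.+1) \sum_(b < n.+1 | (k <= a < b)%N && (a + b == n)%N)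
     brk g a b *: e a (e b x) = \sum_(a < n.+1 | (val a < n - a)%N) F a.
  rewrite [RHS]big_mkcond; apply: eq_bigr => -[a lt_a] _ /=.
  have lt_b : (n - a < n.+1)%N by rewrite ltnS leq_subr.
  have [lt_ka|le_ka] := ltnP a k.
    by rewrite /F e_small // scaler0 if_same big_pred0.
  case: ifP => lt_ab.
    rewrite (big_pred1 (Ordinal lt_b)) // => b /=; rewrite -val_eqE /=.
    by move: lt_ab lt_a; clear; lia.
  rewrite big1 // => b /andP[lt_b']; move: lt_ab lt_a lt_b'; clear; lia.
rewrite (bigID (fun a : 'I_n.+1 => (val a < n - a)%N)) /=; congr (_ + _).
rewrite (bigID (fun a : 'I_n.+1 => (n - a == a)%N)) /= big1 ?add0r; last first.
  by move=> a /andP[_ /eqP /Fmid].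
rewrite (reindex_inj rev_ord_inj) /=; apply: eq_big => -[a lt_a] /=.
  by rewrite subSS; move: lt_a; clear; lia.
by move=> _; rewrite subSS -/(F _) Fsym.
Qed.

Lemma dmul_sum s x : uniq s ->
  D s x = \sum_(n <- s) (-1) ^+ index n s *: u n (E (rem n s) x).
Proof.
elim: s => [|i s IHs] /=; first by rewrite big_nil.
move=> /andP[nsi us]; rewrite big_cons eqxx expr0 scale1r; congr (_ + _).
rewrite IHs // linear_sum -sumrN !big_seq; apply: eq_bigr => n sn.
have [in_|ni] := eqVneq i n; first by rewrite in_ sn in nsi.
by rewrite linearZ /= -(e_umul eC) exprS mulN1r scaleNr.
Qed.

Lemma dmul_cons i s x : D (i :: s) x = u i (E s x) - e i (D s x).
Proof. by []. Qed.

Lemma dmul_swap i j s x : D [:: i, j & s] x = - D [:: j, i & s] x.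
Proof.
rewrite !dmul_cons !(linearB (e _)) /= !(e_umul eC) [e j (e i _)]eC.
by rewrite opprK !opprB addrA.
Qed.

Lemma dmul_rem i s x : i \in s ->
  D s x = (-1) ^+ index i s *: D (i :: rem i s) x.
Proof.
elim: s => // j s IHs; rewrite in_cons [_ == j]eq_sym.
have [->|ne_ij] := eqVneq j i; first by rewrite /= eqxx scale1r.
move=> si; have -> : rem i (j :: s) = j :: rem i s by rewrite /= (negPf ne_ij).
have -> : index i (j :: s) = (index i s).+1 by rewrite /= (negPf ne_ij).
rewrite dmul_swap dmul_cons [D (j :: _) x]dmul_cons IHs //.
rewrite (emuls_rem eC _ si) -[e i _]/(E (i :: rem i s) x).
rewrite (linearZ_LR (u j)) (linearZ_LR (e j)) -scalerBr.
by rewrite exprS mulN1r scaleNr scalerN opprK.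
Qed.

(** A common sign for both operators carries the formula delta (e_s) = [dmul] from sorted words to
    arbitrary ones. *)
Lemma emuls_dmul_perm s t : perm_eq s t -> exists b : bool,
  forall x, E s x = (-1) ^+ b *: E t x /\ D s x = (-1) ^+ b *: D t x.
Proof.
elim: s t => [|i s IHs] t.
  by rewrite perm_sym => /perm_nilP ->; exists false => x; rewrite !scale1r.
move=> pst; have it : i \in t by rewrite -(perm_mem pst) mem_head.
have /IHs[b sE] : perm_eq s (rem i t).
  by rewrite -(perm_cons i); apply: perm_trans pst (perm_to_rem it).
exists (b (+) odd (index i t)) => x; have [sEx sDx] := sE x.
have sgn (y : V) : (-1) ^+ (b (+) odd (index i t)) *: ((-1) ^+ index i t *: y) =
                   (-1) ^+ b *: y.
  by rewrite scalerA signr_addb -mulrA signr_odd -expr2 sqrr_sign mulr1.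
rewrite (emuls_rem eC x it) (dmul_rem x it) !sgn !dmul_cons /= sEx sDx.
by rewrite !(linearZ_LR (e i)) (linearZ_LR (u i)) -scalerBr.
Qed.

Lemma dmul_dup s x : ~~ uniq s -> D s x = 0.
Proof.
elim: s => // i s IHs; rewrite /= negb_and negbK => /orP[is_|nus]; last first.
  by rewrite IHs // (emuls_dup eC) // (linear0 (u i)) (linear0 (e i)) subr0.
rewrite (dmul_rem _ is_) dmul_cons (emuls_rem eC _ is_).
rewrite (linearZ_LR (u i)) (linearZ_LR (e i)) -scalerBr (linearB (e i)).
by rewrite (ee0 eC) subr0 (e_umul eC) subrr scaler0.
Qed.

Lemma dmul_small s x i : (i < k)%N -> i \in s -> D s x = 0.
Proof.
move=> lt_ik is_; rewrite (dmul_rem _ is_) dmul_cons e_small // subr0.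
by rewrite (umul_small eC g _ e_small) ?scaler0 //; move: lt_ik; clear; lia.
Qed.

End CoboundaryWords.

Lemma index_rem (s : seq nat) x y : uniq s -> x \in s -> y \in s ->
  (index y s < index x s)%N -> index x (rem y s) = (index x s).-1.
Proof.
elim: s => //= z s IHs /andP[nz us]; rewrite !in_cons.
have [->|ne_zx] := eqVneq z x; first by rewrite ltn0.
rewrite /= => xs; have [_|ne_zy] //= := eqVneq z y.
rewrite (negPf ne_zx) ltnS => ys lt_i.
by rewrite IHs // prednK // (leq_ltn_trans _ lt_i).
Qed.

Lemma del2E (s : seq nat) r t : uniq s -> (r < size s)%N -> (t < size s)%N ->
  r != t -> del2 r t s = rem (nth 0%N s t) (rem (nth 0%N s r) s).
Proof.
move=> us lt_r lt_t ne_rt; rewrite (rem_filter _ (rem_uniq _ us)) (rem_filter _ us).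
rewrite -filter_predI -[X in _ = filter _ X](mkseq_nth 0%N s) /mkseq filter_map /del2.
congr map; apply: eq_in_filter => i; rewrite mem_iota add0n => /andP[_ lt_i] /=.
by rewrite !nth_uniq // andbC.
Qed.

(** * Adjointness of d and delta *)

Section Adjoint.
Variables (V : lmodType rat) (e : nat -> {linear V -> V}).
Hypothesis eC : forall i j x, e i (e j x) = - e j (e i x).
Variables (g : lie_family) (v : V) (pr : V -> V -> rat) (iota : nat -> V -> V).
Variable P : seq nat -> Prop.
Hypothesis prP : forall x a y z, pr x (a *: y + z) = a * pr x y + pr x z.
Hypothesis prZl : forall a x y, pr (a *: x) y = a * pr x y.
Hypothesis pr_iota : forall a x y, pr (iota a x) y = pr x (e a y).
Hypothesis pr_e : forall a x y, pr (e a x) y = pr x (iota a y).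
Hypothesis iotaE : forall a s, P s -> iota a (emuls e s v) =
  if a \in s then (-1) ^+ index a s *: emuls e (rem a s) v else 0.
Hypothesis iotaZ : forall a c x, iota a (c *: x) = c *: iota a x.
Hypothesis P_uniq : forall s, P s -> uniq s.
Hypothesis P_rem : forall s a, P s -> P (rem a s).

Local Notation E := (emuls e).

Let pr0 x : pr x 0 = 0.
Proof. by rewrite -[X in pr x X](addNr 0) -scaleN1r prP; lra. Qed.

Let prZ x a y : pr x (a *: y) = a * pr x y.
Proof. by rewrite -[a *: y]addr0 prP pr0 addr0. Qed.

Let pr_sum x (T : Type) (r : seq T) (R : pred T) (F : T -> V) :
  pr x (\sum_(i <- r | R i) F i) = \sum_(i <- r | R i) pr x (F i).
Proof.
elim/big_rec2: _ => [|i y z _ <-]; first exact: pr0.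
by rewrite -[X in pr x (X + _)]scale1r prP mul1r.
Qed.

Lemma iota_pair (K : seq nat) r s : P K -> (r < s < size K)%N ->
  iota (nth 0 K s) (iota (nth 0 K r) (E K v)) =
    (-1) ^+ (r + s + 1) *: E (del2 r s K) v.
Proof.
move=> PK /andP[lt_rs lt_s]; have lt_r := ltn_trans lt_rs lt_s.
have uK := P_uniq PK; have ne_rs : r != s by rewrite neq_ltn lt_rs.
rewrite iotaE // mem_nth // iotaZ iotaE; last exact: P_rem.
rewrite mem_rem_uniq // inE mem_nth // andbT nth_uniq // eq_sym ne_rs.
rewrite index_rem ?mem_nth // !index_uniq // scalerA -exprD -del2E //.
suff -> : (-1) ^+ (r + s + 1) = (-1) ^+ (r + s.-1) :> rat by [].
rewrite -[LHS]signr_odd -[RHS]signr_odd; congr (_ ^+ nat_of_bool _).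
by case: s lt_rs {lt_s ne_rs} => //= s _; rewrite addn1 addnS /= negbK.
Qed.

Lemma pr_e_mem (K : seq nat) a x : P K -> a \notin K -> pr (E K v) (e a x) = 0.
Proof.
move=> PK na; rewrite -pr_iota iotaE // (negPf na).
by rewrite -[X in pr X x](scale0r (0 : V)) prZl mul0r.
Qed.

Lemma sum_pairs (F : nat -> nat -> rat) (K : seq nat) (n : nat) : uniq K ->
  (forall a b, F a b = F b a) -> (forall a, F a a = 0) ->
  (forall a b, (a \notin K) || (b \notin K) -> F a b = 0) ->
  \sum_(a < n.+1) F a (n - a)%N =
  (\sum_(r < size K) \sum_(s < size K | (r < s)%N && (nth 0 K r + nth 0 K s == n)%N)
     F (nth 0%N K r) (nth 0%N K s)) *+ 2.
Proof.
move=> uK Fsym Fdiag F0.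
pose G a b := if (a + b == n)%N then F a b else 0.
have -> : \sum_(a < n.+1) F a (n - a)%N = \sum_(a <- K) \sum_(b <- K) G a b.
  have -> : \sum_(a <- K) \sum_(b <- K) G a b =
      \sum_(a <- K | (a <= n)%N) F a (n - a)%N.
    rewrite [RHS]big_mkcond; apply: eq_bigr => a _; case: leqP => [le_a|lt_a].
      rewrite -big_mkcond /= -big_filter.
      have -> : [seq b <- K | (a + b == n)%N] = [seq b <- K | pred1 (n - a)%N b].
        by apply: eq_filter => b /=; move: le_a; clear; lia.
      have [nK|nK] := boolP ((n - a)%N \in K); last first.
        rewrite F0 ?nK ?orbT // big1_seq // => b; rewrite mem_filter /=.
        by case/andP => /eqP ->; rewrite (negPf nK).
      by rewrite filter_pred1_uniq // big_seq1.
    rewrite big1 // => b _; rewrite /G; case: eqP => // abn.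
    by move: lt_a abn; clear; lia.
  rewrite (big_ord_widen_cond n.+1 xpredT (fun a => F a (n - a)%N)) //.
  rewrite -(big_mkord (fun i => true && (i < n.+1)%N) (fun a => F a (n - a)%N)).
  rewrite (bigID (mem K)) /= [X in _ + X]big1 ?addr0; last first.
    by move=> a /andP[_ na]; rewrite F0 // na.
  rewrite -[LHS]big_filter -[RHS]big_filter; apply: perm_big.
  apply: uniq_perm; rewrite ?filter_uniq ?iota_uniq // => a.
  by rewrite !mem_filter mem_index_iota /= ltnS; case: (a \in K); case: (a <= n)%N.
have GE r s : G r s = G s r by rewrite /G addnC Fsym.
rewrite (big_nth 0%N) big_mkord.
under eq_bigr do rewrite (big_nth 0%N) big_mkord.
pose H (r s : 'I_(size K)) := G (nth 0%N K r) (nth 0%N K s).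
have -> : \sum_(r < size K) \sum_(s < size K) H r s =
  \sum_(r < size K) \sum_(s < size K | (r < s)%N) H r s +
  \sum_(r < size K) \sum_(s < size K | (s < r)%N) H r s.
  rewrite -big_split; apply: eq_bigr => r _.
  rewrite (bigID (fun s : 'I_(size K) => (r < s)%N)) /=; congr (_ + _).
  rewrite (bigID (fun s : 'I_(size K) => (s < r)%N)) /= [X in _ + X]big1 ?addr0.
    by apply: eq_bigl => s; case: ltngtP.
  move=> s /andP[]; rewrite -!leqNgt => le1 le2; have -> : s = r.
    by apply/val_inj/eqP; rewrite eqn_leq le1 le2.
  by rewrite /H /G Fdiag if_same.
have -> : \sum_(r < size K) \sum_(s < size K | (s < r)%N) H r s =
    \sum_(r < size K) \sum_(s < size K | (r < s)%N) H r s.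
  rewrite (exchange_big_dep xpredT) //=; apply: eq_bigr => r _.
  by apply: eq_bigr => s _; rewrite /H GE.
rewrite -mulr2n; congr (_ *+ 2); apply: eq_bigr => r _.
by rewrite big_mkcondr; apply: eq_bigr => s _.
Qed.

(** In operator form d is the sum of mu(b - a) e_(a+b) iota_b iota_a over a < b, and delta is the
    sum of the u_n iota_n. They are adjoint because e_i and iota_i are; the left side is the formula
    of [bd_basis] paired with e_I. *)
Lemma pr_dmul (K I : seq nat) : P K -> P I ->
  \sum_(r < size K) \sum_(s < size K | (r < s)%N)
    ((-1) ^+ (r + s + 1) * brk g (nth 0 K r) (nth 0 K s)) *
      pr (E ((nth 0 K r + nth 0 K s)%N :: del2 r s K) v) (E I v) =
  pr (E K v) (dmul e g I v).
Proof.
move=> PK PI; rewrite (dmul_sum eC) ?P_uniq // pr_sum.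
pose F n a b := brk g a b * pr (E K v) (e a (e b (iota n (E I v)))).
have uE n : n \in I -> pr (E K v) ((-1) ^+ index n I *: umul e g n (E (rem n I) v)) =
   \sum_(r < size K) \sum_(s < size K | (r < s)%N && (nth 0 K r + nth 0 K s == n)%N)
     F n (nth 0%N K r) (nth 0%N K s).
  move=> nI; rewrite -linearZ /=.
  have -> : (-1) ^+ index n I *: E (rem n I) v = iota n (E I v).
    by rewrite iotaE // nI.
  rewrite umulE prZ pr_sum.
  have -> : \sum_(a < n.+1) pr (E K v) (brk g a (n - a) *: e a (e (n - a)%N (iota n (E I v))))
     = \sum_(a < n.+1) F n a (n - a)%N by apply: eq_bigr => a _; rewrite prZ.
  rewrite (@sum_pairs (F n) K) ?P_uniq //.
  - by rewrite -[X in _ * X]mulr_natl mulKf.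
  - by move=> a b; rewrite /F brkN eC -scaleN1r prZ mulNr mulN1r mulrN opprK.
  - by move=> a; rewrite /F (ee0 eC) pr0 mulr0.
  - move=> a b /orP[nK|nK]; rewrite /F; last rewrite eC -scaleN1r prZ.
      by rewrite pr_e_mem ?mulr0.
    by rewrite pr_e_mem ?mulr0.
rewrite [RHS](eq_big_seq _ uE) exchange_big; apply: eq_bigr => r _.
rewrite (exchange_big_dep (fun s : 'I_(size K) => (r < s)%N)) /=; last first.
  by move=> n s _ /andP[].
apply: eq_bigr => s lt_rs; have lt_s := ltn_ord s.
set n := (nth 0 K r + nth 0 K s)%N.
rewrite /= pr_e -[LHS]mulrAC -prZl -iota_pair ?lt_rs // !pr_iota.
rewrite -big_filter; have [nI|nI] := boolP (n \in I).
  have -> : [seq i <- I | true && (n == i)] = [seq i <- I | pred1 n i].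
    by apply: eq_filter => i; rewrite /= eq_sym.
  by rewrite filter_pred1_uniq ?P_uniq // big_seq1 /F mulrC.
rewrite big1_seq; last first.
  by move=> i; rewrite mem_filter /= => /andP[/eqP <-]; rewrite (negPf nI).
by rewrite iotaE // (negPf nI) !(linear0 (e _)) pr0 mul0r.
Qed.

End Adjoint.

Lemma cobd_words (V : lmodType rat) (e : nat -> {linear V -> V}) g k v I :
  (forall i j x, e i (e j x) = - e j (e i x)) ->
  (forall i x, (i < k)%N -> e i x = 0) -> uniq I ->
  \sum_(r < size I) \sum_(a < (nth 0%N I r).+1)
    \sum_(b < (nth 0%N I r).+1 | (k <= a < b)%N && (a + b == nth 0 I r)%N)
      ((-1) ^+ r * mu g (b%:Z - a%:Z)) *:
         emuls e (take r I ++ [:: val a; val b] ++ drop r.+1 I) v =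
  dmul e g I v.
Proof.
move=> eC e_small uI; rewrite (dmul_sum eC) // (big_nth 0%N) big_mkord.
apply: eq_bigr => r _; rewrite index_uniq // remE index_uniq //.
rewrite (umul_pairs eC _ e_small) scaler_sumr; apply: eq_bigr => a _.
rewrite scaler_sumr; apply: eq_bigr => b _; rewrite scalerA !emuls_cat /=.
by congr (_ *: _); elim: (take r I) => //= i s ->; rewrite (e_rot eC).
Qed.

Section Pairing.
Variables (g : lie_family) (k : nat).
Implicit Types (x y : chain k) (s t : seq nat) (I : chain_index k).

Local Notation e := (fun i => emul i : {linear chain k -> chain k}).
Local Notation E := (emuls e).
Local Notation vac := (vac k).

Lemma innerEw (S : {fset chain_index k}) x y : msupp x `<=` S ->
  inner x y = \sum_(I <- S) x@_I * y@_I.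
Proof.
move=> sS; rewrite /inner (big_fset_incl _ sS) // => I _ /mcoeff_outdom ->.
by rewrite mul0r.
Qed.

Lemma innerC x y : inner x y = inner y x.
Proof.
pose S := msupp x `|` msupp y.
rewrite (@innerEw S) ?fsubsetUl // (@innerEw S y x) ?fsubsetUr //.
by apply: eq_bigr => I _; rewrite mulrC.
Qed.

Lemma innerP x a y z : inner x (a *: y + z) = a * inner x y + inner x z.
Proof.
rewrite /inner mulr_sumr -big_split; apply: eq_bigr => I _.
by rewrite mcoeffD mcoeffZ mulrDr mulrCA.
Qed.

Lemma inner0 x : inner x 0 = 0.
Proof. by rewrite /inner big1 // => I _; rewrite mcoeff0 mulr0. Qed.

Lemma innerZ x a y : inner x (a *: y) = a * inner x y.
Proof. by rewrite -[a *: y]addr0 innerP inner0 addr0. Qed.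

Lemma innerPl a x y z : inner (a *: x + y) z = a * inner x z + inner y z.
Proof. by rewrite !(innerC _ z) innerP. Qed.

Lemma innerZl a x y : inner (a *: x) y = a * inner x y.
Proof. by rewrite !(innerC _ y) innerZ. Qed.

Lemma inner_index x I : inner x (E (val I) vac) = x@_I.
Proof.
rewrite innerC -ewedgeE ewedge_index /inner msuppU oner_eq0 big_seq_fset1.
by rewrite mcoeffUU mul1r.
Qed.

Lemma inner_indexes I K : inner (E (val K) vac) (E (val I) vac) = (K == I)%:R.
Proof. by rewrite inner_index -ewedgeE ewedge_index mcoeffU. Qed.

Lemma inner_eq x y : (forall I, inner x (E (val I) vac) = inner y (E (val I) vac)) ->
  x = y.
Proof. by move=> xy; apply/malgP => I; rewrite -!inner_index. Qed.

Fact iota_key : unit. Proof. by []. Qed.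

Definition contract : nat -> chain k -> chain k := locked_with iota_key (fun a =>
  lin_ext (fun s => if a \in s then (-1) ^+ index a s *: ewedge k (rem a s) else 0)).

Lemma contractP a c x y : contract a (c *: x + y) = c *: contract a x + contract a y.
Proof. by rewrite /contract unlock linearP. Qed.

Lemma contract0 a : contract a 0 = 0.
Proof. by rewrite /contract unlock linear0. Qed.

Lemma contractZ a c x : contract a (c *: x) = c *: contract a x.
Proof. by rewrite -[c *: x]addr0 contractP contract0 addr0. Qed.

Lemma is_index_rem s a : is_index k s -> is_index k (rem a s).
Proof.
move=> /andP[ss ks]; rewrite /is_index (subseq_sorted ltn_trans (rem_subseq a s)) //.
by apply/allP => i /mem_rem; apply: (allP ks).
Qed.

Lemma contract_index a s : is_index k s -> contract a (E s vac) =
  if a \in s then (-1) ^+ index a s *: E (rem a s) vac else 0.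
Proof.
move=> si; rewrite -[s]/(val (Sub s si : chain_index k)) -ewedgeE /contract unlock.
by rewrite lin_ext_index /= ewedgeE.
Qed.

Lemma inner_contract a x y : inner (contract a x) y = inner x (emul a y).
Proof.
elim/chain_emuls_ind: x => [c x z hx hz|K].
  by rewrite contractP !innerPl hx hz.
elim/chain_emuls_ind: y => [c y z hy hz|I].
  by rewrite emulP !innerP hy hz.
rewrite contract_index ?(valP K) //.
have eaI_cases : emul a (E (val I) vac) = 0 \/ exists2 b : bool,
    exists K' : chain_index k, perm_eq (val K') (a :: val I) /\
    emul a (E (val I) vac) = (-1) ^+ b *: E (val K') vac & true.
  rewrite -[emul a _]/(E (a :: val I) vac).
  have [ok|nok] := boolP (uniq (a :: val I) && all (leq k) (a :: val I)); last first.
    by left; apply: emuls_eq0.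
  right; rewrite -is_index_sort in ok.
  have [b bE] := emuls_perm (@emulC k) (permEl (perm_sort leq (a :: val I))).
  exists b => //; exists (Sub _ ok); split; first by rewrite /= perm_sort.
  by rewrite /= bE scalerA -expr2 sqrr_sign scale1r.
have [aK|naK] := boolP (a \in val K); last first.
  rewrite innerC inner0; case: eaI_cases => [->|[b [K' [pK' ->]] _]].
    by rewrite inner0.
  rewrite innerZ inner_indexes; have [KK'|_] := eqVneq K K'; last by rewrite mulr0.
  by rewrite KK' (perm_mem pK') mem_head in naK.
rewrite innerZl.
rewrite -[rem a (val K)]/(val (Sub (rem a (val K)) (is_index_rem a (valP K)) : chain_index k)).
rewrite inner_indexes.
have [remI|ne_rem] := eqVneq (Sub _ _) I.
  have KE := emuls_rem (@emulC k) vac aK.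
  rewrite -[rem a (val K)]/(val (Sub (rem a (val K)) (is_index_rem a (valP K)) : chain_index k)) remI in KE.
  have -> : emul a (E (val I) vac) = (-1) ^+ index a (val K) *: E (val K) vac.
    by rewrite KE scalerA -expr2 sqrr_sign scale1r.
  by rewrite innerZ inner_indexes eqxx.
rewrite mulr0; case: eaI_cases => [->|[b [K' [pK' ->]] _]]; first by rewrite inner0.
rewrite innerZ inner_indexes; have [KK'|_] := eqVneq K K'; last by rewrite mulr0.
case/eqP: ne_rem; apply: val_inj; apply: (irr_sorted_eq ltn_trans ltnn) => /=.
- by have /andP[] := is_index_rem a (valP K).
- by have /andP[] := valP I.
rewrite -KK' in pK'; apply: perm_mem; rewrite -(perm_cons a).
by apply: perm_trans pK'; rewrite perm_sym perm_to_rem.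
Qed.

Lemma inner_emul a x y : inner (emul a x) y = inner x (contract a y).
Proof. by rewrite innerC -inner_contract innerC. Qed.

Local Notation D := (dmul e g).

Fact delta_key : unit. Proof. by []. Qed.

Definition delta : chain k -> chain k :=
  locked_with delta_key (lin_ext (cobd_basis g k)).

Lemma cobdE x : cobd g x = delta x.
Proof. by rewrite /delta unlock. Qed.

Lemma deltaP a x y : delta (a *: x + y) = a *: delta x + delta y.
Proof. by rewrite /delta unlock linearP. Qed.

HB.instance Definition _ :=
  GRing.isLinear.Build rat (chain k) (chain k) _ delta deltaP.

Lemma deltaZ a x : delta (a *: x) = a *: delta x.
Proof. by rewrite -[in LHS](addr0 (a *: x)) deltaP (linear0 delta) addr0. Qed.

Lemma delta_index I : delta (E (val I) vac) = D (val I) vac.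
Proof.
have /andP[sI _] := valP I.
rewrite -ewedgeE /delta unlock lin_ext_index /cobd_basis.
rewrite -(cobd_words g vac (@emulC k) (@emul_small k)); last first.
  exact: sorted_uniq ltn_trans ltnn _ sI.
apply: eq_bigr => r _; apply: eq_bigr => a _; apply: eq_bigr => b _.
by rewrite ewedgeE.
Qed.

Lemma delta_words s : delta (E s vac) = D s vac.
Proof.
have [|] := boolP (uniq s && all (leq k) s); last first.
  move=> nok; rewrite emuls_eq0 // (linear0 delta); move: nok.
  rewrite negb_and => /orP[nu|]; first by rewrite (dmul_dup (@emulC k)).
  rewrite -has_predC => /hasP[i is_]; rewrite /= -ltnNge => lt_ik.
  by rewrite (dmul_small (@emulC k) g (@emul_small k) _ lt_ik is_).
rewrite -is_index_sort => ok.
have [b bE] := emuls_dmul_perm (@emulC k) g (permEl (perm_sort leq s)).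
have [eE dE] := bE vac.
have dI : delta (E (sort leq s) vac) = D (sort leq s) vac.
  exact: (delta_index (Sub (sort leq s) ok)).
have eE' : E s vac = (-1) ^+ b *: E (sort leq s) vac.
  by rewrite eE scalerA -expr2 sqrr_sign scale1r.
have dE' : D s vac = (-1) ^+ b *: D (sort leq s) vac.
  by rewrite dE scalerA -expr2 sqrr_sign scale1r.
rewrite eE' deltaZ dI dE'; reflexivity.
Qed.

Lemma delta_emul i x : delta (emul i x) = umul e g i x - emul i (delta x).
Proof.
elim/chain_emuls_ind: x => [a x y hx hy|I].
  rewrite emulP !deltaP emulP umulP hx hy opprD addrACA scalerBr; reflexivity.
by rewrite (delta_words (i :: val I)) delta_words.
Qed.

Fact bound_key : unit. Proof. by []. Qed.

Definition bound : chain k -> chain k := locked_with bound_key (bd g (k := k)).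

Lemma bdE x : bd g x = bound x.
Proof. by rewrite /bound unlock. Qed.

Lemma boundP a x y : bound (a *: x + y) = a *: bound x + bound y.
Proof. by rewrite /bound unlock linearP. Qed.

Lemma bound_index I : bound (E (val I) vac) = bd_basis g k (val I).
Proof. by rewrite -ewedgeE /bound unlock /bd lin_ext_index. Qed.

Lemma inner_suml (T : Type) (r : seq T) (R : pred T) (F : T -> chain k) z :
  inner (\sum_(i <- r | R i) F i) z = \sum_(i <- r | R i) inner (F i) z.
Proof.
elim/big_rec2: _ => [|i u w _ <-]; first by rewrite innerC inner0.
by rewrite -[X in inner (X + _)]scale1r innerPl mul1r.
Qed.

Lemma inner_bound x y : inner (bound x) y = inner x (delta y).
Proof.
elim/chain_emuls_ind: x => [c x z hx hz|K].
  rewrite boundP innerPl (innerPl c x z) hx hz; reflexivity.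
elim/chain_emuls_ind: y => [c y z hy hz|I].
  rewrite (innerP _ c y z) deltaP innerP hy hz; reflexivity.
rewrite bound_index delta_words.
rewrite -(pr_dmul (@emulC k) g (P := is_index k) innerP innerZl inner_contract
  inner_emul contract_index contractZ _ is_index_rem (valP K) (valP I)); last first.
  by move=> s /andP[ss _]; apply: sorted_uniq ltn_trans ltnn _ ss.
rewrite inner_suml; apply: eq_bigr => r _; rewrite inner_suml.
by apply: eq_bigr => s _; rewrite innerZl ewedgeE.
Qed.

End Pairing.

(** * The dual basis *)

Section Dual.
Variables (V : lmodType rat) (e : nat -> {linear V -> V}).
Hypothesis eC : forall i j x, e i (e j x) = - e j (e i x).
Variables (g : lie_family) (k : nat).
Hypothesis k_gt0 : (0 < k)%N.
Hypothesis e_small : forall i x, (i < k)%N -> e i x = 0.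
Variable delta : {linear V -> V}.
Hypothesis delta_e : forall i x, delta (e i x) = umul e g i x - e i (delta x).
Variable v : V.
Hypothesis delta_v : delta v = 0.
Variable pr : V -> V -> rat.
Hypothesis prC : forall x y, pr x y = pr y x.
Hypothesis prP : forall x a y z, pr x (a *: y + z) = a * pr x y + pr x z.

Local Notation u := (umul e g).
Local Notation E := (emuls e).
Local Notation D := (dmul e g).
Local Notation xi := (xim e g k v).
Implicit Types (x y z : V) (s t : seq nat) (J : {fset nat}) (n m : nat).

Hypothesis pr_index : forall s t, is_index k s -> is_index k t ->
  pr (E s v) (E t v) = (s == t)%:R.
Hypothesis pr_eq0 : forall x, (forall s, is_index k s -> pr x (E s v) = 0) -> x = 0.

Let pr0 x : pr x 0 = 0.
Proof.
have /eqP := prP x 1 0 0; rewrite scaler0 addr0 mul1r.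
by rewrite -subr_eq0 opprD addNKr oppr_eq0 => /eqP.
Qed.

Let prZ x a y : pr x (a *: y) = a * pr x y.
Proof. by rewrite -[a *: y]addr0 prP pr0 addr0. Qed.

Let prD x y z : pr x (y + z) = pr x y + pr x z.
Proof. by rewrite -[y]scale1r prP scale1r mul1r. Qed.

Let prB x y z : pr x (y - z) = pr x y - pr x z.
Proof. by rewrite prD -scaleN1r prZ mulN1r. Qed.

Let pr_sum x (T : Type) (r : seq T) (R : pred T) (F : T -> V) :
  pr x (\sum_(i <- r | R i) F i) = \sum_(i <- r | R i) pr x (F i).
Proof. by elim/big_rec2: _ => // i y z _ <-; rewrite prD. Qed.

Let pr_span0 (T : Type) (P : T -> Prop) (b : T -> V) x y :
  (forall i, P i -> pr x (b i) = 0) -> span_of P b y -> pr x y = 0.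
Proof.
by move=> xb; elim=> [|a t z Pt _ IHz]; rewrite ?pr0 // prP xb // mulr0 add0r.
Qed.

Definition wsp n : V -> Prop :=
  span_of (fun s => is_index k s /\ sumn s = n) (fun s => E s v).

Lemma wsp_emuls s : wsp (sumn s) (E s v).
Proof.
have [us|nus] := boolP (uniq s); last first.
  by rewrite (emuls_dup eC) //; apply: span_of0.
have [ks|] := boolP (all (leq k) s); last first.
  rewrite -has_predC => /hasP[i is_]; rewrite /= -ltnNge => lt_ik.
  rewrite (emuls_mem0 eC _ _ is_); first exact: span_of0.
  by move=> y; apply: e_small.
have [|b ->] := @emuls_perm _ _ eC s (sort leq s); first by rewrite perm_sym perm_sort.
apply: span_ofZ; apply: (@span_of_gen _ _ _ (fun s => E s v)).
rewrite (perm_sumn (permEl (perm_sort leq s))); split=> //.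
by rewrite is_index_sort us ks.
Qed.

Lemma wsp_e n i x : wsp n x -> wsp (i + n) (e i x).
Proof. by apply: span_of_map => s [_ <-]; apply: (wsp_emuls (i :: s)). Qed.

Lemma wsp_umul n i x : wsp n x -> wsp (i + n) (u i x).
Proof.
move=> wx; rewrite umulE; apply/span_ofZ/span_of_sum => -[a lt_a] _ /=.
have := wsp_e a (wsp_e (i - a) wx); rewrite addnA subnKC //.
exact: span_ofZ.
Qed.

Lemma wsp_mon A B : wsp (sumn A + sumn B) (mon e g v (A, B)).
Proof.
have wB : wsp (sumn B) (umuls e g B v).
  by elim: B => [|b B IHB]; [apply: (wsp_emuls [::]) | apply: wsp_umul].
rewrite /mon /=; elim: A => //= a A IHA; rewrite -addnA.
exact: wsp_e.
Qed.

Lemma wsp_fil N f n m x : fil e g v N f n m x -> wsp n x.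
Proof.
elim=> [|a [A B] y [<- _ _] _ wy]; first exact: span_of0.
by apply: span_ofD => //; apply/span_ofZ/wsp_mon.
Qed.

Lemma wsp_xi I J : wsp (sumn I) (xi (I, J)).
Proof.
have sI := congr1 sumn (main_part_normal_form k I); rewrite sumn_cat in sI.
have fx := zmul_fil eC k_gt0 (dense_parts k I) J (vac_fil e g v (sumn I)).
have := fil_emuls k_gt0 (main_part k I) fx; rewrite addn0 sI.
exact: wsp_fil.
Qed.

Lemma delta_emuls_v s : delta (E s v) = D s v.
Proof. by rewrite (delta_emuls delta_e) delta_v linear0 scaler0 addr0. Qed.

Lemma fil_delta N s : fil e g v N true (sumn s) (rk N s).+1 (delta (E s v)).
Proof.
have := fil_dmul eC k_gt0 s (vac_fil e g v N); rewrite addn0 addn1.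
by rewrite delta_emuls_v.
Qed.

Lemma wsp_delta n x : wsp n x -> wsp n (delta x).
Proof.
by apply: span_of_map => s [_ <-]; apply: (wsp_fil (fil_delta 0 s)).
Qed.

Lemma pr_wsp n m x y : n != m -> wsp n x -> wsp m y -> pr x y = 0.
Proof.
move=> nm wx; apply: pr_span0 => t [tk tm]; rewrite prC; move: x wx.
move=> x; apply: pr_span0 => s [sk sn]; rewrite pr_index //.
by have [ts|] := eqVneq t s; first by rewrite -sn -tm ts eqxx in nm.
Qed.

(** A strictly increasing sequence of sum n is a subsequence of 0, ..., n, which makes the basis in
    weight n a finite list. *)
Definition idx n : seq (seq nat) :=
  undup [seq s <- [seq mask (val m) (iota 0 n.+1) | m : (n.+1).-tuple bool] |
    is_index k s && (sumn s == n)].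

Lemma mem_idx n s : (s \in idx n) = is_index k s && (sumn s == n).
Proof.
rewrite mem_undup mem_filter andb_idr // => /andP[/andP[ss ks] /eqP sn].
have /subseqP[m sm ->] : subseq s (iota 0 n.+1).
  have -> : s = [seq i <- iota 0 n.+1 | i \in s].
    apply: (irr_sorted_eq ltn_trans ltnn) => //.
      exact/sorted_filter/iota_ltn_sorted/ltn_trans.
    move=> i; rewrite mem_filter mem_iota /=; case is_: (i \in s) => //=.
    by rewrite ltnS -sn (perm_sumn (perm_to_rem is_)) /= leq_addr.
  exact: filter_subseq.
have mP : size m == n.+1 by rewrite sm size_iota.
by apply/imageP; exists (Tuple mP).
Qed.

Lemma idxP n s : reflect (is_index k s /\ sumn s = n) (s \in idx n).
Proof. by rewrite mem_idx; apply: (iffP andP) => -[? /eqP]. Qed.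

Lemma wsp_idx n (F : seq nat -> rat) : wsp n (\sum_(s <- idx n) F s *: E s v).
Proof.
rewrite big_seq; apply: span_of_sum => s /idxP sn; apply: span_ofZ.
exact: (@span_of_gen _ _ _ (fun s => E s v)).
Qed.

Lemma idx_eq n x y : (forall s, is_index k s -> sumn s != n ->
    pr x (E s v) = pr y (E s v)) ->
  {in idx n, forall s, pr x (E s v) = pr y (E s v)} -> x = y.
Proof.
move=> xy1 xy2; apply/eqP; rewrite -subr_eq0; apply/eqP/pr_eq0 => s sk.
rewrite prC prB ![pr (E s v) _]prC; apply/eqP; rewrite subr_eq0; apply/eqP.
have [sn|] := eqVneq (sumn s) n; last exact: xy1.
by apply: xy2; apply/idxP.
Qed.

Lemma wsp_span_xi n x : wsp n x -> span_of (fun IJ =>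
  distinguished k IJ.1 IJ.2 /\ sumn IJ.1 = n) xi x.
Proof.
apply: (span_of_map (f := idfun)) => s [_ sn] /=.
have := straighten eC k_gt0 e_small delta_e v (A := s) (B := [::]) (N := n).
rewrite addn0 => /(_ sn); apply: span_ofS => -[I J] [dIJ sI _ _].
by split.
Qed.

Section DualMatrix.
Variable n : nat.
Local Notation r := (size (idx n)).
Local Notation T_ i := (nth [::] (idx n) (i : 'I_r)).
Local Notation X :=
  (\matrix_(i < r, j < r) pr (xi (decode (values (T_ i)))) (E (T_ j) v)).

Let T_idx (i : 'I_r) : T_ i \in idx n.
Proof. exact: mem_nth. Qed.

(** By straightening, each e_J of weight n is a combination of distinguished xi(k)-monomials, and
    all of these are among the rows by [decode_values_surj]. A square matrix whose rows span
    everything is invertible. *)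
Lemma xi_matrix_unit : X \in unitmx.
Proof.
rewrite -row_full_unit -sub1mx; apply/row_subP => j; rewrite row1.
pose coords x : 'rV[rat]_r := \row_j pr x (E (T_ j) v).
have coordsP a x y : coords (a *: x + y) = a *: coords x + coords y.
  by apply/rowP => l; rewrite !mxE !(prC _ (E _ v)) prP.
have -> : delta_mx 0 j = coords (E (T_ j) v).
  apply/rowP => l; rewrite !mxE eqxx /=.
  have /idxP[? _] := T_idx j; have /idxP[? _] := T_idx l.
  by rewrite pr_index // nth_uniq ?undup_uniq // eq_sym.
have /idxP[_ jn] := T_idx j; have := wsp_span_xi (wsp_emuls (T_ j)).
rewrite jn; elim=> [|a [I J] y [/= dIJ sI] _ IHy].
  have -> : coords 0 = 0 by apply/rowP => l; rewrite !mxE prC pr0.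
  exact: sub0mx.
rewrite coordsP addmx_sub // scalemx_sub //.
have [s [sk ss sE]] := decode_values_surj k_gt0 dIJ.
have sn : s \in idx n by apply/idxP; rewrite ss.
have lt_s : (index s (idx n) < r)%N by rewrite index_mem.
have -> : coords (xi (I, J)) = row (Ordinal lt_s) X.
  by apply/rowP => l; rewrite !mxE /= nth_index // sE.
exact: row_sub.
Qed.

Lemma dual_exists I J : distinguished k I J -> sumn I = n ->
  exists x, forall I' J', distinguished k I' J' ->
    pr x (xi (I', J')) = ((I == I') && (J == J'))%:R.
Proof.
move=> dIJ sI; have [s [sk ss sE]] := decode_values_surj k_gt0 dIJ.
have sn : s \in idx n by apply/idxP; rewrite ss.
have lt_s : (index s (idx n) < r)%N by rewrite index_mem.
pose i := Ordinal lt_s; pose F t := if insub (index t (idx n)) is Some j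
  then invmx X j i else 0.
exists (\sum_(t <- idx n) F t *: E t v) => I' J' dIJ'.
have [sI'|ne_n] := eqVneq (sumn I') n; last first.
  rewrite (pr_wsp _ (wsp_idx n F) (wsp_xi I' J')); last by rewrite eq_sym.
  by case: eqP => // II'; rewrite -II' sI eqxx in ne_n.
have [s' [sk' ss' sE']] := decode_values_surj k_gt0 dIJ'.
have sn' : s' \in idx n by apply/idxP; rewrite ss'.
have lt_s' : (index s' (idx n) < r)%N by rewrite index_mem.
pose i' := Ordinal lt_s'.
have -> : pr (\sum_(t <- idx n) F t *: E t v) (xi (I', J')) =
    (X *m invmx X) i' i.
  rewrite prC pr_sum mxE (big_nth [::]) big_mkord; apply: eq_bigr => j _.
  rewrite prZ mxE nth_index //= sE' mulrC; congr (_ * _).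
  rewrite /F index_uniq ?undup_uniq //; case: insubP => [l _ jl|].
    by congr (invmx _ _ _); apply: val_inj.
  by rewrite ltn_ord.
rewrite mulmxV ?xi_matrix_unit // mxE -val_eqE /=.
have [ss'E|ne_s] := eqVneq s s'.
  have [-> ->] : (I, J) = (I', J') by rewrite -sE -sE' ss'E.
  by rewrite ss'E !eqxx.
have -> : (index s' (idx n) == index s (idx n)) = false.
  apply/eqP => ii'; case/eqP: ne_s.
  by rewrite -(nth_index [::] sn) -ii' nth_index.
(* Two indices with the same decoded pair would give two equal rows of an invertible matrix: the
   injectivity of the encoding comes from the determinant. *)
case: andP => // -[/eqP II' /eqP JJ'].
have := xi_matrix_unit; rewrite unitmxE.
have -> : \det X = 0; last by rewrite unitr0.
apply: (determinant_alternate (i1 := i) (i2 := i')) => [|j].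
  rewrite -val_eqE /=; apply: contraNneq ne_s => ii'.
  by rewrite -(nth_index [::] sn) ii' nth_index.
by rewrite !mxE /= !nth_index // sE sE' II' JJ'.
Qed.

End DualMatrix.

(** * Stable cycles and homology *)

Variable hat : seq nat -> {fset nat} -> V.
Hypothesis hat_dual : forall I J I' J', distinguished k I J ->
  distinguished k I' J' -> pr (hat I J) (xi (I', J')) = ((I == I') && (J == J'))%:R.
Variable bound : V -> V.
Hypothesis pr_bound : forall x y, pr (bound x) y = pr x (delta y).

Lemma main_distinguished I : is_main k I -> distinguished k I fset0.
Proof. by case/and3P=> kI nI _; rewrite /distinguished kI nI fsub0set. Qed.

Lemma dense_parts_main I : is_main k I -> dense_parts k I = [::].
Proof. by move=> mI; apply/eqP; rewrite dense_parts_nil. Qed.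

Lemma xi_main I : is_main k I -> xi (I, fset0) = E I v.
Proof.
by move=> mI; rewrite /xim /= main_partE // dense_parts_main.
Qed.

Section Stability.
Variables (sg : V -> V) (sgt : {linear V -> V}).
Hypothesis pr_sg : forall x y, pr (sg x) y = pr x (sgt y).
Hypothesis sgt_e : forall i x, sgt (e i x) = e i.-1 (sgt x).
Hypothesis sgt_v : sgt v = v.

(** Lowering both indices by 1 keeps their difference, hence the bracket; for n <= 2 both sides are
    0. *)
Lemma sgt_u n x : sgt (u n x) = u n.-2 (sgt x).
Proof.
have [le_n2|] := leqP n 2.
  by rewrite !(umul_small eC g _ e_small) ?linear0 //; move: k_gt0 le_n2; clear; lia.
case: n => [|[|n]] // _; rewrite !umulE linearZ linear_sum /=; congr (_ *: _).
have e0 x' : e 0%N x' = 0 by apply: e_small.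
rewrite big_ord_recl big_ord_recr /= subnn !e0 !linear0 add0r addr0.
apply: eq_bigr => -[a lt_a] _ /=.
rewrite linearZ /= !sgt_e /bump /= !add1n /= subSS; congr (_ *: e _ (e _ _)).
  by rewrite /brk; congr mu; lia.
by rewrite subSn.
Qed.

Definition ideal : V -> Prop := span_of (fun AB => AB.2 != [::]) (mon e g v).

Lemma ideal_sgt x : ideal x -> ideal (sgt x).
Proof.
apply: span_of_map => -[A B] /= B0; rewrite /mon /=.
have uE C : sgt (umuls e g C v) = umuls e g (map (predn \o predn) C) v.
  by elim: C => //= c C IHC; rewrite sgt_u IHC.
have eE A' y : sgt (E A' y) = E (map predn A') (sgt y).
  by elim: A' => //= a A' IHA; rewrite sgt_e IHA.
rewrite eE uE; apply: (@span_of_gen _ _ _ (mon e g v) (map predn A, _)) => /=.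
by case: (B) B0.
Qed.

Lemma ideal_delta s : ideal (delta (E s v)).
Proof. by apply: span_ofS (fil_delta 0 s) => -[A B] [_ _]. Qed.

Lemma hat_ideal I x : distinguished k I fset0 -> ideal x -> pr (hat I fset0) x = 0.
Proof.
move=> dI; apply: pr_span0 => -[A B] /= B0.
have := straighten eC k_gt0 e_small delta_e v (erefl (sumn A + sumn B)%N).
rewrite B0; apply: pr_span0 => -[I' J'] [/= dI' _ _ J0].
by rewrite hat_dual // [fset0 == _]eq_sym (negPf J0) andbF.
Qed.

Lemma hat_stable I r : distinguished k I fset0 -> bound (iter r sg (hat I fset0)) = 0.
Proof.
move=> dI; apply: pr_eq0 => s _; rewrite pr_bound.
have prE x : pr (iter r sg (hat I fset0)) x = pr (hat I fset0) (iter r sgt x).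
  by elim: r x => //= r IHr x; rewrite pr_sg IHr -iterSr.
rewrite prE hat_ideal //; elim: r {prE} => [|r IHr]; first exact: ideal_delta.
exact: ideal_sgt.
Qed.

End Stability.

Hypothesis hat_cycle : forall I, distinguished k I fset0 -> bound (hat I fset0) = 0.
Hypothesis spanV : forall x, span_of (is_index k) (fun s => E s v) x.

Lemma delta_delta x : delta (delta x) = 0.
Proof.
elim: (spanV x) => [|a s y _ _ IHy]; first by rewrite !linear0.
rewrite !(linearP delta) IHy addr0 delta_emuls_v (delta_dmul eC delta_e).
by rewrite delta_v linear0 !scaler0.
Qed.

Definition nsp n : V -> Prop := span_of (fun IJ =>
  [/\ distinguished k IJ.1 IJ.2, sumn IJ.1 = n & ~~ is_main k IJ.1]) xi.

Lemma msp_nsp n m x : msp e g k v n m x -> nsp n x.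
Proof. by apply: span_ofS => -[I J] [dIJ sI _]; rewrite dense_parts_nil. Qed.

Lemma nsp_msp n x : nsp n x -> exists m, msp e g k v n m x.
Proof.
elim=> [|a [I J] y [/= dIJ sI nmI] _ [m my]]; first by exists 0%N; apply: span_of0.
exists (maxn (rk n I).+1 m); apply: span_of_cons.
  by split=> //=; rewrite ?dense_parts_nil // leq_maxl.
by apply: span_ofS my => -[I' J'] [? ? lt ?]; split=> //; rewrite leq_max lt orbT.
Qed.

Lemma hat_nsp I n x : is_main k I -> nsp n x -> pr (hat I fset0) x = 0.
Proof.
move=> mI; apply: pr_span0 => -[I' J'] [/= dI' _ nmI'].
rewrite hat_dual //; last exact: main_distinguished.
by case: eqP => // II'; rewrite -II' mI in nmI'.
Qed.

Definition labels n : seq (seq nat * {fset nat}) :=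
  undup [seq IJ <- [seq decode (values s) | s <- idx n] |
    distinguished k IJ.1 IJ.2 && (sumn IJ.1 == n)].

Lemma mem_labels IJ : distinguished k IJ.1 IJ.2 -> IJ \in labels (sumn IJ.1).
Proof.
case: IJ => I J /= dIJ; rewrite mem_undup mem_filter /= dIJ eqxx /=.
have [s [sk sI <-]] := decode_values_surj k_gt0 dIJ.
by apply/map_f/idxP; rewrite sI.
Qed.

Lemma labelsP n IJ : IJ \in labels n -> distinguished k IJ.1 IJ.2 /\ sumn IJ.1 = n.
Proof. by rewrite mem_undup mem_filter => /andP[/andP[? /eqP]]. Qed.

(** The linear extension of [homotopy_value], with the coordinates of [x] read off by the dual
    basis. *)
Definition contraction n x : V :=
  \sum_(IJ <- labels n) pr (hat IJ.1 IJ.2) x *: homotopy_value e g k v IJ.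

Lemma contractionP n : linear (contraction n).
Proof.
move=> a x y; rewrite /contraction scaler_sumr -big_split; apply: eq_bigr => IJ _.
by rewrite prP scalerDl scalerA.
Qed.

HB.instance Definition _ n :=
  GRing.isLinear.Build rat V V _ (contraction n) (@contractionP n).

Lemma contraction_xi n IJ : distinguished k IJ.1 IJ.2 -> sumn IJ.1 = n ->
  contraction n (xi IJ) = homotopy_value e g k v IJ.
Proof.
move=> dIJ <-; have LIJ := mem_labels dIJ.
rewrite /contraction (bigD1_seq IJ) ?undup_uniq //=.
case: IJ dIJ LIJ => I J /= dIJ LIJ; rewrite hat_dual // !eqxx scale1r.
rewrite big_seq_cond big1 ?addr0 // => -[I' J'] /andP[/labelsP[/= dIJ' _] ne].
by rewrite hat_dual // -xpair_eqE (negPf ne) scale0r.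
Qed.

Lemma nsp_cocycle n z : nsp n z -> delta z = 0 -> exists2 w, nsp n w & z = delta w.
Proof.
move=> /nsp_msp[m mz] dz.
have [w mw ->] := cocycle_exact eC k_gt0 e_small delta_e (@contraction_xi n)
  delta_v delta_delta mz dz.
by exists w; first exact: msp_nsp mw.
Qed.

(** The cocycle delta e_I lies in the span of the non-main monomials, so it is delta w with w in
    that span, and c = e_I - w. The premise stands under the existential so that choice yields a
    function on all sequences. *)
Lemma main_cocycle_exists I : exists c, is_main k I ->
  delta c = 0 /\ nsp (sumn I) (E I v - c).
Proof.
have [mI|] := boolP (is_main k I); last by exists 0.
have dI := main_distinguished mI.
have fI := main_part_lower eC g k_gt0 e_small v dI (erefl (sumn I)).
rewrite main_partE // dense_parts_main //= in fI.
have nI : nsp (sumn I) (D I v).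
  apply: msp_nsp; apply: xsp_msp; apply: fil_xsp_lower fI => A B sAB _.
  exact: straighten.
have [|w nw wE] := nsp_cocycle nI; first by rewrite -delta_emuls_v delta_delta.
exists (E I v - w) => _; split; last by rewrite subKr.
by rewrite (linearB delta) /= delta_emuls_v wE subrr.
Qed.

Lemma bound_linear a x y : bound (a *: x + y) = a *: bound x + bound y.
Proof.
apply/eqP; rewrite -subr_eq0; apply/eqP/pr_eq0 => s _.
by rewrite prC prB prP !(prC (E s v)) !pr_bound ![pr _ (delta _)]prC prP subrr.
Qed.

Section Cocycles.
Variable C : seq nat -> V.
Hypothesis CP : forall I, is_main k I -> delta (C I) = 0 /\ nsp (sumn I) (E I v - C I).

Lemma hat_main_cocycle I I' : is_main k I -> is_main k I' ->
  pr (hat I' fset0) (C I) = (I' == I)%:R.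
Proof.
move=> mI mI'; have [_ nC] := CP mI; have := hat_nsp mI' nC.
rewrite prB -(xi_main mI) hat_dual; try exact: main_distinguished.
by rewrite eqxx andbT => /eqP; rewrite subr_eq0 => /eqP.
Qed.

(** Pairing with the cocycle [C I] annihilates boundaries and isolates the coefficient of I. *)
Lemma hat_indep (s : seq (seq nat)) (a : seq nat -> rat) y :
  uniq s -> all (is_main k) s ->
  \sum_(I <- s) a I *: hat I fset0 = bound y -> {in s, forall I, a I = 0}.
Proof.
move=> us ms sE I sI; have mI := allP ms I sI; have [dC _] := CP mI.
have : pr (bound y) (C I) = 0 by rewrite pr_bound dC pr0.
rewrite -sE prC pr_sum (bigD1_seq I) //= big_seq_cond big1 => [|I' /andP[sI' ne]].
  by rewrite addr0 prZ prC hat_main_cocycle // eqxx mulr1.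
by rewrite prZ prC hat_main_cocycle ?(allP ms) // (negPf ne) mulr0.
Qed.

(** Modulo the [C I], a cocycle lies in the span of the non-main monomials, hence in the image of
    delta, to which the cycle [x] is orthogonal. *)
Lemma cocycle_orthogonal n x z : bound x = 0 ->
  (forall I, is_main k I -> sumn I = n -> pr x (C I) = 0) ->
  wsp n z -> delta z = 0 -> pr x z = 0.
Proof.
move=> bx xC wz dz.
have [c [xc dc nc]] : exists c, [/\ pr x c = 0, delta c = 0 & nsp n (z - c)].
  elim: (wsp_span_xi wz) => [|a [I J] y [/= dIJ sI] _ [c [xc dc nc]]].
    by exists 0; rewrite pr0 linear0 subr0; split=> //; apply: span_of0.
  have [mI|nmI] := boolP (is_main k I); last first.
    by exists c; split=> //; rewrite -addrA; apply: span_of_cons.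
  have J0 : J = fset0.
    have /and3P[_ _ /fsubsetP JI] := dIJ; apply/eqP/fset0Pn => -[j /JI /imfsetP[b]] /=.
    by rewrite dense_parts_main.
  have [dC nC] := CP mI; exists (a *: C I + c); split.
  - by rewrite prP xC // mulr0 add0r.
  - by rewrite (linearP delta) dC dc scaler0 addr0.
  rewrite J0 xi_main // opprD addrACA -scalerBr -sI; apply: span_ofD.
    exact: span_ofZ.
  by rewrite sI.
have [|w _ wE] := nsp_cocycle nc; first by rewrite (linearB delta) /= dz dc subrr.
by rewrite -[z](subrK c) prD xc wE -pr_bound bx prC pr0 addr0.
Qed.

(** The rows of the matrix M are the coordinates of the d e_J in weight n, and the columns of its
    cokernel are cocycles of delta; orthogonality to these is membership in the row space. *)
Lemma orthogonal_boundary n x :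
  (forall s, is_index k s -> sumn s != n -> pr x (E s v) = 0) ->
  (forall z, wsp n z -> delta z = 0 -> pr x z = 0) -> exists y, x = bound y.
Proof.
move=> xn xker; pose r := size (idx n).
have lt_idx s : s \in idx n -> (index s (idx n) < r)%N by rewrite index_mem.
pose T_ (i : 'I_r) := nth [::] (idx n) i.
have T_idx i : T_ i \in idx n by apply: mem_nth.
pose M := \matrix_(j < r, i < r) pr (delta (E (T_ i) v)) (E (T_ j) v).
pose X : 'rV[rat]_r := \row_j pr x (E (T_ j) v).
have sumE (F : 'I_r -> rat) : exists G : seq nat -> rat,
    (forall i, G (T_ i) = F i) /\
    \sum_(s <- idx n) G s *: E s v = \sum_i F i *: E (T_ i) v.
  exists (fun s => if insub (index s (idx n)) is Some i then F i else 0).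
  have GE (i : 'I_r) :
      (if insub (index (T_ i) (idx n)) is Some i then F i else 0) = F i.
    by rewrite index_uniq ?undup_uniq // valK.
  by split=> //; rewrite (big_nth [::]) big_mkord; apply: eq_bigr => i _; rewrite GE.
have /submxP[Y YE] : (X <= M)%MS.
  rewrite submxE; apply/eqP/rowP => c; rewrite !mxE.
  have [G [GT GE]] := sumE (fun j => cokermx M j c).
  have wz := wsp_idx n G; rewrite GE in wz.
  have -> : \sum_j X 0 j * cokermx M j c = pr x (\sum_j cokermx M j c *: E (T_ j) v).
    by rewrite pr_sum; apply: eq_bigr => j _; rewrite prZ mxE mulrC.
  apply: (xker _ wz); apply: (@idx_eq n) => [s sk sn|s sn].
    rewrite (pr_wsp _ (wsp_delta wz) (wsp_emuls s)); last by rewrite eq_sym.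
    by rewrite prC pr0.
  pose j := Ordinal (lt_idx s sn).
  have TjE : T_ j = s by rewrite /T_ nth_index.
  have := congr1 (fun A : 'M_r => A j c) (mulmx_coker M); rewrite !mxE => MK.
  rewrite [RHS]prC pr0 -[RHS]MK -TjE prC linear_sum pr_sum; apply: eq_bigr => i _.
  by rewrite linearZ prZ mulrC prC [M j i]mxE.

have [G [GT GE]] := sumE (fun i => Y 0 i).
exists (\sum_(s <- idx n) G s *: E s v); apply: (@idx_eq n) => [s sk sn|s sn].
  rewrite xn // pr_bound (pr_wsp _ (wsp_idx n G) (wsp_delta (wsp_emuls s))) //.
  by rewrite eq_sym.
pose j := Ordinal (lt_idx s sn).
have TjE : T_ j = s by rewrite /T_ nth_index.
have := congr1 (fun A : 'rV_r => A 0 j) YE; rewrite !mxE TjE => ->.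
rewrite pr_bound GE prC pr_sum; apply: eq_bigr => i _.
by rewrite prZ mxE TjE prC.
Qed.

Lemma main_index I : is_main k I -> is_index k I.
Proof.
case/and3P=> kI nI _; rewrite /is_index kpartition_all // andbT.
by apply: sub_sorted nI => i j; apply: leq_trans; rewrite addnS ltnS leq_addr.
Qed.

(** The coefficients of the hat e_I are forced by pairing with the [C I]; the difference is then
    orthogonal to all cocycles of weight n, hence a boundary. *)
Lemma pure_cycle n x : wsp n x -> bound x = 0 -> exists2 z,
  span_of (is_main k) (fun I => hat I fset0) z & exists y, x = z + bound y.
Proof.
move=> wx bx; pose z := \sum_(I <- idx n | is_main k I) pr x (C I) *: hat I fset0.
exists z.
  apply: span_of_sum => I mI; apply: span_ofZ.
  exact: (@span_of_gen _ _ _ (fun I => hat I fset0)).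
have bz : bound (x - z) = 0.
  rewrite addrC -scaleN1r bound_linear bx addr0 /z.
  suff -> : bound z = 0 by rewrite scaler0.
  rewrite /z; elim/big_rec: _ => [|I y mI by0].
    by apply: pr_eq0 => s _; rewrite pr_bound prC pr0.
  by rewrite bound_linear by0 addr0 hat_cycle ?scaler0 //; apply: main_distinguished.
have [y yE] : exists y, x - z = bound y; last by exists y; rewrite -yE addrC subrK.
apply: (@orthogonal_boundary n) => [s sk sn|z' wz' dz'].
  rewrite prC prB (pr_wsp _ (wsp_emuls s) wx) // sub0r pr_sum big_seq_cond.
  rewrite big1 ?oppr0 // => I /andP[/idxP[_ sI] mI]; rewrite prZ [pr (E s v) _]prC.
  rewrite (_ : pr _ (E s v) = 0) ?mulr0 //.
  apply: pr_span0 (wsp_span_xi (wsp_emuls s)) => -[I' J'] [/= dI' sI'].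
  rewrite hat_dual //; last exact: main_distinguished.
  by case: eqP => // II'; rewrite -sI' -II' sI eqxx in sn.
apply: (cocycle_orthogonal bz _ wz' dz') => I mI sI.
have In : I \in idx n by apply/idxP; rewrite main_index.
rewrite prC prB pr_sum big_mkcond (bigD1_seq I) ?undup_uniq //= mI.
rewrite big1 => [|I' ne].
  by rewrite addr0 prZ prC [pr (C I) _]prC hat_main_cocycle // eqxx mulr1 subrr.
case: ifP => // mI'; rewrite prZ [pr (C I) _]prC hat_main_cocycle //.
by rewrite (negPf ne) mulr0.
Qed.

(** The components of a cycle are cycles since d preserves the weight; the splitting reduces to
    [pure_cycle], where finite matrices are available. *)
Lemma weights_cycle (ws : seq nat) x :
  span_of (fun s => is_index k s /\ sumn s \in ws) (fun s => E s v) x ->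
  bound x = 0 ->
  exists2 z, span_of (is_main k) (fun I => hat I fset0) z & exists y, x = z + bound y.
Proof.
elim: ws x => [|n ws IHws] x wx bx.
  case: wx => [|a s y [] //]; exists 0; first exact: span_of0.
  exists 0; have := bound_linear (-1) 0 0; rewrite scaler0 addr0 scaleN1r addNr => ->.
  by rewrite addr0.
have [a [b [wa wb xE]]] : exists a b, [/\ wsp n a, span_of (fun s =>
    [/\ is_index k s, sumn s \in ws & sumn s != n]) (fun s => E s v) b & x = a + b].
  elim: wx => [|c s y [sk sws] _ [a [b [wa wb ->]]]].
    by exists 0, 0; rewrite addr0; split=> //; apply: span_of0.
  have [sn|ne_n] := eqVneq (sumn s) n.
    exists (c *: E s v + a), b; rewrite addrA; split=> //.
    exact: span_of_cons.
  exists a, (c *: E s v + b); rewrite addrCA; split=> //; apply: span_of_cons => //.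
  by split=> //; move: sws; rewrite in_cons (negPf ne_n).
have ba : bound a = 0.
  apply: pr_eq0 => s sk; have [sn|ne_n] := eqVneq (sumn s) n; last first.
    by rewrite pr_bound (pr_wsp _ wa (wsp_delta (wsp_emuls s))) // eq_sym.
  have : pr (E s v) (bound x) = 0 by rewrite bx pr0.
  rewrite xE -[a]scale1r bound_linear !scale1r prD ![pr (E s v) _]prC !pr_bound.
  suff -> : pr b (delta (E s v)) = 0 by rewrite addr0.
  rewrite prC; apply: pr_span0 wb => t [tk _ tn]; rewrite prC.
  apply: pr_wsp (wsp_emuls t) (wsp_delta (wsp_emuls s)).
  by rewrite sn.
have bb : bound b = 0 by rewrite xE -[a]scale1r bound_linear ba scaler0 add0r in bx.
have [za sza [ya aE]] := pure_cycle wa ba.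
have [|zb szb [yb bE]] := IHws b _ bb; first by apply: span_ofS wb => s [].
exists (za + zb); first exact: span_ofD.
exists (ya + yb); rewrite xE aE bE -[ya in RHS]scale1r bound_linear scale1r.
by rewrite addrACA.
Qed.

Lemma cycle_decomposition x : bound x = 0 ->
  exists2 z, span_of (is_main k) (fun I => hat I fset0) z & exists y, x = z + bound y.
Proof.
suff [ws wx] : exists ws : seq nat, span_of (fun s => is_index k s /\ sumn s \in ws)
    (fun s => E s v) x by apply: weights_cycle wx.
elim: (spanV x) => [|a s y sk _ [ws wy]]; first by exists [::]; apply: span_of0.
exists (sumn s :: ws); apply: span_of_cons; first by rewrite mem_head.
by apply: span_ofS wy => t [tk tws]; rewrite in_cons tws orbT.
Qed.

End Cocycles.

End Dual.

(** * Application to the chain complex *)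

Section Concrete.
Variables (g : lie_family) (k : nat).
Implicit Types (x y : chain k) (s t : seq nat) (I K : chain_index k).

Local Notation e := (fun i => emul i : {linear chain k -> chain k}).
Local Notation E := (emuls e).
Local Notation vac := (vac k).

Lemma wedge_sum (T : Type) (r : seq T) (P : pred T) (F : T -> chain k) y :
  wedge (\sum_(i <- r | P i) F i) y = \sum_(i <- r | P i) wedge (F i) y.
Proof.
elim/big_rec2: _ => [|i u w _ <-]; first exact: wedge0.
by rewrite -[X in wedge (X + _)]scale1r wedgeP scale1r.
Qed.

Lemma wedge_umul n x y : wedge (umul e g n x) y = umul e g n (wedge x y).
Proof.
rewrite !umulE wedgeZ wedge_sum; congr (_ *: _); apply: eq_bigr => a _.
by rewrite wedgeZ !wedge_emul.
Qed.

Lemma wedge_dmul s x y : wedge (dmul e g s x) y = dmul e g s (wedge x y).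
Proof.
have wE t z : wedge (E t z) y = E t (wedge z y).
  by elim: t => //= i t IHt; rewrite wedge_emul IHt.
elim: s => [|i s IHs]; first exact: wedge0.
rewrite !dmul_cons addrC -scaleN1r wedgeP wedge_umul wE.
by rewrite wedge_emul IHs scaleN1r addrC.
Qed.

Lemma xiE (I : seq nat) (J : {fset nat}) : xi g k I J = xim e g k vac (I, J).
Proof.
rewrite /xi /xim /= ewedgeE wedge_emuls; congr (E _ _).
elim: (dense_parts k I) => [|b bs IHbs]; first by rewrite /= ewedgeE.
have -> : zmul e g (b :: bs) J vac = if head 0%N b \in J
  then dmul e g b (zmul e g bs J vac) else E b (zmul e g bs J vac) by [].
move: (zmul e g bs J vac) IHbs => Z IHbs.
rewrite map_cons [LHS]/= [foldr _ _ _]IHbs; case: ifP => _.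
  by rewrite ewedgeE cobdE delta_words wedge_dmul (wedge_emuls [::]).
by rewrite ewedgeE wedge_emuls.
Qed.

Lemma inner_words s t : is_index k s -> is_index k t ->
  inner (E s vac) (E t vac) = (s == t)%:R.
Proof. by move=> si ti; apply: (etrans (inner_indexes (Sub t ti) (Sub s si))). Qed.

Fact shift_key : unit. Proof. by []. Qed.

Definition lshift : chain k -> chain k := locked_with shift_key (@shift k).

(** The adjoint of [shift]: a part k becomes k - 1, and [ewedge] then makes the word 0. *)
Definition unshift : chain k -> chain k :=
  locked_with shift_key (lin_ext (fun s => ewedge k (map predn s))).

Lemma lshiftP a x y : lshift (a *: x + y) = a *: lshift x + lshift y.
Proof. by rewrite /lshift unlock /shift linearP. Qed.

Lemma unshiftP a x y : unshift (a *: x + y) = a *: unshift x + unshift y.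
Proof. by rewrite /unshift unlock linearP. Qed.

HB.instance Definition _ :=
  GRing.isLinear.Build rat (chain k) (chain k) _ unshift unshiftP.

Lemma unshiftZ a x : unshift (a *: x) = a *: unshift x.
Proof. by rewrite -[in LHS](addr0 (a *: x)) unshiftP (linear0 unshift) addr0. Qed.

Lemma lshift_index I : lshift (E (val I) vac) = E (map succn (val I)) vac.
Proof. by rewrite -!ewedgeE /lshift unlock /shift lin_ext_index. Qed.

Lemma unshift_index I : unshift (E (val I) vac) = E (map predn (val I)) vac.
Proof. by rewrite -!ewedgeE /unshift unlock lin_ext_index. Qed.

Hypothesis k_gt0 : (0 < k)%N.

Lemma inner_lshift x y : inner (lshift x) y = inner x (unshift y).
Proof.
elim/chain_emuls_ind: x => [c x z hx hz|K].
  rewrite lshiftP innerPl (innerPl c x z) hx hz; reflexivity.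
elim/chain_emuls_ind: y => [c y z hy hz|I].
  rewrite (innerP _ c y z) unshiftP innerP hy hz; reflexivity.
rewrite lshift_index unshift_index.
have /andP[sK kK] := valP K; have /andP[sI kI] := valP I.
have sucK : is_index k (map succn (val K)).
  rewrite /is_index; apply/andP; split.
    by rewrite sorted_map; apply: sub_sorted sK => i j.
  by rewrite all_map; apply: sub_all kK => i /= /leqW.
have [predI|npredI] := boolP (is_index k (map predn (val I))).
  rewrite (inner_words sucK (valP I)) (inner_words (valP K) predI).
  congr (_%:R); congr nat_of_bool.
  have I_gt0 : all (leq 1) (val I) by apply: sub_all kI => i; apply: leq_trans.
  apply/eqP/eqP => [<-|->]; rewrite -map_comp ?map_id_in // => i Ii /=.
  by rewrite prednK // (allP I_gt0).
rewrite [RHS]innerC (emuls_eq0 (s := map predn _)); last first.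
  apply: contra npredI => /andP[u1 k1]; rewrite /is_index k1 andbT.
  rewrite ltn_sorted_uniq_leq u1 sorted_map.
  by apply: sub_sorted sI => i j /= /ltnW le_ij; rewrite -!subn1 leq_sub2r.
rewrite (inner_words sucK (valP I)) innerC inner0.
case: eqP => // IE; case/negP: npredI.
by rewrite -IE -map_comp map_id (valP K).
Qed.

Lemma unshift_words s : unshift (E s vac) = E (map predn s) vac.
Proof.
have [|] := boolP (uniq s && all (leq k) s); last first.
  move=> nok; rewrite emuls_eq0 // (linear0 unshift) emuls_eq0 //.
  move: nok; rewrite !negb_and => /orP[nu|].
    by apply/orP; left; apply: contra nu; apply: map_uniq.
  rewrite -has_predC => /hasP[i is_ lt_ik]; apply/orP; right.
  rewrite -has_predC has_map; apply/hasP; exists i => //=; move: lt_ik.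
  by rewrite /= -!ltnNge; apply: leq_ltn_trans; apply: leq_pred.
move=> ok; have /andP[_ ks] := ok; rewrite -is_index_sort in ok.
have dI : unshift (E (sort leq s) vac) = E (map predn (sort leq s)) vac.
  exact: (unshift_index (Sub (sort leq s) ok)).
have invE : inversions (map predn s) = inversions s.
  elim: s ks {ok dI} => //= i s IHs /andP[ki ks]; rewrite IHs // count_map.
  congr (_ + _)%N; apply: eq_in_count => j /(allP ks) kj /=.
  by move: k_gt0 ki kj; clear; lia.
have sE : sort leq (map predn s) = map predn (sort leq s).
  apply: (sorted_eq leq_trans anti_leq); first exact: (sort_sorted leq_total).
    rewrite sorted_map; apply: sub_sorted (sort_sorted leq_total s) => i j le_ij.
    by rewrite /= -!subn1 leq_sub2r.
  by rewrite perm_sort perm_map // perm_sym perm_sort.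
rewrite (emuls_vac_sort k s) (emuls_vac_sort k (map predn s)) unshiftZ dI invE sE.
reflexivity.
Qed.

Lemma unshift_emul i x : unshift (emul i x) = emul i.-1 (unshift x).
Proof.
elim/chain_emuls_ind: x => [a x y hx hy|I].
  by rewrite emulP !unshiftP hx hy emulP.
rewrite unshift_words; exact: (unshift_words (i :: val I)).
Qed.

Lemma unshift_vac : unshift vac = vac.
Proof. exact: (unshift_words [::]). Qed.

Lemma delta_vac : delta g vac = 0.
Proof. exact: (@delta_words g k [::]). Qed.

Lemma inner_eq0 x : (forall s, is_index k s -> inner x (E s vac) = 0) -> x = 0.
Proof.
by move=> x0; apply: inner_eq => I; rewrite x0 ?(valP I) // innerC inner0.
Qed.

Lemma chain_span x : span_of (is_index k) (fun s => E s vac) x.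
Proof.
elim/chain_emuls_ind: x => [a x y sx sy|I].
  by apply: span_ofD => //; apply: span_ofZ.
exact/(@span_of_gen _ _ _ (fun s => E s vac))/valP.
Qed.

(** [dual_exists] supplies a witness, so the choice in [xihat] never falls back to its default. *)
Lemma xihat_dual (I : seq nat) J (I' : seq nat) J' :
  distinguished k I J -> distinguished k I' J' ->
  inner (xihat g k I J) (xim e g k vac (I', J')) = ((I == I') && (J == J'))%:R.
Proof.
move=> dIJ dIJ'; rewrite -xiE; suff : is_dual g I J (xihat g k I J) by apply.
have [x xdual] := dual_exists (@emulC k) k_gt0 (@emul_small k) (@delta_emul g k)
  (@innerC k) (@innerP k) inner_words dIJ (erefl (sumn I)).
apply: classical_sets.xgetPex; exists x => I'' J'' dIJ''.
by rewrite xiE xdual.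
Qed.

Lemma ehat_stable (I : seq nat) : is_main k I -> stable_cycle g (ehat g k I).
Proof.
move=> mI r; rewrite bdE -(eq_iter (f := lshift)); last first.
  by move=> x; rewrite /lshift unlock.
exact: (hat_stable (@emulC k) k_gt0 (@emul_small k) (@delta_emul g k) delta_vac
  (@innerP k) inner_eq0 xihat_dual (@inner_bound g k) inner_lshift unshift_emul
  unshift_vac r (main_distinguished mI)).
Qed.

End Concrete.

Local Open Scope quotient_scope.

(** * Homology classes and the final statement *)

Section Classes.
Variables (g : lie_family) (k : nat).

Lemma hclass_eq (x y : chain k) (hx : bd g x = 0) (hy : bd g y = 0) :
  hclass hx = hclass hy <-> exists z, x - y = bd g z.
Proof.
rewrite /hclass; split=> [|[z zE]].
  by move=> /eqP; rewrite -Quotient.idealrBE => /boolp.asboolP[z]; exists z.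
by apply/eqP; rewrite -Quotient.idealrBE; apply/boolp.asboolP; exists z.
Qed.

Lemma hclass0 (h0 : bd g (0 : chain k) = 0) : hclass h0 = 0.
Proof.
rewrite /hclass; have -> : Cycle (introT eqP h0 : 0 \in is_cycle g (k := k)) = 0.
  exact: val_inj.
exact: raddf0.
Qed.

Lemma hclass_surj (h : homology g k) : exists x (hx : bd g x = 0), h = hclass hx.
Proof.
rewrite -[h]reprK; case: (repr h) => x px.
exists x, (eqP px); rewrite /hclass; congr (\pi_(homology g k) _).
exact: val_inj.
Qed.

Lemma hclass_sum (T : Type) (s : seq T) (a : T -> rat) (x : T -> chain k)
    (hx : forall t, bd g (x t) = 0) :
  exists hz : bd g (\sum_(t <- s) a t *: x t) = 0,
    \sum_(t <- s) a t *: hclass (hx t) = hclass hz.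
Proof.
pose c t := Cycle (introT eqP (hx t) : x t \in is_cycle g (k := k)).
have hz : bd g (\sum_(t <- s) a t *: x t) = 0.
  rewrite linear_sum big1 // => t _.
  by rewrite linearZ /= hx scaler0.
exists hz; rewrite /hclass.
have -> : Cycle (introT eqP hz : _ \in is_cycle g (k := k)) = \sum_(t <- s) a t *: c t.
  apply: val_inj; rewrite [RHS]raddf_sum; apply: eq_bigr => t _; reflexivity.
rewrite raddf_sum; apply: eq_bigr => t _.
exact: pi_homology_scale.
Qed.

End Classes.

(** Repeated generators are merged on the way: the list stays duplicate-free and the coefficients
    stay 0 outside it. *)
Lemma span_main_sum k (V : lmodType rat) (F : seq nat -> V) z :
  span_of (is_main k) F z ->
  exists (s : seq (main_partition k)) (a : main_partition k -> rat),
    z = \sum_(t <- s) a t *: F (val t).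
Proof.
move=> Fz; suff [s [a [_ _ ->]]] : exists (s : seq (main_partition k)) a,
    [/\ uniq s, forall t, t \notin s -> a t = 0 & z = \sum_(t <- s) a t *: F (val t)].
  by exists s, a.
elim: Fz => [|c I y mI _ [s [a [us a0 ->]]]].
  by exists [::], (fun=> 0); split=> //; rewrite big_nil.
pose t0 : main_partition k := Sub I mI; pose s' := if t0 \in s then s else t0 :: s.
have us' : uniq s' by rewrite /s'; case: ifP => //= ->.
have t0s' : t0 \in s' by rewrite /s'; case: ifP => //; rewrite mem_head.
exists s', (fun t => c * (t == t0)%:R + a t); split=> // [t ts'|].
  have ne : t != t0 by apply: contraNneq ts' => ->.
  rewrite (negPf ne) mulr0 add0r a0 //; apply: contra ts'; rewrite /s'.
  by case: ifP => // _ ts; rewrite in_cons ts orbT.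
under [RHS]eq_bigr do rewrite scalerDl.
rewrite [RHS]big_split /=; congr (_ + _).
  rewrite (bigD1_seq t0) //= eqxx mulr1 big1 ?addr0 // => t /negPf ->.
  by rewrite mulr0 scale0r.
rewrite /s'; case: ifPn => // t0s; rewrite big_cons a0 //.
by rewrite scale0r add0r.
Qed.

Theorem corollary6p1 (k : nat) (hk : (1 <= k)%N) (g : lie_family) :
  exists hcyc : forall I : main_partition k, stable_cycle g (ehat g k (val I)),
    is_basis (fun I : main_partition k => hclass (hcyc I 0%N)).
Proof.
have hcyc (I : main_partition k) : stable_cycle g (ehat g k (val I)).
  by apply: ehat_stable => //; apply: valP.
exists hcyc.
have hat_dual := @xihat_dual g k hk.
have hat_cycle I : distinguished k I fset0 -> bound g (xihat g k I fset0) = 0.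
  move=> dI; exact: (hat_stable (@emulC k) hk (@emul_small k) (@delta_emul g k)
    (delta_vac g k) (@innerP k) (@inner_eq0 k) hat_dual (@inner_bound g k)
    (inner_lshift hk) (unshift_emul hk) (unshift_vac hk) 0 dI).
have [C CP] := boolp.choice (main_cocycle_exists (@emulC k) hk (@emul_small k)
  (@delta_emul g k) (delta_vac g k) (@innerP k) hat_dual (@chain_span k)).
split=> [s a us s0 t ts|h].
  have [hz] := hclass_sum s a (fun I => hcyc I 0%N); rewrite s0.
  have h0 : bd g (0 : chain k) = 0 by rewrite linear0.
  rewrite -(hclass0 h0) => /esym/hclass_eq[y]; rewrite subr0 bdE => sE.
  (* The coefficients are extended by 0 to all sequences, which is the form used in [hat_indep]. *)
  pose b I := if insub I is Some t' then a t' else 0.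
  have := @hat_indep _ _ _ _ _ _ _ (@innerC k) (@innerP k) _ hat_dual _
    (@inner_bound g k) C CP (map val s) b y.
  rewrite map_inj_uniq => [/(_ us)|]; last exact: val_inj.
  rewrite all_map big_map => bs0; have <- : b (val t) = a t by rewrite /b valK.
  apply: bs0; last exact: map_f.
    by apply/allP => t' _; apply: valP.
  by rewrite -sE; apply: eq_bigr => t' _; rewrite /b valK.
have [x [hx ->]] := hclass_surj h.
have bx : bound g x = 0 by rewrite -bdE.
have [z] := cycle_decomposition (@emulC k) hk (@emul_small k) (@delta_emul g k)
  (delta_vac g k) (@innerC k) (@innerP k) (@inner_words k) (@inner_eq0 k) hat_dual
  (@inner_bound g k) hat_cycle (@chain_span k) CP bx.
move=> /span_main_sum[s [a ->]] [y xE]; exists s, a.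
have [hz ->] := hclass_sum s a (fun I => hcyc I 0%N).
apply/hclass_eq; exists y; rewrite bdE xE addrC addKr.
reflexivity.
Qed.
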